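(* Let $M$ be a compact connected $C^2$ closed Riemannian manifold and let $G,H$ be two Poisson commuting Tonelli Hamiltonians on $T^*M$. Let $C_G\subset H^1(M,\mathbb{R})$ be a flat of $\alpha_G$ (on which $\alpha_G$ is therefore constant). Then $C_G$ is also a flat of $\alpha_H$.
   Context: A Hamiltonian $H:T^*M\to\mathbb{R}$ is Tonelli if it is $C^2$ and: (1) for every $K>0$ there is $C^*(K)\in\mathbb{R}$ with $H(x,p)\geqslant K\|p\|-C^*(K)$ for all $(x,p)\in T^*M$; (2) for every $R\geqslant 0$, $\sup\{H(x,p):\|p\|\leqslant R\}<+\infty$; (3) for every $(x,p)\in T^*M$ the second fiber derivative $\partial^2H/\partial p^2(x,p)$ is positive definite. $T^*M$ carries the symplectic form $\Omega=-d\lambda$, $\lambda$ the canonical Liouville form; the Hamiltonian vector field $X_H$ is defined by $\Omega(X_H(x,p),\cdot)=d_{(x,p)}H$. $G$ and $H$ Poisson commute if $\Omega(X_G,X_H)$ vanishes everywhere. The Lagrangian is $L_H(x,v)=\max_{p\in T_x^*M}\big(p(v)-H(x,p)\big)$. A function $u:M\to\mathbb{R}$ is an $(\alpha,H)$-subsolution if $u(y)-u(x)\leqslant\inf_\gamma\int_0^tL_H(\gamma,\dot\gamma)\,d\sigma+t\alpha$ for all $x,y\in M$, $t\geqslant0$, the infimum being over absolutely continuous $\gamma:[0,t]\to M$ with $\gamma(0)=x$, $\gamma(t)=y$. The critical value of $H$ is the smallest $\alpha\in\mathbb{R}$ for which $(\alpha,H)$-subsolutions exist. For a closed $1$-form $\omega$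 on $M$, $H_\omega(x,p)=H(x,p+\omega_x)$ is again Tonelli and its critical value depends only on the cohomology class $[\omega]\in H^1(M,\mathbb{R})$; it is denoted $\alpha_H[\omega]$. This defines Mather's function $\alpha_H:H^1(M,\mathbb{R})\to\mathbb{R}$, which is convex and superlinear; $\alpha_G$ is defined in the same way. A flat of $\alpha_H$ is a convex set $C\subset H^1(M,\mathbb{R})$ on which $\alpha_H$ is affine, i.e. $\alpha_H(tc_0+(1-t)c_1)=t\alpha_H(c_0)+(1-t)\alpha_H(c_1)$ for all $c_0,c_1\in C$ and $t\in(0,1)$. It is known (Massart, Bernard) that $\alpha_H$ is then constant on $C$. *)

(* Defs.v *)
From HB Require Import structures.
From mathcomp Require Import all_boot all_order all_algebra.
From mathcomp Require Import generic_quotient ring_quotient.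
From mathcomp Require Import all_classical all_reals all_analysis.

Set Implicit Arguments.
Unset Strict Implicit.
Unset Printing Implicit Defensive.

Import Order.TTheory GRing.Theory Num.Theory.
Import numFieldNormedType.Exports.
Local Open Scope classical_set_scope.
Local Open Scope ring_scope.

(* f is of class C^k on the set U, which is open in all uses.  In finite
   dimension this is the usual notion: x |-> 'd f x is continuous iff
   x |-> 'D_v f x is for every v. *)
Fixpoint Ck (R : realType) (V W : normedModType R) (k : nat) (f : V -> W)
    (U : set V) : Prop :=
  match k with
  | 0%N => forall x, U x -> {for x, continuous f}
  | k'.+1 => (forall x, U x -> differentiable f x) /\
             (forall v, Ck k' (fun x => 'D_v f x) U)
  end.

Definition pairing (R : realType) (n : nat) (p v : 'rV[R]_n) : R :=
  \sum_(k < n) p ord0 k * v ord0 k.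

(* A C^2 structure (without boundary) of dimension n on M.  The total functions
   [chart i] and [param i] are only meaningful on [dom i] and on its image,
   where they are mutually inverse.  As any atlas can be so presented,
   every point x comes with a preferred chart [chart_at x]: tangent vectors and
   covectors at x are stored as their coordinates in that chart. *)
Record c2atlas (R : realType) (n : nat) (M : topologicalType) := C2Atlas {
  chart_index : Type;
  dom : chart_index -> set M;
  chart : chart_index -> M -> 'rV[R]_n;
  param : chart_index -> 'rV[R]_n -> M;
  chart_at : M -> chart_index;
  dom_open : forall i, open (dom i);
  cod_open : forall i, open (chart i @` dom i);
  chartK : forall i x, dom i x -> param i (chart i x) = x;
  chart_continuous : forall i x, dom i x -> {for x, continuous (chart i)};
  param_continuous : forall i q, (chart i @` dom i) q ->
    {for q, continuous (param i)};
  dom_chart_at : forall x, dom (chart_at x) x;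
  transition_C2 : forall i j,
    Ck 2 (chart j \o param i) (chart i @` (dom i `&` dom j)) }.

(* (x, p) is the covector at x whose coordinates in the chart [chart_at x] are
   p.  The product topology on this type plays no role: regularity is always
   read in the charts [cotangent_param i] below. *)
Definition cotangent_bundle (R : realType) (n : nat) (M : topologicalType)
    (A : c2atlas R n M) : Type := (M * 'rV[R]_n)%type.

Section bundles.
Context {R : realType} {n : nat} {M : topologicalType} (A : c2atlas R n M).
Local Notation vec := 'rV[R]_n.

Definition cod (i : chart_index A) : set vec := chart i @` dom i.

(* Differential at q of the change of coordinates from the chart i to the
   preferred chart at the point param i q; it acts on row vectors on the
   right. *)
Definition to_preferred (i : chart_index A) (q : vec) : 'M[R]_n :=
  'J (chart (chart_at A (param i q)) \o param i) q.

(* The tangent vector at param i q with coordinates v in the chart i. *)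
Definition tangent_param (i : chart_index A) (q v : vec) : vec :=
  v *m to_preferred i q.

(* The canonical chart of the cotangent bundle induced by the chart i:
   coordinates (q, p) |-> covector.  The change of coordinates of covectors is
   the inverse transpose of that of vectors, and it is computed here from the
   inverse change of coordinates. *)
Definition cotangent_param (i : chart_index A) (z : vec * vec) :
    cotangent_bundle A :=
  let x := param i z.1 in
  (x, z.2 *m ('J (chart i \o param (chart_at A x)) (chart (chart_at A x) x))^T).

Definition cotangent_cod (i : chart_index A) : set (vec * vec) :=
  [set z | cod i z.1].

(* A Riemannian metric, given by its Gram matrices in the preferred charts.
   On a C^2 manifold it cannot be asked to be more than C^1. *)
Record riemannian_metric := RiemannianMetric {
  gram : M -> 'M[R]_n;
  gram_sym : forall x, (gram x)^T = gram x;
  gram_posdef : forall x (v : vec), v != 0 -> 0 < (v *m gram x *m v^T) ord0 ord0;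
  gram_C1 : forall i (v w : vec),
    Ck 1 (fun q => (tangent_param i q v *m gram (param i q) *m
                    (tangent_param i q w)^T) ord0 ord0) (cod i) }.

Definition tangent_norm (g : riemannian_metric) (x : M) (v : vec) : R :=
  Num.sqrt ((v *m gram g x *m v^T) ord0 ord0).

Definition cotangent_norm (g : riemannian_metric) (x : M) (p : vec) : R :=
  sup [set pairing p v | v in [set v | tangent_norm g x v <= 1]].

Definition tonelli (g : riemannian_metric) (H : cotangent_bundle A -> R) : Prop :=
  [/\ forall i, Ck 2 (H \o cotangent_param i) (cotangent_cod i),
      forall K : R, 0 < K -> exists C : R, forall x p,
        K * cotangent_norm g x p - C <= H (x, p),
      forall r : R, 0 <= r ->
        has_ubound [set H z | z in [set z | cotangent_norm g z.1 z.2 <= r]]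
    & forall x (p v : vec), v != 0 ->
        0 < 'D_v (fun p' => 'D_v (fun p'' => H (x, p'')) p') p].

(* Canonical forms on the cotangent bundle, in the chart [cotangent_param i]:
   their expression, lambda = sum_k p_k dq_k and Omega = - d lambda, is the same
   for every i.  The exterior derivative is evaluated on constant vector
   fields. *)
Definition liouville (z Y : vec * vec) : R := pairing z.2 Y.1.

Definition Omega (z X Y : vec * vec) : R :=
  - ('D_X (fun z' => liouville z' Y) z - 'D_Y (fun z' => liouville z' X) z).

(* X is the value at z, in the chart [cotangent_param i], of the Hamiltonian
   vector field of H. *)
Definition hamiltonian_vector (H : cotangent_bundle A -> R) (i : chart_index A)
    (z X : vec * vec) : Prop :=
  forall Y : vec * vec, Omega z X Y = 'D_Y (H \o cotangent_param i) z.

Definition poisson_commute (G H : cotangent_bundle A -> R) : Prop :=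
  forall (i : chart_index A) z X Y, cotangent_cod i z ->
    hamiltonian_vector G i z X -> hamiltonian_vector H i z Y ->
    Omega z X Y = 0.

Definition lagrangian (H : cotangent_bundle A -> R) (x : M) (v : vec) : R :=
  sup [set pairing p v - H (x, p) | p in [set: vec]].

Definition abs_continuous (a b : R) (f : R -> vec) : Prop :=
  forall e : R, 0 < e -> exists2 d : R, 0 < d &
    forall (m : nat) (s t : 'I_m -> R),
      (forall k, a <= s k /\ s k <= t k /\ t k <= b) ->
      (forall j k, j != k -> t j <= s k \/ t k <= s j) ->
      \sum_(k < m) (t k - s k) < d ->
      \sum_(k < m) `|f (t k) - f (s k)| < e.

(* Curves [0, t] -> M are represented by total functions of which only the
   restriction to [0, t] matters. *)
Definition abs_continuous_curve (t : R) (gamma : R -> M) : Prop :=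
  {within `[0, t], continuous gamma} /\
  forall (i : chart_index A) (a b : R), 0 <= a -> a <= b -> b <= t ->
    gamma @` `[a, b] `<=` dom i -> abs_continuous a b (chart i \o gamma).

(* Only meaningful where gamma is differentiable, hence at almost every time
   if gamma is absolutely continuous. *)
Definition velocity (gamma : R -> M) (s : R) : vec :=
  derive1 (chart (chart_at A (gamma s)) \o gamma) s.

Definition action (H : cotangent_bundle A -> R) (t : R) (gamma : R -> M) : \bar R :=
  (\int[lebesgue_measure]_(s in `[0%R, t])
     (lagrangian H (gamma s) (velocity gamma s))%:E)%E.

Definition subsolution (alpha : R) (H : cotangent_bundle A -> R) (u : M -> R) :
    Prop :=
  forall (x y : M) (t : R), 0 <= t ->
    ((u y - u x)%:E <=
     ereal_inf [set action H t gamma | gamma in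
                 [set gamma | [/\ abs_continuous_curve t gamma,
                                  gamma 0%R = x & gamma t = y]]]
     + (t * alpha)%:E)%E.

(* The least alpha admitting subsolutions; the value is irrelevant if there is
   none, which does not happen for Tonelli Hamiltonians. *)
Definition critical_value (H : cotangent_bundle A -> R) : R :=
  get [set alpha : R | (exists u, subsolution alpha H u) /\
         forall beta, (exists u, subsolution beta H u) -> alpha <= beta].

Definition shift_form (H : cotangent_bundle A -> R) (w : M -> vec) :
    cotangent_bundle A -> R :=
  fun z => H (z.1, z.2 + w z.1).

(* Component along v, in the chart i, of the 1-form w. *)
Definition form_comp (w : M -> vec) (i : chart_index A) (v q : vec) : R :=
  pairing (w (param i q)) (tangent_param i q v).

(* On a C^2 manifold, C^1 is the natural class of 1-forms; H^1 is the same if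
   computed with smoother forms, whenever these make sense. *)
Definition is_closed (w : M -> vec) : Prop :=
  (forall (i : chart_index A) v, Ck 1 (form_comp w i v) (cod i)) /\
  (forall (i : chart_index A) q u v, cod i q -> 'D_u (form_comp w i v) q = 'D_v (form_comp w i u) q).

Definition is_exact (w : M -> vec) : Prop :=
  exists f : M -> R,
    (forall i : chart_index A, Ck 2 (f \o param i) (cod i)) /\
    (forall (i : chart_index A) q v, cod i q -> form_comp w i v q = 'D_v (f \o param i) q).

End bundles.

Section Ck_linear.
Context {R : realType} {V W : normedModType R}.
Implicit Types (f g : V -> W) (U : set V).

Lemma near_differentiable f g (x : V) :
  (\near x, f x = g x) -> differentiable f x -> differentiable g x.
Proof.
move=> fg /diff_locallyP[cf ef].
have gx : g x = f x by rewrite (nbhs_singleton fg).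
have eg : g \o shift x = cst (g x) + 'd f x +o_ 0 id.
  apply/eqaddoP => e e0; rewrite gx.
  move: ef => /eqaddoP/(_ e e0) ef.
  have fg0 : \forall h \near (0 : V), f (h + x) = g (h + x).
    by move: fg; rewrite (near_shift 0)/=; apply: filterS => h /=; rewrite subr0.
  by apply: filterS2 ef fg0 => h; rewrite /= !fctE /= => + <-.
by apply/diff_locallyP; rewrite (diff_unique cf eg).
Qed.

Lemma Ck_ext k f g U : open U -> (forall x, U x -> f x = g x) ->
  Ck k f U -> Ck k g U.
Proof.
move=> oU; have nearU x : U x -> \forall y \near x, U y by move=> Ux; apply: open_nbhs_nbhs.
elim: k f g => [|k IH] f g fg /=.
  move=> cf x Ux; rewrite /prop_for /continuous_at -(fg x Ux).
  apply: cvg_trans (cf x Ux); apply: near_eq_cvg.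
  by apply: filterS (nearU x Ux) => y; exact: fg.
move=> [df cf]; split=> [x Ux|v].
  apply: near_differentiable (df x Ux).
  by apply: filterS (nearU x Ux) => y; exact: fg.
apply: IH (cf v) => x Ux; apply: near_eq_derive.
by apply: filterS (nearU x Ux) => y; exact: fg.
Qed.

Lemma Ck_cst0 k U : Ck k (fun _ : V => 0 : W) U.
Proof.
elim: k => [|k IH] /=; first by move=> x _; exact: cvg_cst.
split=> [x _|v]; first exact: differentiable_cst.
suff -> : (fun x => 'D_v (fun _ : V => 0 : W) x) = (fun _ => 0) by [].
by apply/funext => x; rewrite (derive_cst 0).
Qed.

Lemma Ck_lin k (a : R) f g U : open U -> Ck k f U -> Ck k g U ->
  Ck k (fun x => a *: f x + g x) U.
Proof.
move=> oU; elim: k f g => [|k IH] f g /=.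
  by move=> cf cg x Ux; apply: cvgD (cg x Ux); apply: cvgZr; exact: cf.
move=> [df cf] [dg cg]; split=> [x Ux|v].
  by apply: differentiableD (dg x Ux); apply: differentiableZ; exact: df.
apply: Ck_ext (IH _ _ (cf v) (cg v)) => // x Ux.
have dfx := diff_derivable (v := v) (df x Ux).
have dgx := diff_derivable (v := v) (dg x Ux).
by rewrite [RHS](deriveD (derivableZ dfx) dgx) (deriveZ a dfx).
Qed.

Lemma derive_lin (a : R) f g U k x v : Ck k.+1 f U -> Ck k.+1 g U -> U x ->
  'D_v (fun x => a *: f x + g x) x = a *: 'D_v f x + 'D_v g x.
Proof.
move=> [df _] [dg _] Ux.
have dfx := diff_derivable (v := v) (df x Ux).
have dgx := diff_derivable (v := v) (dg x Ux).
by rewrite [LHS](deriveD (derivableZ dfx) dgx) (deriveZ a dfx).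
Qed.

End Ck_linear.

Section deRham.
Context {R : realType} {n : nat} {M : topologicalType} (A : c2atlas R n M).
Local Notation vec := 'rV[R]_n.

Lemma open_cod (i : chart_index A) : open (cod i).
Proof. exact: cod_open. Qed.

Lemma pairing_lin (a : R) (p p' v : vec) :
  pairing (a *: p + p') v = a * pairing p v + pairing p' v.
Proof.
rewrite /pairing mulr_sumr -big_split/=; apply: eq_bigr => k _.
by rewrite !mxE mulrDl mulrA.
Qed.

Lemma form_comp_lin (a : R) (w w' : M -> vec) (i : chart_index A) v :
  form_comp (a *: w + w') i v =
  (fun q => a *: (form_comp w i v q : R^o) + form_comp w' i v q).
Proof. by apply/funext => q; rewrite /form_comp pairing_lin. Qed.

Lemma form_comp0 (i : chart_index A) v : form_comp 0 i v = (fun=> 0).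
Proof.
by apply/funext => q; rewrite /form_comp /pairing big1// => k _; rewrite mxE mul0r.
Qed.

Definition closed_pred : {pred (M -> vec)} := fun w => `[< is_closed A w >].

Lemma closed_pred_submod : submod_closed closed_pred.
Proof.
split; first (apply/asboolP; split => [i v|i q u v _]; rewrite !form_comp0 //).
  exact: Ck_cst0.
move=> a w w' /asboolP[Cw dw] /asboolP[Cw' dw']; apply/asboolP.
split=> [i v|i q u v iq]; rewrite !form_comp_lin.
  by apply: Ck_lin => //; exact: open_cod.
rewrite !(@derive_lin R _ R^o a _ _ (cod i) 0) //.
by rewrite dw // dw'.
Qed.

HB.instance Definition _ := GRing.isSubmodClosed.Build R (M -> vec) closed_pred
  closed_pred_submod.

Record closed_form := ClosedForm {
  form_val :> M -> vec;
  closed_formP : form_val \in closed_pred }.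

HB.instance Definition _ := [isSub for form_val].
HB.instance Definition _ := [Choice of closed_form by <:].
HB.instance Definition _ := [SubChoice_isSubLmodule of closed_form by <:].

Definition exact_pred : {pred closed_form} := fun w => `[< is_exact A w >].

Lemma exact_pred_submod : submod_closed exact_pred.
Proof.
split.
  apply/asboolP; exists (fun=> 0); split=> [i|i q v _].
    exact: (@Ck_cst0 R _ R^o).
  by rewrite form_comp0 (derive_cst (0 : R^o)).
move=> a w w' /asboolP[f [Cf fE]] /asboolP[f' [Cf' fE']]; apply/asboolP.
exists (fun x => a *: (f x : R^o) + f' x); split=> [i|i q v iq].
  by apply: (@Ck_lin R _ R^o 2 a (f \o param i) (f' \o param i)) => //; exact: open_cod.
rewrite form_comp_lin /= fE // fE' //.
by rewrite (@derive_lin R _ R^o a (f \o param i) (f' \o param i) (cod i) 1).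
Qed.

HB.instance Definition _ := GRing.isSubmodClosed.Build R closed_form exact_pred
  exact_pred_submod.

(* De Rham cohomology: closed 1-forms modulo exact ones. *)
Definition H1 : Type := Quotient.quot exact_pred.

HB.instance Definition _ := GRing.Zmodule.on H1.
HB.instance Definition _ := EqQuotient.on H1.

Definition H1_class (w : closed_form) : H1 := (\pi_H1 w)%qT.

Lemma H1_classP (w w' : closed_form) :
  H1_class w = H1_class w' <-> is_exact A (w - w').
Proof.
split; first by move=> /eqP; rewrite /H1_class piE => /asboolP.
by move=> ww'; apply/eqP; rewrite /H1_class piE; apply/asboolP.
Qed.

Lemma H1_classD w w' : H1_class (w + w') = H1_class w + H1_class w'.
Proof. exact: (raddfD \pi_(Quotient.quot exact_pred)%qT). Qed.

Lemma reprH1K (c : H1) : H1_class (repr c) = c.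
Proof. exact: reprK. Qed.

Definition H1_scale (a : R) (c : H1) : H1 := H1_class (a *: repr c).

Lemma H1_classZ a w : H1_class (a *: w) = H1_scale a (H1_class w).
Proof.
have := (H1_classP w (repr (H1_class w))).1 (esym (reprH1K _)).
move=> /asboolP ww'; apply/H1_classP/asboolP.
by have := rpredZ a (ww' : w - repr (H1_class w) \in exact_pred); rewrite scalerBr.
Qed.

Fact H1_scaleA a b c : H1_scale a (H1_scale b c) = H1_scale (a * b) c.
Proof. by rewrite -[c]reprH1K -!H1_classZ scalerA. Qed.

Fact H1_scale1 : left_id 1 H1_scale.
Proof. by move=> c; rewrite -[c]reprH1K -!H1_classZ scale1r. Qed.

Fact H1_scaleDr : right_distributive H1_scale +%R.
Proof.
move=> a c d; rewrite -[c]reprH1K -[d]reprH1K.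
by rewrite -H1_classD -!H1_classZ -H1_classD scalerDr.
Qed.

Fact H1_scaleDl c : {morph H1_scale^~ c : a b / a + b}.
Proof.
by move=> a b; rewrite -[c]reprH1K -!H1_classZ -H1_classD scalerDl.
Qed.

HB.instance Definition _ := GRing.Zmodule_isLmodule.Build R H1
  H1_scaleA H1_scale1 H1_scaleDr H1_scaleDl.

(* Mather's alpha function.  For a Tonelli Hamiltonian the critical value does
   not depend on the form chosen to represent the class. *)
Definition mather_alpha (H : cotangent_bundle A -> R) (c : H1) : R :=
  critical_value (shift_form H (repr c : closed_form)).

Definition is_flat (alpha : H1 -> R) (C : set H1) : Prop :=
  convex_set (C : set (convex_lmodType H1)) /\
  forall c0 c1, C c0 -> C c1 -> forall t : R, 0 < t < 1 ->
    alpha (t *: c0 + (1 - t) *: c1) = t * alpha c0 + (1 - t) * alpha c1.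

End deRham.

Arguments H1 {R n M} A.
Arguments cotangent_bundle {R n M} A.
Arguments riemannian_metric {R n M} A.

(* Main.v *)
(* Let w be a critical subsolution of G. The discounted equation
   lam (u - w) + H(x, du) = 0 has a solution u (Perron's method), and u is
   again a critical subsolution of G: one doubles variables along one Euler
   step of the flow of G, which changes H by o(t) because {G, H} = 0. These u
   are equi-Lipschitz, so for small lam the term lam (u - w) is nearly
   constant, and up to a constant u is an approximate weak KAM solution of H.
   As shifting both Hamiltonians by a closed 1-form keeps {G, H} = 0, every class c
   carries a critical subsolution of G_c whose subdifferentials lie at H_c-level
   nearly alpha_H(c).
   If alpha_H(c0) > alpha_H(c1) for two points of the flat, the momenta of the
   corresponding u0 and u1 at a common point are separated by H, so that, G being
   strictly convex along fibers, the mean of u0 and u1 is a subsolution for G and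
   the midpoint class at a level strictly below the mean of alpha_G(c0) and
   alpha_G(c1); inf-convolution supplies the subdifferentials needed at points
   where u0 or u1 is not differentiable. This contradicts the affinity of
   alpha_G. Hence alpha_H is constant on the flat. *)

Require Import Defs.
From HB Require Import structures.
From mathcomp Require Import all_boot all_order all_algebra.
From mathcomp Require Import all_classical all_reals all_analysis.
From mathcomp Require Import measurable_realfun.
From mathcomp Require Import ring lra.

Set Implicit Arguments.
Unset Strict Implicit.
Unset Printing Implicit Defensive.

Import Order.TTheory GRing.Theory Num.Theory.
Import numFieldNormedType.Exports.
Local Open Scope classical_set_scope.
Local Open Scope ring_scope.

(** * Absolutely continuous functions *)

(** Subsolutions are defined through the action of absolutely continuous curves, but every step of
    the overview is local and infinitesimal. The proof therefore works with an equivalent Dini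
    condition, [sub], and converts at both ends. Its level may depend on the point, so the same
    notion serves for critical subsolutions and for the discounted equation. The Lagrangian along a
    curve is not known to be measurable; the action is bounded below through integrable minorants,
    supplied by the fundamental theorem of calculus for absolutely continuous functions. Closed
    forms are merely C^1, so a shifted Hamiltonian is only C^1 in a chart and its vector field only
    continuous. A single Euler step, made uniform by compactness, replaces the flow, and
    [is_hamiltonian] keeps what survives the shift. The discount ties the values of u to levels of
    H: if the best G-level of u were some m > a, a suitable step of length t would raise u - w by
    about t (m - a), hence change the H-level by lam t (m - a), too much for a step along which H
    varies by o(t). *)

(** The supremum of the endpoints [y] with [P a y] must be [b]: the local hypothesis at it joins an
    interval ending just before it to one ending just after. It chains estimates that are known only
    locally, often in a chart. *)
Lemma interval_gluing (R : realType) (P : R -> R -> Prop) (a b : R) : a <= b ->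
  (forall x y z, a <= x -> x <= y -> y <= z -> z <= b ->
     P x y -> P y z -> P x z) ->
  (forall s, a <= s <= b -> exists2 d, 0 < d &
     forall x y, a <= x -> x <= s -> s <= y -> y <= b -> y - x < d -> P x y) ->
  P a b.
Proof.
move=> ab Ptrans Ploc.
pose S := [set y | a <= y <= b /\ P a y].
have Sa : S a.
  split; first by rewrite lexx.
  have [|d d0 Pd] := Ploc a; first by rewrite lexx.
  by apply: Pd => //; rewrite subrr.
have hS : has_sup S by split; [exists a | exists b => y [/andP[]]].
pose c := sup S.
have ac : a <= c by apply: ub_le_sup => //; exact: hS.2.
have cb : c <= b by apply: ge_sup => //; [exists a|move=> y [/andP[]]].
have [|d d0 Pd] := Ploc c; first by rewrite ac.
have [y [/andP[ay yb] Py] cy] := sup_adherent (divr_gt0 d0 (ltr0n _ 2)) hS.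
have yc : y <= c by apply: ub_le_sup => //; [exact: hS.2|split => //; rewrite ay].
pose z := Num.min b (c + d / 3).
have cz : c <= z by rewrite le_min cb lerDl divr_ge0// ltW.
have zb : z <= b by rewrite ge_min lexx.
have Pz : P a z.
  apply: (Ptrans _ _ _ _ ay) (Py) _ => //; first exact: (le_trans yc).
  apply: Pd => //.
  have : z <= c + d / 3 by rewrite ge_min lexx orbT.
  by rewrite /c in yc cy cz ac cb *; lra.
have zc : z <= c by apply: ub_le_sup => //; [exact: hS.2|split => //; rewrite zb (le_trans ac)].
suff <- : z = b by [].
move: zc; rewrite /z; case: (leP b (c + d / 3)) => // _ dc.
by exfalso; move: dc; rewrite gerDl leNgt divr_gt0.
Qed.

Section absolute_continuity.
Context {R : realType}.
Implicit Types (a b : R) (f : R -> R) (l : seq (R * R)).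
Local Notation mu := (@lebesgue_measure R).

Definition itv_family a b l :=
  all (fun p => [&& a <= p.1, p.1 <= p.2 & p.2 <= b]) l &&
  pairwise (fun p q => (p.2 <= q.1) || (q.2 <= p.1)) l.

(** The real-valued counterpart of [abs_continuous], with the intervals in a list: the induction in
    [acontinuous_TV] concatenates families and refines their members. *)
Definition acontinuous a b f := forall e : R, 0 < e -> exists2 d, 0 < d &
  forall l, itv_family a b l -> \sum_(p <- l) (p.2 - p.1) < d ->
    \sum_(p <- l) `|f p.2 - f p.1| < e.

Lemma acontinuous_le a b f (g : R -> R) (C : R) :
  (forall s t, a <= s -> s <= t -> t <= b -> `|g t - g s| <= C * `|f t - f s|) ->
  acontinuous a b f -> acontinuous a b g.
Proof.
move=> gf af e e0.
have C0 : 0 < `|C| + 1 by rewrite ltr_pwDr.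
have [d d0 fd] := af _ (divr_gt0 e0 C0); exists d => // l lab ld.
have := fd l lab ld; rewrite ltr_pdivlMr// mulrC; apply: le_lt_trans.
rewrite mulr_sumr big_seq [leRHS]big_seq; apply: ler_sum => p pl.
have /allP/(_ p pl)/and3P[ap pp pb] := proj1 (andP lab).
apply: le_trans (gf _ _ ap pp pb) _; rewrite ler_wpM2r//.
by rewrite (le_trans (ler_norm _))// lerDl.
Qed.

Lemma acontinuous_single a b f e : acontinuous a b f -> 0 < e -> exists2 d, 0 < d &
  forall s t, a <= s -> s <= t -> t <= b -> t - s < d -> `|f t - f s| < e.
Proof.
move=> af e0; have [d d0 fd] := af e e0; exists d => // s t sa st tb std.
have := fd [:: (s, t)]; rewrite !big_seq1/= /itv_family/= sa st tb/=.
exact.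
Qed.

Lemma abs_continuous_acontinuous (n : nat) a b (f : R -> 'rV[R]_n) (g : R -> R) (C : R) :
  (forall s t, a <= s -> s <= t -> t <= b -> `|g t - g s| <= C * `|f t - f s|) ->
  abs_continuous a b f -> acontinuous a b g.
Proof.
move=> gf af e e0.
have C0 : 0 < `|C| + 1 by rewrite ltr_pwDr.
have [d d0 fd] := af _ (divr_gt0 e0 C0); exists d => // l /andP[lab lp] ld.
have := fd (size l) (fun k => (tnth (in_tuple l) k).1) (fun k => (tnth (in_tuple l) k).2).
rewrite -(big_tnth _ _ _ predT (fun p => p.2 - p.1)).
rewrite -(big_tnth _ _ _ predT (fun p => `|f p.2 - f p.1|)).
have H1 k : a <= (tnth (in_tuple l) k).1 /\ (tnth (in_tuple l) k).1 <= (tnth (in_tuple l) k).2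
   /\ (tnth (in_tuple l) k).2 <= b.
  by have /allP/(_ _ (mem_tnth k (in_tuple l)))/and3P[] := lab.
have H2 (j k : 'I_(size l)) : j != k -> (tnth (in_tuple l) j).2 <= (tnth (in_tuple l) k).1 \/
    (tnth (in_tuple l) k).2 <= (tnth (in_tuple l) j).1.
  move=> jk; pose x0 := (0 : R, 0 : R); rewrite !(tnth_nth x0)/=.
  move/(pairwiseP x0): lp => lp.
  have [jltk|kltj|/val_inj ejk] := ltngtP j k; last by rewrite ejk eqxx in jk.
    by apply/orP; apply: lp => //; rewrite inE.
  by apply/orP; rewrite orbC; apply: lp => //; rewrite inE.
move=> /(_ H1 H2 ld); rewrite ltr_pdivlMr// mulrC; apply: le_lt_trans.
rewrite mulr_sumr big_seq [leRHS]big_seq; apply: ler_sum => p pl.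
have /allP/(_ p pl)/and3P[ap pp pb] := lab.
apply: le_trans (gf _ _ ap pp pb) _; rewrite ler_wpM2r//.
by rewrite (le_trans (ler_norm _))// lerDl.
Qed.

Fixpoint consecutive (s : R) (P : seq R) : seq (R * R) :=
  if P is x :: P' then (s, x) :: consecutive x P' else [::].

Lemma variation_consecutive s t f P :
  variation s t f P = \sum_(p <- consecutive s P) `|f p.2 - f p.1|.
Proof.
elim: P s => [|x P IH] s; first by rewrite /variation/= big_nil big_geq.
rewrite /= big_cons/= -IH /variation/= big_nat_recl//.
Qed.

Lemma consecutive_le s P p : path <%O s P -> p \in consecutive s P ->
  [/\ s <= p.1, p.1 <= p.2 & p.2 <= last s P].
Proof.
elim: P s p => //= x P IH s p /andP[sx xP]; rewrite inE => /orP[/eqP->/=|].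
  split => //; first exact: ltW.
  elim: {IH} P x sx xP => //= y P IH x sx /andP[xy yP].
  by apply: le_trans (ltW xy) _; apply: IH => //; exact: lt_trans sx xy.
move=> /(IH _ _ xP)[xp pp pl]; split => //; exact: le_trans (ltW sx) xp.
Qed.

Lemma consecutive_pairwise s P : path <%O s P ->
  pairwise (fun p q => (p.2 <= q.1) || (q.2 <= p.1)) (consecutive s P).
Proof.
elim: P s => //= x P IH s /andP[sx xP]; rewrite IH// andbT.
by apply/allP => q /(consecutive_le xP)[xq _ _]; rewrite /= xq.
Qed.

Lemma consecutive_length s P :
  \sum_(p <- consecutive s P) (p.2 - p.1) = last s P - s.
Proof.
elim: P s => [|x P IH] s /=; first by rewrite big_nil subrr.
by rewrite big_cons/= IH addrC subrKA.
Qed.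

(** Refining an interval by a partition keeps the family admissible and its total length, so each
    increment may be replaced by a variation and then by the supremum of these. The list [l] holds
    the pieces of the intervals already refined. *)
Lemma acontinuous_TV a b f e d : 0 <= e ->
  (forall l, itv_family a b l -> \sum_(p <- l) (p.2 - p.1) < d ->
    \sum_(p <- l) `|f p.2 - f p.1| < e) ->
  forall m l, itv_family a b (l ++ m) -> \sum_(p <- l ++ m) (p.2 - p.1) < d ->
   ((\sum_(p <- l) `|f p.2 - f p.1|)%:E +
     \sum_(p <- m) total_variation p.1 p.2 f <= e%:E)%E.
Proof.
move=> e0 fd; elim=> [|p m IH] l.
  by rewrite big_nil adde0 cats0 => fl ld; rewrite lee_fin ltW// fd.
move=> /andP[lab lpw] ld.
have lab' := lab; rewrite all_cat/= in lab'.
have /and3P[all_l /and3P[ap pp pb] all_m] := lab'.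
have key P : itv_partition p.1 p.2 P ->
   ((\sum_(p <- l) `|f p.2 - f p.1|)%:E + (variation p.1 p.2 f P)%:E +
     \sum_(p <- m) total_variation p.1 p.2 f <= e%:E)%E.
  move=> [pP /eqP lP]; rewrite variation_consecutive -EFinD -big_cat/=.
  have cle q : q \in consecutive p.1 P -> [/\ p.1 <= q.1, q.1 <= q.2 & q.2 <= p.2].
    by move=> /(consecutive_le pP); rewrite lP.
  apply: IH.
    apply/andP; split.
      rewrite !all_cat all_l all_m/= andbT; apply/allP => q /cle[q1 q2 q3].
      by rewrite q2 (le_trans ap q1) (le_trans q3 pb).
    move: lpw; rewrite !pairwise_cat/= allrel_consr allrel_catl.
    move=> /and3P[/andP[lp lm] -> /andP[pm ->]].
    rewrite lm consecutive_pairwise//= !andbT; apply/andP; split; last first.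
      apply/allrelP => x y xl /cle[q1 q2 q3].
      have := allP lp x xl => /= /orP[h|h]; apply/orP.
        by left; exact: le_trans h q1.
      by right; exact: le_trans q3 h.
    apply/allrelP => y x /cle[q1 q2 q3] xm.
    have := allP pm x xm => /= /orP[h|h]; apply/orP.
      by left; exact: le_trans q3 h.
    by right; exact: le_trans h q1.
  move: ld; rewrite !big_cat/= big_cons consecutive_length lP addrA.
  by [].
have TVge0 q : q \in m -> (0 <= total_variation q.1 q.2 f)%E.
  by move=> /(allP all_m)/and3P[_ qq _]; exact: total_variation_ge0.
have S0 : (0 <= \sum_(p <- m) total_variation p.1 p.2 f)%E.
  by rewrite big_seq; apply: sume_ge0 => q qm; exact: TVge0.
have [P0 P0p] : exists P, itv_partition p.1 p.2 P.
  have := pp; rewrite le_eqVlt => /orP[/eqP ->|p12].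
    by exists [::]; split => //=.
  by exists [:: p.2]; exact: itv_partition1.
have Sfin : (\sum_(p <- m) total_variation p.1 p.2 f)%E \is a fin_num.
  rewrite ge0_fin_numE//; apply: le_lt_trans (ltry e); apply: le_trans (key _ P0p).
  rewrite leeDr// -EFinD lee_fin addr_ge0//; first by apply: sumr_ge0.
  by rewrite variation_consecutive; apply: sumr_ge0.
rewrite big_cons addeCA -leeBrDr; last first.
  by rewrite fin_numD Sfin.
apply: ge_ereal_sup => _ /= [_ [P Pp] <-] <-.
rewrite leeBrDr; last by rewrite fin_numD Sfin.
by rewrite addeCA addeA; exact: key.
Qed.

Lemma acontinuous_sub a b f (x y : R) : a <= x -> y <= b ->
  acontinuous a b f -> acontinuous x y f.
Proof.
move=> ax yb fab e e0; have [d d0 fd] := fab e e0; exists d => // l /andP[/allP la lp].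
apply: fd; rewrite /itv_family lp andbT; apply/allP => p /la/and3P[xp pp py].
by rewrite pp (le_trans ax xp) (le_trans py yb).
Qed.

(** On intervals shorter than the modulus attached to 1 the variation is at most 1; finiteness then
    chains by additivity. *)
Lemma acontinuous_bounded_variation a b f : a <= b -> acontinuous a b f ->
  bounded_variation a b f.
Proof.
move=> ab af; apply/bounded_variationP => //.
rewrite ge0_fin_numE ?total_variation_ge0//.
apply: (@interval_gluing R (fun x y => total_variation x y f < +oo)%E) => //.
  move=> x y z ax xy yz zb; rewrite (total_variationD f xy yz).
  exact: lte_add_pinfty.
move=> s /andP[as_ sb].
have [d d0 fd] := af 1 ltr01; exists d => // x y ax xs sy yb yx.
have := acontinuous_TV ler01 fd (m := [:: (x, y)]) (l := [::]).
rewrite /= !big_seq1 big_nil add0e /= => /(_ _ yx) H.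
apply: le_lt_trans (H _) (ltry _).
by rewrite /itv_family/= ax (le_trans xs sy) yb.
Qed.

Lemma acontinuous_total_variation a b f : acontinuous a b f ->
  acontinuous a b (fun x => fine (total_variation a x f)).
Proof.
move=> af e e0; have [d d0 fd] := af _ (divr_gt0 e0 (ltr0n _ 2)).
exists d => // l lab ld.
have := acontinuous_TV (ltW (divr_gt0 e0 (ltr0n _ 2))) fd (m := l) (l := [::]) lab ld.
rewrite big_nil add0e => H.
suff -> : \sum_(p <- l) `|fine (total_variation a p.2 f) - fine (total_variation a p.1 f)|
   = fine (\sum_(p <- l) total_variation p.1 p.2 f)%E.
  apply: le_lt_trans (fine_le _ _ H) _ => //.
    rewrite ge0_fin_numE ?(le_lt_trans H) ?ltry// big_seq.
    apply: sume_ge0 => p /(allP (proj1 (andP lab)))/and3P[_ pp _].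
    exact: total_variation_ge0.
  by rewrite /= ltr_pdivrMr// ltr_pMr// ltr1n.
have TVfin p : p \in l -> [/\ a <= p.1, p.1 <= p.2, total_variation a p.1 f \is a fin_num
    & total_variation p.1 p.2 f \is a fin_num].
  move=> /(allP (proj1 (andP lab)))/and3P[ap pp pb].
  have : bounded_variation a p.2 f.
    apply: acontinuous_bounded_variation; first exact: le_trans pp.
    exact: acontinuous_sub (lexx a) pb af.
  move=> /bounded_variationP; rewrite (le_trans ap pp) => /(_ isT).
  by rewrite (total_variationD f ap pp) fin_numD => /andP[-> ->].
rewrite big_seq [in RHS]big_seq -sum_fine; last by move=> p /TVfin[].
apply: eq_bigr => p /TVfin[ap pp f1 f2].
rewrite (total_variationD f ap pp) fineD// addrAC subrr add0r ger0_norm//.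
by rewrite fine_ge0// total_variation_ge0.
Qed.

Lemma measure_itv_family (nu : {measure set (measurableTypeR R) -> \bar R}) a b l :
  itv_family a b l ->
  nu (\big[setU/set0]_(p <- l) `]p.1, p.2]%classic) =
  (\sum_(p <- l) nu `]p.1, p.2]%classic)%E.
Proof.
move=> /andP[lab lp].
elim: l lab lp => [|p l IH]/=; first by rewrite !big_nil measure0.
move=> /andP[ap al] /andP[pl lp]; rewrite !big_cons measureU.
- by rewrite -IH.
- exact: measurable_itv.
- by apply: bigsetU_measurable => q _; exact: measurable_itv.
apply/seteqP; split=> // x [/=]; rewrite in_itv/= -bigcup_seq => /andP[px xp] [q/= ql].
rewrite in_itv/= => /andP[qx xq].
have /orP[h|h] := allP pl _ ql.
  by have := lt_le_trans qx (le_trans xp h); rewrite ltxx.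
by have := lt_le_trans px (le_trans xq h); rewrite ltxx.
Qed.

(** [l n] keeps the dyadic pieces of level n of []a, b]] that lie in U; their union grows with n
    because each piece splits into two of the next level. The Stieltjes measure of an open set is
    thus reached by sums of increments over finite families, which absolute continuity controls. *)
Lemma dyadic_exhaustion a b (U : set R) : a < b -> open U ->
  exists l : nat -> seq (R * R), [/\ forall n, itv_family a b (l n),
    forall n, \big[setU/set0]_(p <- l n) `]p.1, p.2]%classic `<=` U,
    forall n m, (n <= m)%N -> \big[setU/set0]_(p <- l n) `]p.1, p.2]%classic `<=`
       \big[setU/set0]_(p <- l m) `]p.1, p.2]%classic &
    U `&` `]a, b]%classic `<=` \bigcup_n \big[setU/set0]_(p <- l n) `]p.1, p.2]%classic].
Proof.
move=> ab oU.
pose h n : R := (b - a) / 2 ^+ n.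
have h0 n : 0 < h n by rewrite divr_gt0 ?subr_gt0// exprn_gt0.
have hS n : h n = h n.+1 *+ 2.
  by rewrite /h exprS; field; rewrite expf_neq0.
pose I n k : R * R := (a + k%:R * h n, a + k.+1%:R * h n).
pose l n := [seq p <- [seq I n k | k <- iota 0 (2 ^ n)] | asbool (`]p.1, p.2]%classic `<=` U)].
have memU n x : (\big[setU/set0]_(p <- l n) `]p.1, p.2]%classic) x <->
   exists k, [/\ (k < 2 ^ n)%N, `](I n k).1, (I n k).2]%classic x & `](I n k).1, (I n k).2]%classic `<=` U].
  rewrite -bigcup_seq; split.
    move=> [p /=]; rewrite mem_filter => /andP[/asboolP pU /mapP[k]].
    by rewrite mem_iota/= add0n => kn pI px; subst p; exists k.
  move=> [k [kn kx kU]]; exists (I n k) => //=.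
  by rewrite mem_filter; apply/andP; split; [exact/asboolP|rewrite map_f// mem_iota].
have hb n : a + (2 ^ n)%:R * h n = b.
  by rewrite /h natrX mulrC divfK ?subrKC// expf_neq0.
exists l; split.
- move=> n; apply/andP; split.
    apply/allP => p; rewrite mem_filter => /andP[_ /mapP[k]]; rewrite mem_iota/= => kn ->/=.
    apply/and3P; split; first by rewrite lerDl mulr_ge0// ltW.
      by rewrite lerD2l ler_pM2r// ler_nat.
    by rewrite -(hb n) lerD2l ler_pM2r// ler_nat.
  apply: subseq_pairwise (filter_subseq _ _) _.
  rewrite pairwise_map; apply/(pairwiseP 0%N) => i j; rewrite !inE size_iota => ii jj ij.
  rewrite !nth_iota//= !add0n; apply/orP; left.
  by rewrite lerD2l ler_pM2r// ler_nat.
- by move=> n x /memU[k [_ kx]]; exact.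
- move=> n m /subnK <-; elim: (m - n)%N => // d IH x /IH; rewrite addSn.
  move: (d + n)%N => {IH m d}m /memU[k [kn kx kU]]; apply/memU.
  move: kx; rewrite /I/= in_itv/= => /andP[kx xk].
  have e1 : (k.*2)%:R * h m.+1 = k%:R * h m.
    by rewrite (hS m) -muln2 natrM -[h m.+1 *+ 2]mulr_natl mulrA.
  have e2 : (k.*2.+2)%:R * h m.+1 = k.+1%:R * h m.
    by rewrite -doubleS (hS m) -muln2 natrM -[h m.+1 *+ 2]mulr_natl mulrA.
  have [xm|mx] := leP x (a + k.*2.+1%:R * h m.+1).
    exists k.*2; split; first by rewrite expnS mul2n ltn_double.
      by rewrite /= in_itv/= xm e1 kx.
    move=> y; rewrite /= in_itv/= e1 => /andP[ky yk]; apply: kU.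
    rewrite /= in_itv/= ky -e2 (le_trans yk)// lerD2l ler_pM2r// ler_nat//.
  exists k.*2.+1; split; first by rewrite expnS mul2n ltn_Sdouble.
    by rewrite /= in_itv/= mx e2 xk.
  move=> y; rewrite /= in_itv/= e2 => /andP[ky yk]; apply: kU.
  rewrite /= in_itv/= yk andbT -e1 (le_lt_trans _ ky)// lerD2l ler_pM2r// ler_nat//.
- move=> x [Ux]; rewrite /= in_itv/= => /andP[ax xb].
  have /nbhs_ballP[e/= e0 eU] := open_nbhs_nbhs (conj oU Ux).
  have : \forall n \near \oo, h n < e.
    have : h n @[n --> \oo] --> 0.
      rewrite -[X in _ --> X](mulr0 (b - a)).
      apply: cvgMr; rewrite (_ : (fun n => _) = (fun n => (2^-1) ^+ n)).
        by apply: cvg_expr; rewrite ger0_norm// invf_lt1// ltr1n.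
      by apply/funext => n; rewrite exprVn.
    move=> /cvgrPdist_lt/(_ e e0); apply: filterS => n.
    by rewrite sub0r normrN gtr0_norm.
  move=> [n _ /(_ n (leqnn n)) hne].
  exists n => //; apply/memU.
  pose z := (x - a) / h n.
  have z0 : 0 < z by rewrite divr_gt0// subr_gt0.
  have zx : a + z * h n = x by rewrite /z divfK ?subrKC ?gt_eqF.
  have zP k : (a + k%:R * h n < x) = (k%:R < z).
    by rewrite -[x in LHS]zx ltrD2l ltr_pM2r.
  have zP' k : (x <= a + k%:R * h n) = (z <= k%:R).
    by rewrite -[x in LHS]zx lerD2l ler_pM2r.
  have [k [kz zk]] : exists k, k%:R < z /\ z <= k.+1%:R.
    have [m zm] : exists m, z <= m%:R.
      exists (Num.trunc z).+1; exact/ltW/truncnS_gt.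
    elim: m zm => [|m IH] zm; first by have := lt_le_trans z0 zm; rewrite ltxx.
    by have [/IH//|mz] := leP z m%:R; exists m.
  have kn : (k < 2 ^ n)%N.
    rewrite -(ltr_nat R) (lt_le_trans kz)// -zP' hb//.
  exists k; split => //; first by rewrite /= in_itv/= zP zP' kz.
  move=> y /=; rewrite in_itv/= => /andP[ky yk]; apply: eU => /=.
  have e3 : k.+1%:R * h n = k%:R * h n + h n by rewrite -natr1 mulrDl mul1r.
  rewrite -zP in kz; rewrite -zP' in zk; rewrite e3 in zk yk.
  by rewrite /ball/= ltr_norml; apply/andP; split; lra.
Qed.

(** The density is the Radon-Nikodym derivative of the Stieltjes measure of F; Lebesgue
    differentiation identifies it with the derivative of F almost everywhere. *)
Lemma nondecreasing_acontinuous_FTC a b (F : R -> R) : a < b ->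
  {in `[a, b] &, {homo F : x y / x <= y}} -> acontinuous a b F ->
  exists g : R -> R, [/\ mu.-integrable `[a, b] (EFin \o g),
    {ae mu, forall x, a < x < b -> is_derive x 1 F (g x)} &
    (F b - F a)%:E = (\int[mu]_(x in `[a, b]) (g x)%:E)%E].
Proof.
move=> ab Fnd Fac.
(* Clamping to [[a, b]] extends F to a monotone function on the line, right-continuous because F is
   uniformly continuous on the interval. *)
pose cl x := Num.min (Num.max x a) b.
have clab x : cl x \in `[a, b].
  by rewrite in_itv/= /cl le_min ge_min le_max !lexx (ltW ab) !orbT.
have clE x : x \in `[a, b] -> cl x = x.
  by rewrite in_itv/= /cl => /andP[ax xb]; rewrite (max_idPl ax) (min_idPl xb).
have maxP x y : x <= y -> 0 <= Num.max y a - Num.max x a <= y - x.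
  by clear; move=> xy; case: (leP x a) => xa; case: (leP y a) => ya; lra.
have minP x y : x <= y -> 0 <= Num.min y b - Num.min x b <= y - x.
  by clear; move=> xy; case: (leP x b) => xb; case: (leP y b) => yb; lra.
have clnd : {homo cl : x y / x <= y}.
  move=> x y /maxP/andP[+ _]; rewrite subr_ge0 => /minP/andP[+ _].
  by rewrite subr_ge0.
have cldist x y : x <= y -> cl y - cl x <= y - x.
  move=> /maxP/andP[]; rewrite subr_ge0 => /minP/andP[_ h1] h2.
  exact: le_trans h1 h2.
pose F' := F \o cl.
have F'nd : nondecreasing F'.
  by move=> x y xy; apply: Fnd => //; apply: clnd.
have F'rc : right_continuous F'.
  apply: right_continuousW => x; apply/cvgrPdist_lt => e e0.
  have [d d0 fd] := acontinuous_single Fac e0.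
  near=> y.
  have xyd : `|x - y| < d by near: y; apply: cvgr_dist_lt.
  have clP z : a <= cl z <= b by have := clab z; rewrite in_itv.
  have [xy|yx] := leP x y.
    rewrite distrC /F'/=; apply: fd; [by case/andP: (clP x)|exact: clnd|by case/andP: (clP y)|].
    by rewrite (le_lt_trans (cldist _ _ xy))// -(ger0_norm (x := y - x)) ?subr_ge0// distrC.
  rewrite /F'/=; apply: fd; [by case/andP: (clP y)|exact/clnd/ltW|by case/andP: (clP x)|].
  by rewrite (le_lt_trans (cldist _ _ (ltW yx)))// -(ger0_norm (x := x - y)) ?subr_ge0// ltW.
pose Fc : cumulative R R := HB.pack F' (isCumulative.Build R _ R F' F'nd F'rc).
pose nuF := lebesgue_stieltjes_measure Fc.
have nuFE (x y : R) : x <= y -> nuF `]x, y]%classic = (F' y - F' x)%:E.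
  move=> xy; rewrite /nuF /lebesgue_stieltjes_measure /measure_extension measurable_mu_extE/=; last exact: is_ocitv.
  by rewrite wlength_itv_bnd.
have mab : measurable (`]a, b]%classic : set (measurableTypeR R)) by exact: measurable_itv.
have nufin : fin_num_fun (mrestr nuF mab).
  move=> A mA; rewrite /mrestr ge0_fin_numE//.
  apply: (@le_lt_trans _ _ (nuF `]a, b]%classic)); last by rewrite nuFE ?ltry// ltW.
  by apply: le_measure; rewrite ?inE//; exact: measurableI.
pose nu : {finite_measure set (measurableTypeR R) -> \bar R} :=
  HB.pack (mrestr nuF mab) (Measure_isFinite.Build _ _ _ (mrestr nuF mab) nufin).
(* A null set lies in an open set of measure less than the modulus [d]; the dyadic families inside
   that set have total increment at most [e], and so has their limit. *)
have numu : nu `<< mu.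
  apply/null_content_dominatesP => A mA A0.
  suff nuAe e : 0 < e -> (nu A <= e%:E)%E.
    by apply/eqP; rewrite eq_le measure_ge0 andbT; apply/lee_addgt0Pr => e e0; rewrite add0e nuAe.
  move=> e0; have [d d0 fd] := Fac e e0.
  have [|U [oU AU UAd]] := lebesgue_regularity_outer mA _ d0; first by rewrite A0.
  have mU : measurable (U : set (measurableTypeR R)) by exact: open_measurable.
  have Ud : (mu U < d%:E)%E.
    rewrite (_ : U = (U `\` A) `|` A); last by rewrite setUC setDUK.
    apply: le_lt_trans UAd; rewrite -[leRHS]adde0 -[X in (_ <= _ + X)%E]A0.
    by apply: measureU2 => //; exact: measurableD.
  have [l [lab lU lmono UL]] := dyadic_exhaustion ab oU.
  pose L n : set (measurableTypeR R) := \big[setU/set0]_(p <- l n) `]p.1, p.2]%classic.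
  have mL n : measurable (L n).
    by apply: bigsetU_measurable => q _; exact: measurable_itv.
  have mUL : measurable (\bigcup_n L n) by exact: bigcupT_measurable.
  have nuL n : (nuF (L n) <= e%:E)%E.
    have -> : nuF (L n) = (\sum_(p <- l n) nuF `]p.1, p.2]%classic)%E.
      exact: (measure_itv_family (lebesgue_stieltjes_measure Fc) (lab n)).
    have lab' p : p \in l n -> [/\ a <= p.1, p.1 <= p.2 & p.2 <= b].
      by move=> pl; have /allP/(_ p pl)/and3P := proj1 (andP (lab n)).
    rewrite big_seq (eq_bigr (fun p => (F p.2 - F p.1)%:E)); last first.
      move=> p /lab'[ap pp pb]; rewrite nuFE// /F'/= !clE ?in_itv/= ?ap ?pb ?(le_trans pp)//.
      by rewrite (le_trans ap).
    rewrite -big_seq sumEFin lee_fin; apply: (@le_trans _ _ (\sum_(p <- l n) `|F p.2 - F p.1|)).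
      by apply: ler_sum => p _; exact: ler_norm.
    apply/ltW/fd => //.
    rewrite -lte_fin; apply: le_lt_trans Ud.
    apply: (@le_trans _ _ (mu (L n))); last by apply: le_measure; rewrite ?inE//; exact: lU.
    have -> : mu (L n) = (\sum_(p <- l n) mu `]p.1, p.2]%classic)%E.
      exact: (measure_itv_family mu (lab n)).
    rewrite -sumEFin big_seq [leRHS]big_seq.
    apply: lee_sum => p /lab'[ap pp pb].
    rewrite lebesgue_measure_itv/= lte_fin.
    have [p12|p21] := ltP p.1 p.2; first by rewrite EFinB.
    by rewrite lee_fin subr_le0.
  apply: (@le_trans _ _ (nuF (\bigcup_n L n))).
    rewrite /nu/= /mrestr; apply: le_measure; rewrite ?inE//; first exact: measurableI.
    by move=> x [Ax xab]; apply: UL; split => //; exact: AU.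
  have cvL : (nuF \o L) n @[n --> \oo] --> nuF (\bigcup_n L n).
    apply: nondecreasing_cvg_mu => // n m nm.
    by apply/subsetPset; exact: lmono.
  rewrite -(cvg_lim _ cvL)//; apply: lime_le; first by apply/cvg_ex; eexists; exact: cvL.
  by near=> n; exact: nuL.
pose h := Radon_Nikodym_SigmaFinite.f nu mu.
have hfin x : h x \is a fin_num by exact: Radon_Nikodym_SigmaFinite.f_fin_num.
pose g := fine \o h.
have gE : EFin \o g = h by apply/funext => x; rewrite /= fineK.
have ig : mu.-integrable setT (EFin \o g).
  by rewrite gE; exact: Radon_Nikodym_SigmaFinite.f_integrable.
have igs A : measurable A -> mu.-integrable A (EFin \o g).
  by move=> mA; apply: integrableS ig.
have nug x y : a <= x -> x <= y -> y <= b -> (\int[mu]_(t in `]x, y]) (g t)%:E)%E = (F y - F x)%:E.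
  move=> ax xy yb.
  have := Radon_Nikodym_SigmaFinite.f_integral numu (measurable_itv `]x, y]).
  rewrite -/h -gE => <-; rewrite /nu/= /mrestr (_ : _ `&` _ = `]x, y]%classic).
    rewrite nuFE// /F'/= !clE// in_itv/=.
      by rewrite ax (le_trans xy).
    by rewrite yb (le_trans ax).
  apply/setIidPl => z /=; rewrite !in_itv/= => /andP[xz zy].
  by rewrite (le_lt_trans ax xz) (le_trans zy).
exists g; split; first exact: igs.
- have := lebesgue_differentiation (open_integrable_locally openT ig).
  apply: filterS; first exact: (ae_filter_ringOfSetsType mu).
  move=> x xg /andP[ax xb].
  have [] := @FTC1_lebesgue_pt R g (BRight a) x b xb (igs _ (measurable_itv _)) _ xg.
    by [].
  set Phi := fun y => _ => dPhi DPhi.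
  have PhiE : {near x, (fun y => Phi y + F a) =1 F}.
    near=> y; rewrite /Phi /Rintegral nug//=; first by rewrite subrK.
      by apply/ltW; near: y; exact: lt_nbhsr.
    by apply/ltW; near: y; exact: lt_nbhsl.
  apply: near_eq_is_derive PhiE _.
  have dc : derivable (cst (F a) : R -> R) x 1 by exact: derivable_cst.
  split; first exact: derivableD.
  by rewrite [LHS](deriveD dPhi dc) derive_cst addr0 -derive1E.
- have := nug a b (lexx _) (ltW ab) (lexx _) => <-.
  by rewrite integral_itv_obnd_cbnd//; have /integrableP[] := igs _ (measurable_itv `]a, b]).
Unshelve. all: by end_near.
Qed.

End absolute_continuity.

Local Notation mu := (@lebesgue_measure _).
(** Jordan decomposition: f is its variation V minus V - f, both nondecreasing and absolutely
    continuous. *)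
Lemma acontinuous_FTC (R : realType) (a b : R) (f : R -> R) : a < b -> acontinuous a b f ->
  exists g : R -> R, [/\ mu.-integrable `[a, b] (EFin \o g),
    {ae mu, forall x, a < x < b -> is_derive x 1 f (g x)} &
    (f b - f a)%:E = (\int[mu]_(x in `[a, b]) (g x)%:E)%E].
Proof.
move=> ab fac.
pose V x := fine (total_variation a x f).
have Vac : acontinuous a b V by exact: acontinuous_total_variation.
have VB x y : x \in `[a, b] -> y \in `[a, b] -> x <= y -> `|f y - f x| <= V y - V x.
  rewrite !in_itv/= => /andP[ax xb] /andP[ay yb] xy.
  have : bounded_variation a y f.
    exact: acontinuous_bounded_variation (acontinuous_sub (lexx a) yb fac).
  move=> /bounded_variationP; rewrite ay => /(_ isT).
  rewrite /V (total_variationD f ax xy) fin_numD => /andP[f1 f2].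
  by rewrite fineD// addrAC subrr add0r -lee_fin fineK// total_variation_ge.
have Vnd : {in `[a, b] &, {homo V : x y / x <= y}}.
  by move=> x y xab yab xy; rewrite -subr_ge0 (le_trans _ (VB _ _ xab yab xy)).
pose W x := V x - f x.
have Wnd : {in `[a, b] &, {homo W : x y / x <= y}}.
  move=> x y xab yab xy; have := VB _ _ xab yab xy.
  by rewrite /W ler_norml => /andP[_]; lra.
have Wac : acontinuous a b W.
  apply: (@acontinuous_le _ _ _ V _ 2) => // s t as_ st tb.
  have sab : s \in `[a, b] by rewrite in_itv/= as_ (le_trans st).
  have tab : t \in `[a, b] by rewrite in_itv/= tb (le_trans as_).
  have V0 : 0 <= V t - V s by rewrite subr_ge0 Vnd.
  have := VB _ _ sab tab st.
  by rewrite (ger0_norm V0) /W !ler_norml => /andP[? ?]; apply/andP; split; lra.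
have [g1 [ig1 dg1 Fg1]] := nondecreasing_acontinuous_FTC ab Vnd Vac.
have [g2 [ig2 dg2 Fg2]] := nondecreasing_acontinuous_FTC ab Wnd Wac.
exists (fun x => g1 x - g2 x); split.
- rewrite (_ : _ \o _ = (EFin \o g1) \- (EFin \o g2))%E; first exact: integrableB.
  by apply/funext => x.
- apply: filterS2 dg1 dg2; first exact: (ae_filter_ringOfSetsType mu).
  move=> x d1 d2 axb; have [dV eV] := d1 axb; have [dW eW] := d2 axb.
  have -> : f = V - W by apply/funext => y; rewrite !fctE /W; lra.
  by split; [exact: derivableB|rewrite deriveB// eV eW].
- under eq_integral do rewrite EFinB.
  rewrite integralB//.
  by rewrite -Fg1 -Fg2 -EFinB; congr (_%:E); rewrite /W; lra.
Qed.

(** The integral is a difference of suprema over simple functions below the positive and negative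
    parts, hence monotone for arbitrary functions. This matters for [action], whose integrand is not
    known to be measurable. *)
Lemma le_integral_nonmeasurable d (T : measurableType d) (R : realType)
    (nu : {measure set T -> \bar R}) (D : set T) (f g : T -> \bar R) :
  (forall x, D x -> f x <= g x)%E ->
  (\int[nu]_(x in D) f x <= \int[nu]_(x in D) g x)%E.
Proof.
move=> fg; rewrite /integral.
have fg' x : ((f \_ D) x <= (g \_ D) x)%E.
  by rewrite /patch; case: ifPn => // /set_mem; exact: fg.
apply: leeB; apply: le_ereal_sup => _ [h hf <-]; exists h => // x; apply: le_trans (hf x) _.
  by rewrite !funeposE /= ge_max le_max fg' le_max lexx !orbT.
by rewrite !funenegE /= ge_max le_max leeN2 fg' le_max lexx !orbT.
Qed.

(** The minorant is the derivative of F off a null set and the lower bound C on it. Being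
    integrable, it stands in for f, about which no measurability is known. *)
Lemma acontinuous_le_integrable (R : realType) (a b : R) (f F : R -> R) (C : R) :
  a <= b -> acontinuous a b F -> (forall s, a <= s <= b -> C <= f s) ->
  {ae mu, forall x, a < x < b -> forall d : R, is_derive x 1 F d -> d <= f x} ->
  exists g : R -> R, [/\ mu.-integrable `[a, b] (EFin \o g),
    forall s, a <= s <= b -> g s <= f s &
    ((F b - F a)%:E <= \int[mu]_(x in `[a, b]) (g x)%:E)%E].
Proof.
rewrite le_eqVlt => /orP[/eqP <-|ab] Fac Cf Ff.
  exists (cst C); split; [|exact: Cf|].
  - apply: continuous_compact_integrable; first exact: segment_compact.
    by apply: continuous_subspaceT => x; exact: cvg_cst.
  - by rewrite subrr set_itv1 integral_set1.
have [g0 [ig0 dg0 Fg0]] := acontinuous_FTC ab Fac.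
have : {ae mu, forall x, a < x < b -> g0 x <= f x}.
  apply: filterS2 dg0 Ff; first exact: (ae_filter_ringOfSetsType mu).
  by move=> x h1 h2 axb; apply: h2 => //; exact: h1.
move=> [N [mN N0 hN]].
(* The endpoints join the exceptional set, as the almost everywhere statements only cover the open
   interval. *)
pose N' := N `|` [set a; b].
have mN' : measurable N' by apply: measurableU => //; apply: measurableU; exact: measurable_set1.
have N'0 : mu N' = 0%E.
  rewrite measureU0//; first by apply: measurableU; exact: measurable_set1.
  by rewrite measureU0; [exact: lebesgue_measure_set1|exact: measurable_set1|
    exact: measurable_set1|exact: lebesgue_measure_set1].
pose g x := if x \in N' then C else g0 x.
have gN' x : a <= x <= b -> ~ N' x -> g0 x <= f x.
  move=> /andP[ax xb] N'x; apply: contrapT => gf; apply: N'x.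
  have [ax'|] := ltP a x; last by move=> xa; right; left; apply/eqP; rewrite eq_le ax xa.
  have [xb'|] := ltP x b; last by move=> bx; right; right; apply/eqP; rewrite eq_le xb bx.
  by left; apply: hN => /(_ _)h; apply: gf; apply: h; rewrite ax'.
have mg0 : measurable_fun `[a, b] (g0 : measurableTypeR R -> R) by apply/measurable_EFinP; exact: measurable_int ig0.
have mg : measurable_fun `[a, b] (g : measurableTypeR R -> R).
  apply: measurable_fun_if => //.
  - apply: (measurable_fun_bool true).
    rewrite (_ : _ @^-1` _ = N'); last first.
      by apply/seteqP; split => [x /= xN|x xN /=]; [exact: set_mem|exact: mem_set].
    exact: measurableI.
  - by apply: measurable_funS mg0 => //; exact: measurable_itv.
have gg0 : ae_eq mu `[a, b]%classic (EFin \o g) (EFin \o g0).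
  exists N'; split => // x /= xP; apply: contrapT => N'x; apply: xP => _.
  by rewrite /g memNset.
have ig : mu.-integrable `[a, b] (EFin \o g).
  apply/integrableP; split; first exact/measurable_EFinP.
  have /integrableP[_] := ig0; apply: le_lt_trans.
  rewrite le_eqVlt; apply/orP; left; apply/eqP.
  apply: ge0_ae_eq_integral => //.
  - by apply: measurableT_comp => //; exact/measurable_EFinP.
  - by apply: measurableT_comp => //; exact/measurable_EFinP.
  - by apply: filterS gg0 => x /= h /h [->].
exists g; split => //.
  move=> s sab; rewrite /g; case: ifPn => sN; first exact: Cf.
  by apply: gN' => //; move: sN; rewrite notin_setE.
rewrite Fg0 (ae_eq_integral (EFin \o g))//.
- exact: measurable_int ig0.
- exact: measurable_int ig.
- exact: ae_eq_sym.
Qed.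

(** * Hamiltonians in a chart and their Legendre transforms *)

Lemma near_fst (T1 T2 : topologicalType) (x : T1) (y : T2) (P : T1 -> Prop) :
  (\forall a \near x, P a) -> \forall z \near (x, y), P z.1.
Proof. by move=> h; exact: (@cvg_fst _ _ (nbhs x) (nbhs y) _ _ h). Qed.

Lemma near_snd (T1 T2 : topologicalType) (x : T1) (y : T2) (P : T2 -> Prop) :
  (\forall a \near y, P a) -> \forall z \near (x, y), P z.2.
Proof. by move=> h; exact: (@cvg_snd _ _ (nbhs x) (nbhs y) _ _ h). Qed.

Lemma near_pair1 (T1 T2 : topologicalType) (x : T1) (y : T2) (P : T1 * T2 -> Prop) :
  (\forall z \near (x, y), P z) -> \forall a \near x, P (a, y).
Proof.
move=> [[A B] [/= nA nB] AB]; apply: filterS nA => a Aa; apply: AB; split => //=.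
exact: nbhs_singleton.
Qed.

Lemma near_pair2 (T1 T2 : topologicalType) (x : T1) (y : T2) (P : T1 * T2 -> Prop) :
  (\forall z \near (x, y), P z) -> \forall b \near y, P (x, b).
Proof.
move=> [[A B] [/= nA nB] AB]; apply: filterS nB => b Bb; apply: AB; split => //=.
exact: nbhs_singleton.
Qed.

Lemma near_dist (R : realType) (W : normedModType R) (x : W) (d : R) : 0 < d ->
  \forall y \near x, `|y - x| < d.
Proof.
by move=> d0; apply: filterS (nbhsx_ballx x d d0) => y; rewrite -ball_normE/= distrC.
Qed.

Lemma continuous_ptP (R : realType) (W W' : normedModType R) (f : W -> W') (x : W) :
  {for x, continuous f} <-> forall e, 0 < e -> \forall y \near x, `|f y - f x| <= e.
Proof.
split=> [/cvgrPdist_le h e e0|h]; first by apply: filterS (h e e0) => y; rewrite distrC.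
by apply/cvgrPdist_le => e e0; apply: filterS (h e e0) => y; rewrite distrC.
Qed.

Lemma continuous_near_gt (R : realType) (T : topologicalType) (f : T -> R) (x : T) (c : R) :
  {for x, continuous f} -> c < f x -> \forall y \near x, c < f y.
Proof. by move=> cf cfx; exact: (cvgr_gt _ cf _ cfx). Qed.

Lemma continuous_near_lt (R : realType) (T : topologicalType) (f : T -> R) (x : T) (c : R) :
  {for x, continuous f} -> f x < c -> \forall y \near x, f y < c.
Proof. by move=> cf cfx; exact: (cvgr_lt _ cf _ cfx). Qed.

Lemma near_norm (R : realType) (W : normedModType R) (x : W) (P : W -> Prop) :
  (\forall y \near x, P y) -> exists2 d : R, 0 < d & forall y, `|y - x| < d -> P y.
Proof.
move=> /nbhs_ballP[d /= d0 hd]; exists d => // y yd.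
by apply: hd; rewrite -ball_normE/= distrC.
Qed.

Lemma continuous_discount (R : realType) (T : topologicalType) (lam : R) (f w : T -> R) (x : T) :
  {for x, continuous f} -> {for x, continuous w} ->
  {for x, continuous (fun q => - (lam * (f q - w q)))}.
Proof.
move=> cf cw; apply: (@cvgN _ _ _ (nbhs x) _ (fun q => lam * (f q - w q))).
by apply: cvgMr; exact: cvgB.
Qed.

Section row_vectors.
Context {R : realType} {n : nat}.
Local Notation V := 'rV[R]_n.
Implicit Types p q v w : V.

Lemma norm_coord v k : `|v ord0 k| <= `|v|.
Proof.
rewrite [leRHS]mx_normrE.
exact: (le_bigmax _ (fun ij : 'I_1 * 'I_n => `|v ij.1 ij.2|) (ord0, k)).
Qed.

Lemma norm_rV_le v c : 0 <= c -> (forall k, `|v ord0 k| <= c) -> `|v| <= c.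
Proof.
move=> c0 vc; rewrite [leLHS]mx_normrE; apply: bigmax_le => // -[i k] _ /=.
by rewrite (ord1 i).
Qed.

Lemma pairingC p v : pairing p v = pairing v p.
Proof. by apply: eq_bigr => k _; rewrite mulrC. Qed.

Lemma pairingDl p q v : pairing (p + q) v = pairing p v + pairing q v.
Proof. by rewrite -big_split; apply: eq_bigr => k _; rewrite mxE mulrDl. Qed.

Lemma pairingZl a p v : pairing (a *: p) v = a * pairing p v.
Proof. by rewrite /pairing mulr_sumr; apply: eq_bigr => k _; rewrite mxE mulrA. Qed.

Lemma pairingNl p v : pairing (- p) v = - pairing p v.
Proof. by rewrite -scaleN1r pairingZl mulN1r. Qed.

Lemma pairingBl p q v : pairing (p - q) v = pairing p v - pairing q v.
Proof. by rewrite pairingDl pairingNl. Qed.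

Lemma pairing0l v : pairing 0 v = 0.
Proof. by rewrite -(scale0r 0) pairingZl mul0r. Qed.

Lemma pairingDr p v w : pairing p (v + w) = pairing p v + pairing p w.
Proof. by rewrite pairingC pairingDl !(pairingC _ p). Qed.

Lemma pairingZr a p v : pairing p (a *: v) = a * pairing p v.
Proof. by rewrite pairingC pairingZl pairingC. Qed.

Lemma pairingNr p v : pairing p (- v) = - pairing p v.
Proof. by rewrite pairingC pairingNl pairingC. Qed.

Lemma pairingBr p v w : pairing p (v - w) = pairing p v - pairing p w.
Proof. by rewrite pairingDr pairingNr. Qed.

Lemma pairing0r p : pairing p 0 = 0.
Proof. by rewrite pairingC pairing0l. Qed.

(** The factor n comes from the norm on row vectors, which is the maximum norm. *)
Lemma pairing_bound p v : `|pairing p v| <= n%:R * (`|p| * `|v|).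
Proof.
apply: le_trans (ler_norm_sum _ _ _) _.
apply: (@le_trans _ _ (\sum_(k < n) `|p| * `|v|)).
  apply: ler_sum => k _; rewrite normrM; apply: ler_pM => //; exact: norm_coord.
by rewrite sumr_const card_ord mulr_natl.
Qed.

Lemma pairing_le p v : pairing p v <= n%:R * (`|p| * `|v|).
Proof. exact: le_trans (ler_norm _) (pairing_bound _ _). Qed.

Lemma pairing_sqr_ge v : `|v| ^+ 2 <= pairing v v.
Proof.
have v0 : 0 <= pairing v v by apply: sumr_ge0 => k _; rewrite -expr2 sqr_ge0.
rewrite -[leRHS]sqr_sqrtr// lerXn2r ?nnegrE ?sqrtr_ge0//.
apply: norm_rV_le => [|k]; first exact: sqrtr_ge0.
rewrite -sqrtr_sqr ler_sqrt// expr2 /pairing (bigD1 k)//= lerDl.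
by apply: sumr_ge0 => j _; rewrite -expr2 sqr_ge0.
Qed.

Lemma continuous_pairing : continuous (fun z : V * V => pairing z.1 z.2).
Proof.
move=> z; rewrite /pairing; apply: cvg_big => [|k _]; first exact: add_continuous.
apply: (@cvgM _ _ _ _ (fun x : V * V => x.1 ord0 k) (fun x : V * V => x.2 ord0 k)).
  by apply: (continuous_cvg _ (@coord_continuous R 1 n ord0 k _)); exact: cvg_fst.
by apply: (continuous_cvg _ (@coord_continuous R 1 n ord0 k _)); exact: cvg_snd.
Qed.

Lemma cvg_pairing (T : Type) (F : set_system T) {FF : Filter F} (f g : T -> V) p v :
  f @ F --> p -> g @ F --> v -> (fun x => pairing (f x) (g x)) @ F --> pairing p v.
Proof.
move=> fp gv.
exact: (@cvg_comp _ _ _ (fun x => (f x, g x)) _ F _ _ (cvg_pair fp gv)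
  (@continuous_pairing (p, v))).
Qed.

Lemma continuous_pairingl v : continuous (fun p => pairing p v).
Proof.
move=> p; exact: (@cvg_pairing _ (nbhs p) _ id (fun=> v) p v cvg_id (cvg_cst v)).
Qed.

Lemma compact_ball_rV p (r : R) : compact [set x : V | `|x - p| <= r].
Proof.
apply: bounded_closed_compact.
  exists (r + `|p|); split; first exact: num_real.
  move=> M rM x /= xp; rewrite -[x](subrK p) (le_trans (ler_normD _ _))//.
  by rewrite (le_trans _ (ltW rM))// lerD2r.
apply: (@closed_comp _ _ (fun x : V => `|x - p|) [set y | y <= r]); last exact: closed_le.
move=> x _; apply: (@cvg_norm _ _ _ (nbhs x) _ (fun y => y - p)).
by apply: cvgB; [exact: cvg_id|exact: cvg_cst].
Qed.

End row_vectors.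

Section hamiltonian.
Context {R : realType} {n : nat}.
Local Notation V := 'rV[R]_n.
Implicit Types (U : set V) (K : V * V -> R) (Kq Kp : V * V -> V).

(* [ham_sdiff] is strict differentiability, with gradient [(Kq, Kp)]. *)
Record is_hamiltonian U K Kq Kp : Prop := IsHamiltonian {
  ham_open : open U;
  ham_sdiff : forall z : V * V, U z.1 -> forall e, 0 < e -> exists2 d, 0 < d &
    forall x y : V * V, `|x - z| < d -> `|y - z| < d ->
      `|K x - K y - pairing (Kq z) (x.1 - y.1) - pairing (Kp z) (x.2 - y.2)|
      <= e * `|x - y|;
  ham_cq : forall z : V * V, U z.1 -> {for z, continuous Kq};
  ham_cp : forall z : V * V, U z.1 -> {for z, continuous Kp};
  ham_conv : forall q p p', U q -> p' != p ->
    K (q, p) + pairing (Kp (q, p)) (p' - p) < K (q, p');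
  ham_coer : forall q0 k, U q0 -> exists C, \forall q \near q0, forall p,
    k * `|p| - C <= K (q, p) }.

Definition legendre K (q v : V) : R := sup [set pairing p v - K (q, p) | p in [set: V]].

Definition maximizer K (q v p : V) := forall p',
  pairing p' v - K (q, p') <= pairing p v - K (q, p).

Lemma maximizer_legendre K q v p : maximizer K q v p ->
  legendre K q v = pairing p v - K (q, p).
Proof.
move=> pmax; apply/eqP; rewrite eq_le; apply/andP; split.
  by apply: ge_sup => [|_ [p' _ <-]]; [exists (pairing p v - K (q, p)), p|exact: pmax].
apply: ub_le_sup; last by exists p.
by exists (pairing p v - K (q, p)) => _ [p' _ <-]; exact: pmax.
Qed.

Lemma norm_pair_fst (x y : V * V) : `|x.1 - y.1| <= `|x - y|.
Proof. by rewrite [leRHS]prod_normE le_max lexx. Qed.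

Lemma norm_pair_snd (x y : V * V) : `|x.2 - y.2| <= `|x - y|.
Proof. by rewrite [leRHS]prod_normE le_max lexx orbT. Qed.

Section theory.
Variables (U : set V) (K : V * V -> R) (Kq Kp : V * V -> V).
Hypothesis ham : is_hamiltonian U K Kq Kp.

Lemma ham_near q : U q -> \forall q' \near q, U q'.
Proof. by move=> Uq; apply: open_nbhs_nbhs; split => //; exact: ham_open ham. Qed.

Lemma ham_continuous (z : V * V) : U z.1 -> {for z, continuous K}.
Proof.
move=> Uz; apply/cvgrPdist_le => e e0.
have [d d0 sd] := ham_sdiff ham Uz ltr01.
pose C := 1 + n%:R * `|Kq z| + n%:R * `|Kp z|.
have C0 : 0 < C by rewrite /C -addrA ltr_pwDl// addr_ge0// mulr_ge0.
near=> y.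
have yd : `|y - z| < d by near: y; exact: (near_dist z).
have ye : `|y - z| < e / C by near: y; apply: (near_dist z); rewrite divr_gt0.
have zd : `|z - z| < d by rewrite subrr normr0.
have := sd z y zd yd; rewrite mul1r => h.
have h1 : `|K z - K y| <= C * `|z - y|.
  rewrite -[K z - K y](subrK (pairing (Kq z) (z.1 - y.1) + pairing (Kp z) (z.2 - y.2))).
  apply: le_trans (ler_normD _ _) _; rewrite opprD addrA.
  have a1 := pairing_bound (Kq z) (z.1 - y.1).
  have a2 := pairing_bound (Kp z) (z.2 - y.2).
  have b1 : n%:R * (`|Kq z| * `|z.1 - y.1|) <= n%:R * `|Kq z| * `|z - y|.
    by rewrite -mulrA ler_wpM2l// ler_wpM2l// norm_pair_fst.
  have b2 : n%:R * (`|Kp z| * `|z.2 - y.2|) <= n%:R * `|Kp z| * `|z - y|.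
    by rewrite -mulrA ler_wpM2l// ler_wpM2l// norm_pair_snd.
  have a3 := ler_normD (pairing (Kq z) (z.1 - y.1)) (pairing (Kp z) (z.2 - y.2)).
  rewrite /C !mulrDl mul1r; lra.
apply: le_trans h1 _; rewrite mulrC -ler_pdivlMr// distrC; exact: ltW.
Unshelve. all: by end_near. Qed.

Lemma ham_near_le q p e : U q -> 0 < e -> \forall q' \near q, `|K (q', p) - K (q, p)| <= e.
Proof.
move=> Uq e0.
have /(@ham_continuous (q, p))/cvgrPdist_le/(_ e e0) h : U (q, p).1 by [].
by apply: filterS (near_pair1 h) => x; rewrite distrC.
Qed.

Lemma cvg_ham (T : Type) (F : set_system T) {FF : Filter F} (f g : T -> V) q p : U q ->
  f @ F --> q -> g @ F --> p -> (fun x => K (f x, g x)) @ F --> K (q, p).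
Proof.
move=> Uq fp gv; exact: (@cvg_comp _ _ _ (fun x => (f x, g x)) _ F _ _ (cvg_pair fp gv)
  (@ham_continuous (q, p) Uq)).
Qed.

Lemma maximizer_exists q v : U q -> exists p, maximizer K q v p.
Proof.
move=> Uq; have [C /nbhs_singleton Ck] := ham_coer ham (n%:R * `|v| + 1) Uq.
(* With the slope n |v| + 1 in the coercivity estimate, the objective at p is at most C - |p|, hence
   below its value at 0 outside the ball of radius B. *)
pose B := `|C + K (q, 0)|.
have [||p pB pmax] := @compact_EVT_max _ _ (fun p => pairing p v - K (q, p))
    [set p | `|p - 0| <= B] _ (@compact_ball_rV R n 0 B) _.
- by exists (0 : V); rewrite /= subr0 normr0 /B.
- apply: continuous_in_subspaceT => p _.
  have cK : {for p, continuous (fun p' => K (q, p'))}.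
    apply/continuous_ptP => e e0.
    have /(@ham_continuous (q, p))/continuous_ptP/(_ e e0) h : U (q, p).1 by [].
    exact: (near_pair2 h).
  exact: (@continuousB _ _ _ (fun p => pairing p v) _ p (@continuous_pairingl _ _ v p) cK).
exists p => p'; have [p'B|Bp'] := leP `|p' - 0| B; first by apply: pmax; exact/mem_set.
have := pmax 0; rewrite pairing0l sub0r => /(_ _)h; apply: le_trans (h _); last first.
  by apply/mem_set; rewrite /= subr0 normr0 /B.
rewrite subr0 in Bp'; have := Ck p'; have := pairing_le p' v.
have := le_lt_trans (ler_norm _) Bp'.
rewrite mulrDl mul1r (mulrC `|p'|) mulrA; lra.
Qed.

Lemma fenchel q v p : U q -> pairing p v <= legendre K q v + K (q, p).
Proof.
move=> Uq; have [p0 p0max] := maximizer_exists v Uq.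
by rewrite (maximizer_legendre p0max) -lerBlDr; exact: p0max.
Qed.

Lemma maximizer_bound q0 B0 : U q0 -> exists B, \forall q \near q0, forall v p,
  `|v| <= B0 -> maximizer K q v p -> `|p| <= B.
Proof.
move=> Uq0; have [C Ck] := ham_coer ham (n%:R * B0 + 1) Uq0.
exists (C + K (q0, 0) + 1); have h0 := ham_near_le 0 Uq0 (@ltr01 R).
near=> q => v p vB /(_ 0); rewrite pairing0l sub0r.
have : (n%:R * B0 + 1) * `|p| - C <= K (q, p) by move: p; near: q.
have : `|K (q, 0) - K (q0, 0)| <= 1 by near: q.
have : n%:R * (`|p| * `|v|) <= n%:R * B0 * `|p|.
  by rewrite -mulrA ler_wpM2l// mulrC ler_wpM2r.
have := pairing_le p v; rewrite ler_norml mulrDl mul1r => ? ? /andP[]; lra.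
Unshelve. all: by end_near. Qed.

(** First-order condition, tested by moving p along the defect [v - Kp (q, p)] itself. *)
Lemma maximizer_grad q v p : U q -> maximizer K q v p -> v = Kp (q, p).
Proof.
move=> Uq pmax; apply/eqP; rewrite -subr_eq0 -normr_le0; apply/ler_addgt0Pr => e e0; rewrite add0r.
set w := v - _.
have [->|w0] := eqVneq w 0; first by rewrite normr0 ltW.
have nw0 : 0 < `|w| by rewrite normr_gt0.
have [d d0 sd] := ham_sdiff ham (Uq : U (q, p).1) e0.
pose s := d / (2 * `|w|).
have s0 : 0 < s by rewrite divr_gt0// mulr_gt0.
have swE : `|s *: w| = d / 2.
  by rewrite normrZ gtr0_norm// /s invfM mulrA mulfVK// gt_eqF.
have E : (q, p + s *: w) - (q, p) = (0, s *: w).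
  by apply: injective_projections => /=; rewrite ?subrr// addrAC subrr add0r.
have nE : `|(q, p + s *: w) - (q, p)| = `|s *: w|.
  by rewrite E prod_normE/= normr0; apply/max_idPr.
have h1 : `|(q, p + s *: w) - (q, p)| < d by rewrite nE swE; lra.
have h2 : `|(q, p) - (q, p)| < d by rewrite subrr normr0.
have := sd _ _ h1 h2; rewrite nE /= subrr pairing0r subr0.
have -> : p + s *: w - p = s *: w by rewrite addrAC subrr add0r.
rewrite normrZ (gtr0_norm s0) pairingZr ler_norml => /andP[_ h3].
have := pmax (p + s *: w); rewrite pairingDl pairingZl.
have := pairing_sqr_ge w; rewrite {2}/w pairingBl => h4 h5.
have h6 : s * `|w| ^+ 2 <= e * (s * `|w|).
  rewrite (pairingC w v) in h5 h4.
  have : s * `|w| ^+ 2 <= s * (pairing v w - pairing (Kp (q, p)) w) by rewrite ler_wpM2l// ltW.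
  by rewrite mulrBr; lra.
move: h6; by rewrite (mulrCA e) expr2 ler_pM2l// ler_pM2r.
Qed.

Lemma grad_maximizer q p : U q -> maximizer K q (Kp (q, p)) p.
Proof.
move=> Uq p'; have [->//|pp'] := eqVneq p' p.
have := ham_conv ham Uq pp'; rewrite pairingBr (pairingC p') (pairingC p); lra.
Qed.

Lemma maximizer_unique q v p p' : U q -> maximizer K q v p -> maximizer K q v p' -> p' = p.
Proof.
move=> Uq pm p'm; apply: contrapT => /eqP pp'.
have vE := maximizer_grad Uq pm.
have := ham_conv ham Uq pp'; have := p'm p.
by rewrite -vE pairingBr (pairingC p') (pairingC p); lra.
Qed.

(** Nearby maximizers stay in a fixed ball. On the compact part of it at distance at least e from p
    the objective at (q, v) is strictly smaller than at p, by uniqueness, and this persists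
    uniformly near (q, v). *)
Lemma maximizer_continuous q v p e : U q -> maximizer K q v p -> 0 < e ->
  \forall y \near (q, v), forall p', maximizer K y.1 y.2 p' -> `|p' - p| < e.
Proof.
move=> Uq pm e0.
have [B hB] := maximizer_bound (`|v| + 1) Uq.
pose A := [set p' : V | `|p' - 0| <= B] `&` [set p' | e <= `|p' - p|].
have cA : compact A.
  apply: compact_closedI; first exact: compact_ball_rV.
  apply: (@closed_comp _ _ (fun x : V => `|x - p|) [set y | e <= y]); last exact: closed_ge.
  move=> x _; apply: (@cvg_norm _ _ _ (nbhs x) _ (fun y => y - p)).
  by apply: cvgB; [exact: cvg_id|exact: cvg_cst].
have nA : \forall y \near (q, v), A `<=` (fun p3 => ~ maximizer K y.1 y.2 p3).
  apply: (proj1 (compact_near_coveringP A) cA _ (nbhs (q, v))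
    (fun y p3 => ~ maximizer K y.1 y.2 p3)) => p3 [_ /= ep3].
  have p3p : p3 != p by apply: contraTneq ep3 => ->; rewrite subrr normr0 -ltNge.
  have lt3 : pairing p3 v - K (q, p3) < pairing p v - K (q, p).
    rewrite lt_neqAle pm andbT; apply: contra_neqT p3p => /negPn/eqP E.
    by apply: (maximizer_unique Uq pm) => p4; rewrite E; exact: pm.
  pose Phi z : R := (pairing p z.2.2 - K (z.2.1, p)) - (pairing z.1 z.2.2 - K (z.2.1, z.1)).
  have cPhi : Phi z @[z --> (p3, (q, v))] --> Phi (p3, (q, v)).
    have c1 : z.1 @[z --> (p3, (q, v))] --> p3 by exact: cvg_fst.
    have c2 : z.2.1 @[z --> (p3, (q, v))] --> q.
      exact: (cvg_comp _ _ (@cvg_snd _ _ (nbhs p3) (nbhs (q, v)) _) (@cvg_fst _ _ (nbhs q) (nbhs v) _)).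
    have c3 : z.2.2 @[z --> (p3, (q, v))] --> v.
      exact: (cvg_comp _ _ (@cvg_snd _ _ (nbhs p3) (nbhs (q, v)) _) (@cvg_snd _ _ (nbhs q) (nbhs v) _)).
    apply: cvgB; apply: cvgB.
    - exact: cvg_pairing (cvg_cst p) c3.
    - exact: cvg_ham Uq c2 (cvg_cst p).
    - exact: cvg_pairing c1 c3.
    - exact: cvg_ham Uq c2 c1.
  have Phi0 : 0 < Phi (p3, (q, v)) by rewrite /Phi/= subr_gt0.
  have FF : Filter (nbhs (p3, (q, v))) by exact: nbhs_filter.
  have := @cvgr_gt _ _ (nbhs (p3, (q, v))) FF Phi _ cPhi _ Phi0.
  apply: filterS => -[p4 [q4 v4]] /=; rewrite /Phi/= subr_gt0 => h /(_ p).
  by rewrite leNgt h.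
have nq := near_fst v hB.
have nv := near_snd q (near_dist v (@ltr01 R)).
apply: filterS3 nA nq nv => -[q' v'] /= h1 h2 h3 p' p'm.
rewrite ltNge; apply/negP => ep'; apply: (h1 p') => //; split => //=.
rewrite subr0; apply: h2 p'm.
by rewrite -[v'](subrK v) (le_trans (ler_normD _ _))// addrC lerD2l ltW.
Qed.

(** Envelope argument: a maximizer p' at the nearby point is a competitor at (q, v) and is close to
    p. Both optimality conditions of the doubling call for this upper bound on the Legendre
    transform. *)
Lemma danskin q v p e : U q -> maximizer K q v p -> 0 < e ->
  \forall y \near (q, v), legendre K y.1 y.2 - legendre K q v <=
    pairing p (y.2 - v) - pairing (Kq (q, p)) (y.1 - q) + e * `|y - (q, v)|.
Proof.
move=> Uq pm e0.
have e20 : 0 < e / 2 by rewrite divr_gt0.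
have n0 : 0 < n%:R + 1 :> R by rewrite ltr_wpDl.
have [d d0 sd] := ham_sdiff ham (Uq : U (q, p).1) e20.
have h1 := maximizer_continuous Uq pm (divr_gt0 e20 n0).
have h2 := maximizer_continuous Uq pm d0.
have h3 := near_dist (q, v) d0.
have h4 := near_fst v (ham_near Uq).
near=> y.
have Uy : U y.1 by near: y.
have [p' p'm] := maximizer_exists y.2 Uy.
have pp'1 : `|p' - p| < e / 2 / (n%:R + 1) by move: p' p'm; near: y.
have pp'2 : `|p' - p| < d by move: p' p'm {pp'1}; near: y.
have yd : `|y - (q, v)| < d by near: y.
rewrite (maximizer_legendre p'm).
have := fenchel v p' Uq => fe.
have x1 : `|(y.1, p') - (q, p)| < d.
  by rewrite prod_normE/= gt_max pp'2 andbT (le_lt_trans (norm_pair_fst y (q, v))).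
have x2 : `|(q, p') - (q, p)| < d.
  by rewrite prod_normE/= gt_max pp'2 andbT subrr normr0.
have := sd _ _ x1 x2; rewrite /= subrr pairing0r subr0 => sd'.
have E : `|(y.1, p') - (q, p')| <= `|y - (q, v)|.
  by rewrite prod_normE/= subrr normr0 ge_max normr_ge0 (norm_pair_fst y (q, v)).
have sd2 : pairing (Kq (q, p)) (y.1 - q) - e / 2 * `|y - (q, v)| <= K (y.1, p') - K (q, p').
  have := le_trans sd' (ler_wpM2l (ltW e20) E).
  by rewrite ler_norml => /andP[+ _]; lra.
have pb : pairing (p' - p) (y.2 - v) <= e / 2 * `|y - (q, v)|.
  apply: le_trans (pairing_le _ _) _; rewrite mulrA ler_pM//.
  - have : `|p' - p| * (n%:R + 1) <= e / 2 by rewrite -ler_pdivlMr// ltW.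
    by rewrite mulrDr mulr1 mulrC; have := normr_ge0 (p' - p); lra.
  - exact: (norm_pair_snd y (q, v)).
have : pairing p' y.2 - pairing p' v = pairing p (y.2 - v) + pairing (p' - p) (y.2 - v).
  by rewrite pairingBl !pairingBr; lra.
have -> : e = e / 2 + e / 2 by lra.
rewrite mulrDl; lra.
Unshelve. all: by end_near. Qed.

Lemma legendre_continuous (q v : V) : U q ->
  {for (q, v), continuous (fun y : V * V => legendre K y.1 y.2)}.
Proof.
move=> Uq; have [p pm] := maximizer_exists v Uq.
apply/continuous_ptP => e e0.
have h1 := danskin Uq pm (@ltr01 R).
pose C := n%:R * `|p| + n%:R * `|Kq (q, p)| + 1.
have C0 : 0 < C by rewrite ltr_wpDl// addr_ge0// mulr_ge0.
have h2 := near_dist (q, v) (divr_gt0 e0 C0).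
have h3 : \forall y \near (q, v), `|(pairing p y.2 - K (y.1, p)) - (pairing p v - K (q, p))| <= e.
  have c : {for (q, v), continuous (fun y : V * V => pairing p y.2 - K (y.1, p))}.
    apply: cvgB.
      exact: cvg_pairing (cvg_cst p) (@cvg_snd _ _ (nbhs q) (nbhs v) _).
    exact: cvg_ham Uq (@cvg_fst _ _ (nbhs q) (nbhs v) _) (cvg_cst p).
  exact: (proj1 (continuous_ptP _ _) c e e0).
have h4 := near_fst v (ham_near Uq).
near=> y.
have Uy : U y.1 by near: y.
have yC : `|y - (q, v)| < e / C by near: y.
have l1 : `|(pairing p y.2 - K (y.1, p)) - (pairing p v - K (q, p))| <= e by near: y.
have l2 : legendre K y.1 y.2 - legendre K q v <=
    pairing p (y.2 - v) - pairing (Kq (q, p)) (y.1 - q) + 1 * `|y - (q, v)| by near: y.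
have f1 := fenchel y.2 p Uy.
rewrite ler_norml; apply/andP; split.
  by rewrite (maximizer_legendre pm); move: l1; rewrite ler_norml => /andP[+ _]; lra.
apply: le_trans l2 _.
apply: (@le_trans _ _ (C * `|y - (q, v)|)); last by rewrite mulrC -ler_pdivlMr// ltW.
rewrite /C !mulrDl lerD2r; apply: lerD.
  by rewrite -mulrA (le_trans (pairing_le _ _))// ler_wpM2l// ler_wpM2l// (norm_pair_snd y (q, v)).
rewrite -pairingNr; apply: le_trans (pairing_le _ _) _.
by rewrite -mulrA normrN ler_wpM2l// ler_wpM2l// (norm_pair_fst y (q, v)).
Unshelve. all: by end_near. Qed.

End theory.
End hamiltonian.

(** * One-sided derivatives and subsolutions in a chart *)

Section one_dimensional.
Context {R : realType}.

(** For each e > 0 the bound with slope c + e survives limits by continuity and extends to the right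
    by the Dini estimate, so the supremum of the times where it holds is s. *)
Lemma dini_mean_value (phi : R -> R) (s c : R) : 0 <= s ->
  (forall r, 0 <= r <= s -> {for r, continuous phi}) ->
  (forall r, 0 <= r < s -> forall e, 0 < e ->
     \forall h \near 0^'+, phi (r + h) - phi r <= h * (c + e)) ->
  phi s - phi 0 <= s * c.
Proof.
move=> s0 cphi dphi.
have key e : 0 < e -> phi s - phi 0 <= s * (c + e).
  move=> e0; pose S := [set r | 0 <= r <= s /\ phi r - phi 0 <= r * (c + e)].
  have S0 : S 0 by split; rewrite ?lexx// subrr mul0r.
  have hS : has_sup S by split; [exists 0 | exists s => y [/andP[]]].
  pose t := sup S.
  have t0 : 0 <= t by apply: ub_le_sup => //; exact: hS.2.
  have ts : t <= s by apply: ge_sup => //; [exists 0|move=> y [/andP[]]].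
  have St : phi t - phi 0 <= t * (c + e).
    rewrite leNgt; apply/negP => lt.
    pose psi r := phi r - phi 0 - r * (c + e).
    have cpsi : {for t, continuous psi}.
      apply: continuousB; first by apply: continuousB; [apply: cphi; rewrite t0|exact: cvg_cst].
      by apply: continuousM; [exact: cvg_id|exact: cvg_cst].
    have psit : 0 < psi t by rewrite subr_gt0.
    have /nbhs_ballP[d /= d0 hd] := continuous_near_gt cpsi psit.
    have [y [/andP[y0 ys] Sy] ty] := sup_adherent d0 hS.
    have yt : y <= t by apply: ub_le_sup => //; [exact: hS.2|split => //; rewrite y0].
    have := hd y; rewrite /ball/= ger0_norm ?subr_ge0// => /(_ _).
    have : t - y < d by rewrite -/t in ty; lra.
    by move=> h /(_ h); rewrite /psi; lra.
  have [<-//|st] := eqVneq t s.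
  have {st}ts' : t < s by rewrite lt_neqAle st.
  have ht : \forall h \near 0^'+, phi (t + h) - phi t <= h * (c + e).
    by apply: dphi => //; rewrite t0.
  have hs : \forall h \near 0^'+, h < s - t.
    by apply: nbhs_right_lt; rewrite subr_gt0.
  have h0 : \forall h \near 0^'+, (0 : R) < h by exact: nbhs_right_gt.
  have [h [[h1 h2] h3]] := filter_ex (filterI (filterI ht hs) h0).
  have : S (t + h).
    split; first by rewrite addr_ge0// ?(ltW h3)//=; lra.
    by rewrite mulrDl; lra.
  move=> /(ub_le_sup hS.2); rewrite -/t; lra.
apply/ler_addgt0Pr => e e0.
have := key (e / (s + 1)); rewrite divr_gt0 ?ltr_wpDl// => /(_ isT).
rewrite mulrDr => /le_trans; apply; rewrite lerD2l mulrCA ger_pMr//.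
by rewrite ler_pdivrMr ?ltr_wpDl// mul1r lerDl.
Qed.

End one_dimensional.

Section local_subsolutions.
Context {R : realType} {n : nat}.
Local Notation V := 'rV[R]_n.
Implicit Types (f l : V -> R) (q p v : V).

(** An upper bound c for the upper right Dini derivative of f along v. *)
Definition dini f q v (c : R) := forall e, 0 < e ->
  \forall h \near 0^'+, f (q + h *: v) - f q <= h * (c + e).

(** The Frechet subdifferential; [superdiff] is its mirror image. *)
Definition subdiff f q p := forall e, 0 < e ->
  \forall y \near q, pairing p (y - q) - e * `|y - q| <= f y - f q.

Definition superdiff f q p := forall e, 0 < e ->
  \forall y \near q, f y - f q <= pairing p (y - q) + e * `|y - q|.

Lemma near_ray q v (P : V -> Prop) : (\forall y \near q, P y) ->
  \forall h \near 0^'+, P (q + h *: v).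
Proof.
move=> /nbhs_ballP[d /= d0 hd].
have v0 : 0 < `|v| + 1 by rewrite ltr_wpDl.
near=> h; apply: hd; rewrite -ball_normE/= opprD addrA subrr add0r normrN normrZ.
rewrite gtr0_norm; last by near: h; exact: nbhs_right_gt.
apply: (@le_lt_trans _ _ (h * (`|v| + 1))); first by rewrite ler_wpM2l// lerDl.
by rewrite -ltr_pdivlMr//; near: h; apply: nbhs_right_lt; rewrite divr_gt0.
Unshelve. all: by end_near. Qed.

Lemma continuous_ray f q v (r : R) : {for q + r *: v, continuous f} ->
  {for r, continuous (fun t : R => f (q + t *: v))}.
Proof.
move=> cf; apply: (cvg_comp (fun t : R => q + t *: v) f) cf.
by apply: cvgD; [exact: cvg_cst|apply: cvgZl; exact: cvg_id].
Qed.

Section sub.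
Variables (U : set V) (K : V * V -> R) (Kq Kp : V * V -> V).
Hypothesis ham : is_hamiltonian U K Kq Kp.

(* The infinitesimal form of domination by the action of [K], with a level [l]
   that may depend on the point. *)
Definition local_sub l f := (forall q, U q -> {for q, continuous f}) /\
  (forall q v, U q -> dini f q v (legendre K q v + l q)).

Lemma local_sub_segment l f q v s c : local_sub l f -> 0 <= s ->
  (forall r, 0 <= r <= s -> U (q + r *: v)) ->
  (forall r, 0 <= r <= s -> legendre K (q + r *: v) v + l (q + r *: v) <= c) ->
  f (q + s *: v) - f q <= s * c.
Proof.
move=> [cf df] s0 Uqv Lc.
have := @dini_mean_value R (fun r => f (q + r *: v)) s c s0.
rewrite scale0r addr0; apply.
  by move=> r rs; apply: continuous_ray; exact/cf/Uqv.
move=> r /andP[r0 rs] e e0; have rs' : 0 <= r <= s by rewrite r0 ltW.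
apply: filterS2 (df _ v (Uqv r rs') e e0) (nbhs_right_gt 0) => h h1 h0.
have -> : q + (r + h) *: v = q + r *: v + h *: v by rewrite scalerDl addrA.
by apply: le_trans h1 _; rewrite (ler_wpM2l (ltW h0))// lerD2r Lc.
Qed.

Lemma legendre_near_bound q0 B0 : U q0 -> exists C, \forall q \near q0,
  forall v, `|v| <= B0 -> legendre K q v <= C.
Proof.
move=> Uq0; have [B hB] := maximizer_bound ham B0 Uq0.
have [C hC] := ham_coer ham 0 Uq0.
exists (n%:R * (`|B| * `|B0|) + C); near=> q => v vB0.
have Uq : U q by near: q; exact: (ham_near ham).
have [p pm] := maximizer_exists ham v Uq.
have pB : `|p| <= B by move: v p vB0 pm; near: q.
rewrite (maximizer_legendre pm); apply: lerD.
  apply: le_trans (pairing_le _ _) _; rewrite ler_wpM2l//.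
  by apply: ler_pM => //; [exact: le_trans pB (ler_norm _)|exact: le_trans vB0 (ler_norm _)].
have : 0 * `|p| - C <= K (q, p) by move: p {pm pB}; near: q.
by rewrite mul0r; lra.
Unshelve. all: by end_near. Qed.

(** Directions of norm 1 have bounded Legendre transform near q0, and integrating along segments
    gives a Lipschitz bound. C and r are fixed before l and f: the estimate is uniform over all
    subsolutions of level at most m. *)
Lemma local_sub_lipschitz q0 m : U q0 -> exists C r, [/\ 0 <= C, 0 < r,
  forall x, `|x - q0| < r -> U x &
  forall l f, local_sub l f -> (forall q, U q -> l q <= m) ->
    forall x y, `|x - q0| < r -> `|y - q0| < r -> f y - f x <= C * `|y - x|].
Proof.
move=> Uq0; have [C hC] := legendre_near_bound 1 Uq0.
have [r r0 hr] := near_norm (filterI (ham_near ham Uq0) hC).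
exists `|C + m|, r; split => // [x /hr[]//|l f lf lm x y xr yr].
have [->|xy] := eqVneq y x; first by rewrite !subrr normr0 mulr0.
pose s := `|y - x|; have s0 : 0 < s by rewrite normr_gt0 subr_eq0.
pose v := s^-1 *: (y - x).
have nv : `|v| = 1 by rewrite normrZ normfV normr_id mulVf// gt_eqF.
have yE : y = x + s *: v by rewrite scalerA divff ?gt_eqF// scale1r subrKC.
have seg t : 0 <= t <= s -> `|x + t *: v - q0| < r.
  move=> /andP[t0 ts].
  have -> : x + t *: v - q0 = (1 - t / s) *: (x - q0) + (t / s) *: (y - q0).
    rewrite /v scalerA scalerBl scale1r [_ + _ *: (y - q0)]addrC -addrA [RHS]addrC.
    rewrite -[in RHS]addrA [- _ + _]addrC -[in RHS]scalerBr.
    have -> : y - q0 - (x - q0) = y - x by rewrite opprB addrA subrK.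
    by rewrite addrA addrAC.
  have ts0 : 0 <= t / s by rewrite divr_ge0// ltW.
  have ts1 : 0 <= 1 - t / s by rewrite subr_ge0 ler_pdivrMr// mul1r.
  apply: le_lt_trans (ler_normD _ _) _; rewrite (normrZ (1 - t / s)) (normrZ (t / s)) (ger0_norm ts0) (ger0_norm ts1).
  pose M := Num.max `|x - q0| `|y - q0|.
  have Mr : M < r by rewrite gt_max xr.
  apply: le_lt_trans Mr; have -> : M = (1 - t / s) * M + t / s * M by lra.
  by apply: lerD; apply: ler_wpM2l => //; rewrite le_max lexx ?orbT.
rewrite -[`|y - x|]/s mulrC {1}yE.
apply: (@local_sub_segment l) => //; first exact: ltW.
  by move=> t /seg/hr[].
move=> t /seg/hr[Ux /(_ v)]; rewrite nv lexx => /(_ isT) h.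
by apply: le_trans (ler_norm _); apply: lerD => //; exact: lm.
Qed.

(** Tested in the direction [Kp (q, p)], for which p is a maximizer: the term [pairing p v] then
    occurs on both sides and cancels. *)
Lemma local_sub_subdiff l f q p : local_sub l f -> U q -> subdiff f q p -> K (q, p) <= l q.
Proof.
move=> [_ df] Uq fp; pose v := Kp (q, p).
have pm : maximizer K q v p by exact: (grad_maximizer ham).
apply/ler_addgt0Pr => e e0; pose e' := e / (1 + `|v|).
have v0 : 0 < 1 + `|v| by rewrite ltr_pwDl.
have e'0 : 0 < e' by rewrite divr_gt0.
have [h [[h1 h2] h0]] := filter_ex
  (filterI (filterI (df q v Uq e' e'0) (near_ray v (fp e' e'0))) (nbhs_right_gt 0)).
have h3 := le_trans h2 h1; rewrite (maximizer_legendre pm) in h3.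
have E : q + h *: v - q = h *: v by rewrite addrAC subrr add0r.
rewrite E pairingZr normrZ gtr0_norm// mulrCA -mulrBr ler_pM2l// in h3.
have -> : e = e' * (1 + `|v|) by rewrite mulfVK// gt_eqF.
by rewrite mulrDr mulr1; lra.
Qed.

(** A superdifferential bounds f only from above, so the Dini bound at q gives nothing directly. The
    subsolution is integrated instead along the segment that arrives at q with velocity [Kp (q, p)],
    which calls for the continuity of l. *)
Lemma local_sub_superdiff l f q p : local_sub l f -> U q -> {for q, continuous l} ->
  superdiff f q p -> K (q, p) <= l q.
Proof.
move=> lf Uq cl fp; pose v := Kp (q, p).
have pm : maximizer K q v p by exact: (grad_maximizer ham).
apply/ler_addgt0Pr => e e0; pose e' := e / (1 + `|v|).
have v0 : 0 < 1 + `|v| by rewrite ltr_pwDl.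
have e'0 : 0 < e' by rewrite divr_gt0.
have cL : {for q, continuous (fun y => legendre K y v + l y)}.
  apply: continuousD => //; apply/continuous_ptP => e1 e10.
  exact: (near_pair1 (proj1 (continuous_ptP _ _) (legendre_continuous ham Uq) e1 e10)).
have nL : \forall y \near q, legendre K y v + l y < legendre K q v + l q + e'.
  by apply: (continuous_near_lt cL); rewrite ltrDl.
have [d d0 hd] := near_norm (filterI (ham_near ham Uq) nL).
have nseg : \forall h \near 0^'+, h * `|v| < d.
  near=> h; apply: (@le_lt_trans _ _ (h * (1 + `|v|))).
    by rewrite ler_wpM2l// lerDr.
  by rewrite -ltr_pdivlMr//; near: h; apply: nbhs_right_lt; rewrite divr_gt0.
have [h [[h1 h2] h0]] := filter_ex
  (filterI (filterI nseg (near_ray (- v) (fp e' e'0))) (nbhs_right_gt 0)).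
pose y := q + h *: - v.
have hseg t : 0 <= t <= h -> U (y + t *: v) /\
    legendre K (y + t *: v) v + l (y + t *: v) < legendre K q v + l q + e'.
  move=> /andP[t0 th]; apply: hd; rewrite /y.
  have -> : q + h *: - v + t *: v - q = (h - t) *: - v.
    by rewrite scalerBl !scalerN opprK addrAC (addrAC q) subrr add0r.
  rewrite normrZ normrN ger0_norm ?subr_ge0//; apply: le_lt_trans h1.
  by rewrite ler_wpM2r// gerBl.
have h3 : f q - f y <= h * (legendre K q v + l q + e').
  have {1}-> : q = y + h *: v by rewrite /y scalerN subrK.
  apply: (@local_sub_segment l) => //; first exact: ltW.
    by move=> t /hseg[].
  by move=> t /hseg[_ /ltW].
have E : q + h *: - v - q = - (h *: v) by rewrite addrAC subrr add0r scalerN.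
rewrite E pairingNr pairingZr normrN normrZ (gtr0_norm h0) in h2.
have h4 : h * (pairing p v) <= h * (legendre K q v + l q + e' + e' * `|v|).
  by rewrite [leRHS]mulrDr (mulrCA h e'); rewrite -/y in h2; lra.
rewrite ler_pM2l// (maximizer_legendre pm) in h4.
have -> : e = e' * (1 + `|v|) by rewrite mulfVK// gt_eqF.
by rewrite mulrDr mulr1; lra.
Unshelve. all: by end_near. Qed.

End sub.
End local_subsolutions.

Lemma near_right0 (R : realType) (P : R -> Prop) : (\forall t \near 0^'+, P t) ->
  exists2 d : R, 0 < d & forall t, 0 < t -> t < d -> P t.
Proof.
move=> /near_norm[d d0 hd]; exists d => // t t0 td; apply: hd => //.
by rewrite subr0 gtr0_norm.
Qed.

Lemma near_prodI (T : topologicalType) I (F : set_system I) (x : T)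
    (P : T -> Prop) (Q : I -> Prop) (S : T -> I -> Prop) :
  (\forall y \near x, P y) -> (\forall i \near F, Q i) ->
  (forall y i, P y -> Q i -> S y i) -> \forall y \near x & i \near F, S y i.
Proof. by move=> nP nQ PQ; exists (P, Q) => //= -[y i] [/= Py Qi]; exact: PQ. Qed.

Lemma compact_near_right (R : realType) (T : topologicalType) (A : set T)
    (P : T -> R -> Prop) : compact A ->
  (forall z, A z -> \forall y \near z & t \near 0^'+, P y t) ->
  exists2 d : R, 0 < d & forall t, 0 < t -> t < d -> forall z, A z -> P z t.
Proof.
move=> /compact_near_coveringP cA hA.
have [d d0 hd] := near_right0 (cA _ (0^'+) (fun t z => P z t) _ hA).
by exists d => // t t0 td z; exact: hd.
Qed.

(** * Doubling of variables along one Euler step *)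

Section doubling.
Context {R : realType} {n : nat}.
Local Notation V := 'rV[R]_n.

Section legendre_bounds.
Variables (U : set V) (K : V * V -> R) (Kq Kp : V * V -> V).
Hypothesis ham : is_hamiltonian U K Kq Kp.

(** Provides one step length for which [local_sub_segment] applies from every starting pair in A. *)
Lemma legendre_uniform (A : set (V * V)) (e : R) : compact A ->
  (forall z, A z -> U z.1) -> 0 < e ->
  exists2 d : R, 0 < d & forall t, 0 < t -> t < d -> forall z, A z ->
    U (z.1 + t *: z.2) /\
    legendre K (z.1 + t *: z.2) z.2 <= legendre K z.1 z.2 + e.
Proof.
move=> cA AU e0; apply: compact_near_right => // -[q v] /AU /= Uq.
have e20 : 0 < e / 2 by rewrite divr_gt0.
have h1 := proj1 (continuous_ptP _ _) (legendre_continuous ham Uq (v := v)) _ e20.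
have [d1 d10 hd1] := near_norm h1.
have [d2 d20 hd2] := near_norm (ham_near ham Uq).
pose d := Num.min d1 d2; have d0 : 0 < d by rewrite lt_min d10.
have v0 : 0 < 2 * (`|v| + d) by rewrite mulr_gt0// ltr_wpDl.
apply: (near_prodI (near_dist (q, v) (divr_gt0 d0 (ltr0n _ 2)))
  (filterI (nbhs_right_gt 0) (nbhs_right_lt (divr_gt0 d0 v0)))).
move=> -[q' v'] t yd [t0 td].
have yq := le_lt_trans (norm_pair_fst (q', v') (q, v)) yd.
have yv := le_lt_trans (norm_pair_snd (q', v') (q, v)) yd.
rewrite /= in yq yv *.
have nv' : `|v'| <= `|v| + d.
  by rewrite -[v'](subrK v) (le_trans (ler_normD _ _))// addrC lerD2l; lra.
have ray : `|q' + t *: v' - q| < d.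
  rewrite addrAC; apply: le_lt_trans (ler_normD _ _) _.
  rewrite normrZ gtr0_norm//.
  have : t * `|v'| <= d / 2.
    apply: (@le_trans _ _ (t * (`|v| + d))); first by rewrite ler_wpM2l// ltW.
    rewrite ltr_pdivlMr// in td; lra.
  lra.
split; first by apply: hd2; apply: lt_le_trans ray _; rewrite ge_min lexx orbT.
have dd1 : d <= d1 by rewrite ge_min lexx.
have a1 := hd1 (q' + t *: v', v'); have a2 := hd1 (q', v').
have : `|(q' + t *: v', v') - (q, v)| < d1.
  by rewrite prod_normE/= gt_max; apply/andP; split; lra.
move=> /a1; have : `|(q', v') - (q, v)| < d1 by lra.
move=> /a2; rewrite /= !ler_norml => /andP[? ?] /andP[? ?]; lra.
Qed.

Lemma ham_bound_above q0 P0 : U q0 -> exists C, \forall q \near q0,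
  forall p, `|p| <= P0 -> K (q, p) <= C.
Proof.
move=> Uq0.
have [P00|P00] := ltP P0 0.
  by exists 0; near=> q => p pP; have := le_lt_trans pP P00; rewrite ltNge normr_ge0.
have cK p : {for p, continuous (fun p' => K (q0, p'))}.
  apply/continuous_ptP => e e0.
  exact: (near_pair2 (proj1 (continuous_ptP _ _) (ham_continuous ham (Uq0 : U (q0, p).1)) e e0)).
have cB := @compact_ball_rV R n 0 P0.
have [||p0 _ p0max] := @compact_EVT_max _ _ (fun p => K (q0, p)) _ _ cB _.
- by exists (0 : V); rewrite /= subr0 normr0.
- by apply: continuous_in_subspaceT => p _; exact: cK.
exists (K (q0, p0) + 1).
have : \forall q \near q0, [set p | `|p - 0| <= P0] `<=` (fun p => K (q, p) <= K (q0, p0) + 1).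
  apply: (proj1 (compact_near_coveringP _) cB _ (nbhs q0) (fun q p => K (q, p) <= K (q0, p0) + 1)).
  move=> p pP.
  have h := proj1 (continuous_ptP _ _) (ham_continuous ham (Uq0 : U (q0, p).1)) 1 ltr01.
  have [d d0 hd] := near_norm h.
  apply: (near_prodI (near_dist p d0) (near_dist q0 d0)) => p' q' pd qd.
  have : `|(q', p') - (q0, p)| < d by rewrite prod_normE gt_max qd.
  move=> /hd; rewrite ler_norml => /andP[_]; have := p0max p (mem_set pP); lra.
by apply: filterS => q hq p pP; apply: hq; rewrite /= subr0.
Unshelve. all: by end_near. Qed.

Lemma legendre_superlinear q0 k : U q0 -> exists C, \forall q \near q0,
  forall v, k * `|v| - C <= legendre K q v.
Proof.
move=> Uq0; have [C hC] := ham_bound_above `|k| Uq0.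
exists C; near=> q => v.
have Uq : U q by near: q; exact: (ham_near ham).
have KC p : `|p| <= `|k| -> K (q, p) <= C by move: p; near: q.
have [v0|v0] := eqVneq v 0.
  have := fenchel ham v 0 Uq; have := KC 0; rewrite normr0 pairing0l => /(_ (normr_ge0 _)).
  by rewrite v0 normr0; lra.
have nv0 : mx_norm v != 0 by move: v0; rewrite -normr_eq0.
have [[i j] /= ij] := mx_norm_neq0 nv0.
rewrite (ord1 i) in ij.
(* p is dual to v for the maximum norm: it is carried by a coordinate j where |v| is attained, with
   the sign of v there. *)
pose p : V := (k * Num.sg (v ord0 j)) *: delta_mx 0 j.
have np : `|p| <= `|k|.
  apply: norm_rV_le => // l; rewrite !mxE eqxx/= normrM.
  have : `|k * Num.sg (v ord0 j)| <= `|k|.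
    by rewrite normrM ler_piMr// normr_sg; case: eqP.
  by case: eqP => _; rewrite ?normr1 ?normr0 ?mulr1 ?mulr0.
have pv : pairing p v = k * `|v|.
  rewrite pairingZl /pairing (bigD1 j)//= big1 => [|l lj]; last first.
    by rewrite mxE eqxx (negbTE lj) mul0r.
  rewrite mxE !eqxx mul1r addr0 -mulrA; congr (_ * _).
  by rewrite [RHS]ij normrEsg.
by have := fenchel ham v p Uq; have := KC p np; rewrite pv; lra.
Unshelve. all: by end_near. Qed.

End legendre_bounds.

Variables (U : set V) (KG KH : V * V -> R) (Gq Gp Hq Hp : V * V -> V).
Hypotheses (hamG : is_hamiltonian U KG Gq Gp) (hamH : is_hamiltonian U KH Hq Hp).
Hypothesis bracket0 : forall z : V * V, U z.1 ->
  pairing (Hp z) (Gq z) = pairing (Hq z) (Gp z).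

(* One step of the symplectic Euler scheme of G preserves H up to o(t). *)
Lemma symplectic_step (A : set (V * V)) (e : R) : compact A ->
  (forall z, A z -> U z.1) -> 0 < e ->
  exists2 d : R, 0 < d & forall t, 0 < t -> t < d -> forall z, A z ->
    forall w, `|w| <= 1 ->
    KH (z.1, z.2 + t *: (Gq z - w)) - KH (z.1 + t *: Gp z, z.2) <=
      t * (e - pairing (Hp z) w).
Proof.
move=> cA AU e0; apply: compact_near_right => // z0 /AU Uz0.
(* M bounds both components of the displacement per unit time near z0, the perturbation w
   included. *)
pose M := `|Gp z0| + `|Gq z0| + 3.
have M0 : 0 < M by rewrite ltr_wpDl// addr_ge0.
have e3 : 0 < e / 3 by rewrite divr_gt0.
have [d d0 sd] := ham_sdiff hamH Uz0 (divr_gt0 e3 M0).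
have n10 : 0 < n%:R + 1 :> R by rewrite ltr_wpDl.
have c1 := proj1 (continuous_ptP _ _) (ham_cp hamH Uz0) _ (divr_gt0 e3 n10).
have cX : {for z0, continuous (fun z => pairing (Hp z0) (Gq z) - pairing (Hq z0) (Gp z))}.
  apply: cvgB; apply: cvg_pairing; [exact: cvg_cst|exact: (ham_cq hamG Uz0)
    |exact: cvg_cst|exact: (ham_cp hamG Uz0)].
(* The linear part of the increment of H along the step is the Poisson bracket, which vanishes at z0
   and is therefore small nearby. *)
have c2 : \forall z \near z0, pairing (Hp z0) (Gq z) - pairing (Hq z0) (Gp z) < e / 3.
  by apply: (continuous_near_lt cX); rewrite bracket0// subrr.
have c3 := proj1 (continuous_ptP _ _) (ham_cp hamG Uz0) _ ltr01.
have c4 := proj1 (continuous_ptP _ _) (ham_cq hamG Uz0) _ ltr01.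
have c5 := near_dist z0 (divr_gt0 d0 (ltr0n _ 2)).
have c6 : \forall t \near 0^'+, t < d / 2 / M :> R.
  by apply: nbhs_right_lt; rewrite !divr_gt0.
apply: (near_prodI (filterI (filterI c1 c2) (filterI (filterI c3 c4) c5))
  (filterI (nbhs_right_gt 0) c6)).
move=> z t [[h1 h2] [[h3 h4] h5]] [t0 tM] w w1.
have tMd : t * M < d / 2 by rewrite -ltr_pdivlMr.
have nGp : `|Gp z| <= M.
  by have := ler_normD (Gp z - Gp z0) (Gp z0); rewrite subrK /M; have := normr_ge0 (Gq z0); lra.
have nGq : `|Gq z - w| <= M.
  have := ler_normD (Gq z - Gq z0) (Gq z0); rewrite subrK; have := ler_normB (Gq z) w.
  by rewrite /M; have := normr_ge0 (Gp z0); lra.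
have z1 := le_lt_trans (norm_pair_fst z z0) h5.
have z2 := le_lt_trans (norm_pair_snd z z0) h5.
have near1 (a b : V) : `|a| < d / 2 -> `|b| <= M -> `|a + t *: b| < d.
  move=> ad bM; apply: le_lt_trans (ler_normD _ _) _; rewrite normrZ gtr0_norm//.
  by have := ler_wpM2l (ltW t0) bM; lra.
have x1 : `|(z.1, z.2 + t *: (Gq z - w)) - z0| < d.
  rewrite prod_normE/= gt_max; apply/andP; split; first lra.
  by rewrite addrAC; exact: near1.
have x2 : `|(z.1 + t *: Gp z, z.2) - z0| < d.
  rewrite prod_normE/= gt_max; apply/andP; split; last lra.
  by rewrite addrAC; exact: near1.
have := sd _ _ x1 x2.
have -> : (z.1, z.2 + t *: (Gq z - w)) - (z.1 + t *: Gp z, z.2) = (- (t *: Gp z), t *: (Gq z - w)).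
  by apply: injective_projections => /=; rewrite ?opprD ?addrA ?subrr ?add0r// addrAC subrr add0r.
have -> : (z.1, z.2 + t *: (Gq z - w)).1 - (z.1 + t *: Gp z, z.2).1 = - (t *: Gp z).
  by rewrite /= opprD addrA subrr add0r.
have -> : (z.1, z.2 + t *: (Gq z - w)).2 - (z.1 + t *: Gp z, z.2).2 = t *: (Gq z - w).
  by rewrite /= addrAC subrr add0r.
have nn : `|(- (t *: Gp z), t *: (Gq z - w))| <= t * M.
  rewrite prod_normE/= normrN !normrZ (gtr0_norm t0) ge_max.
  by apply/andP; split; apply: ler_wpM2l => //; exact: ltW.
have eM : e / 3 / M * `|(- (t *: Gp z), t *: (Gq z - w))| <= t * (e / 3).
  apply: le_trans (ler_wpM2l _ nn) _; first by rewrite ltW// divr_gt0.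
  by rewrite mulrCA mulfVK// gt_eqF.
have nw : `|pairing (Hp z0 - Hp z) w| <= e / 3.
  apply: le_trans (pairing_bound _ _) _.
  have : `|Hp z0 - Hp z| * `|w| <= e / 3 / (n%:R + 1).
    rewrite -[leRHS]mulr1; apply: ler_pM => //; rewrite distrC; exact: h1.
  rewrite ler_pdivlMr// => h; apply: le_trans h.
  by rewrite mulrC ler_wpM2l ?mulr_ge0// lerDl.
move=> h; have := le_trans h eM; rewrite ler_norml => /andP[_].
rewrite pairingNr !pairingZr pairingBr => h6.
have h7 : t * (pairing (Hp z0) (Gq z) - pairing (Hq z0) (Gp z)) <= t * (e / 3).
  by rewrite ler_wpM2l// ltW.
have h8 : t * (pairing (Hp z) w - pairing (Hp z0) w) <= t * (e / 3).
  apply: (ler_wpM2l (ltW t0)); move: nw; rewrite pairingBl ler_norml => /andP[+ _]; lra.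
lra.
Qed.

(** Only the endpoint moves. Replacing v by b moves it by t (b - v) and raises t times the Legendre
    transform by at most t [pairing p (b - v)] to first order; the factors t cancel and the slope is
    p. *)
Lemma doubling_superdiff f y v p t : U y -> maximizer KG y v p -> 0 < t ->
  (\forall b \near v, f (y + t *: b) - t * legendre KG y b <=
     f (y + t *: v) - t * legendre KG y v) ->
  superdiff f (y + t *: v) p.
Proof.
move=> Uy pm t0 hmax e1 e10.
have [dd dd0 hdd] := near_norm (filterI (near_pair2 (danskin hamG Uy pm e10)) hmax).
apply: filterS (near_dist _ (mulr_gt0 t0 dd0)) => x' x'd.
pose b := v + t^-1 *: (x' - (y + t *: v)).
have bE : b - v = t^-1 *: (x' - (y + t *: v)) by rewrite /b addrAC subrr add0r.
have nb : `|b - v| = t^-1 * `|x' - (y + t *: v)| by rewrite bE normrZ gtr0_norm ?invr_gt0.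
have bd : `|b - v| < dd by rewrite nb mulrC ltr_pdivrMr// mulrC.
have [/= b1 b2] := hdd b bd.
have yb : y + t *: b = x'.
  by rewrite /b scalerDr scalerA divff ?gt_eqF// scale1r addrA subrKC.
have E : `|(y, b) - (y, v)| = t^-1 * `|x' - (y + t *: v)|.
  by rewrite prod_normE/= subrr normr0 -nb; apply/max_idPr.
move: b1; rewrite subrr pairing0r subr0 E bE pairingZr yb in b2 * => b1.
set P := pairing p _ in b1 *; set X := `|_ - (_ + _)| in b1 *.
have E2 : t * (t^-1 * P + e1 * (t^-1 * X)) = P + e1 * X by field; rewrite gt_eqF.
have {b1} := ler_wpM2l (ltW t0) b1; rewrite E2 mulrBr; move: b2.
lra.
Qed.

(** The starting point moves while the endpoint [y + t *: v] stays fixed, so v changes by -(y' - y)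
    / t. The Legendre transform contributes p through v and t [Gq] through y, the penalty the last
    term. With [doubling_superdiff], the two contact covectors are, up to the penalty, the momenta
    at both ends of a symplectic Euler step of G. *)
Lemma doubling_subdiff f y v p t k qb : U y -> maximizer KG y v p -> 0 < t -> 0 < k ->
  (\forall z \near (y, v), z.1 + t *: z.2 = y + t *: v ->
     - f z.1 - t * legendre KG z.1 z.2 - t * (k * pairing (z.1 - qb) (z.1 - qb)) <=
     - f y - t * legendre KG y v - t * (k * pairing (y - qb) (y - qb))) ->
  subdiff f y (p + t *: (Gq (y, p) - (2 * k) *: (y - qb))).
Proof.
move=> Uy pm t0 k0 hmax e1 e10.
have t10' : 0 < t + 1 by rewrite addr_gt0.
have e20 : 0 < e1 / 2 / (t + 1) by rewrite !divr_gt0.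
have [dd dd0 hdd] := near_norm (filterI (danskin hamG Uy pm e20) hmax).
have it0 : 0 < t^-1 by rewrite invr_gt0.
have s1 : 0 < 1 + t^-1 by rewrite addr_gt0.
have s2 : 0 < t * k * (n%:R + 1) by rewrite !mulr_gt0// ltr_wpDl.
apply: filterS2 (near_dist y (divr_gt0 dd0 s1))
  (near_dist y (divr_gt0 (divr_gt0 e10 (ltr0n _ 2)) s2)).
move=> y' ydd ye; set xi := y' - y in ydd ye *.
pose v' := v - t^-1 *: xi.
have y'E : y' = y + xi by rewrite /xi subrKC.
have v'E : v' - v = - (t^-1 *: xi) by rewrite /v' addrAC subrr add0r.
have nv' : `|v' - v| = t^-1 * `|xi| by rewrite v'E normrN normrZ gtr0_norm.
have nyv : `|(y', v') - (y, v)| <= (1 + t^-1) * `|xi|.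
  rewrite prod_normE/= nv' -/xi mulrDl mul1r ge_max lerDl lerDr.
  by rewrite normr_ge0 mulr_ge0// ltW.
have /hdd/= [dan mx] : `|(y', v') - (y, v)| < dd.
  by apply: le_lt_trans nyv _; rewrite mulrC -ltr_pdivlMr.
have ytv : y' + t *: v' = y + t *: v.
  rewrite y'E /v' scalerBr scalerA divff ?gt_eqF// scale1r.
  by rewrite addrACA subrr addr0.
move: mx => /(_ ytv).
have -> : pairing (y' - qb) (y' - qb) =
    pairing (y - qb) (y - qb) + 2 * pairing (y - qb) xi + pairing xi xi.
  have -> : y' - qb = (y - qb) + xi by rewrite y'E addrAC.
  move: (y - qb) => z; rewrite pairingDl 2!pairingDr (pairingC xi z); lra.
move: dan; rewrite v'E -/xi pairingNr pairingZr => dan.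
have {dan} dan2 := ler_wpM2l (ltW t0) dan.
have E2 a1 a2 a3 : t * (- (t^-1 * a1) - a2 + a3) = - a1 - t * a2 + t * a3.
  by field; rewrite gt_eqF.
rewrite E2 mulrBr in dan2.
have l1 : t * (e1 / 2 / (t + 1) * `|(y', v') - (y, v)|) <= e1 / 2 * `|xi|.
  apply: (@le_trans _ _ (t * (e1 / 2 / (t + 1) * ((1 + t^-1) * `|xi|)))).
    by apply: (ler_wpM2l (ltW t0)); apply: (ler_wpM2l (ltW e20)).
  rewrite le_eqVlt; apply/orP; left; apply/eqP.
  by field; rewrite !gt_eqF.
have l2 : t * (k * pairing xi xi) <= e1 / 2 * `|xi|.
  have h : pairing xi xi <= (n%:R + 1) * (`|xi| * `|xi|).
    apply: le_trans (pairing_le _ _) _; rewrite mulrDl mul1r lerDl; exact: mulr_ge0.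
  apply: (@le_trans _ _ (t * (k * ((n%:R + 1) * (`|xi| * `|xi|))))).
    by apply: (ler_wpM2l (ltW t0)); apply: (ler_wpM2l (ltW k0)).
  rewrite !mulrA; apply: ler_wpM2r => //; rewrite mulrC -ler_pdivlMr//; exact: ltW.
rewrite [pairing (p + _) xi]pairingDl [pairing (t *: _) xi]pairingZl
  [pairing (Gq _ - _) xi]pairingBl [pairing ((2 * k) *: _) xi]pairingZl.
move: l1 l2 dan2; lra.
Qed.

End doubling.

(* Doubling of variables against the cost of one Euler step of G, localized by
   a quadratic penalty of size [d]: the first variable is [y], the second one
   [y + t *: v]. *)
Lemma doubling_local (R : realType) (n : nat) (U : set 'rV[R]_n)
    (KG KH : 'rV[R]_n * 'rV[R]_n -> R) (Gq Gp Hq Hp : 'rV[R]_n * 'rV[R]_n -> 'rV[R]_n)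
    (hamG : is_hamiltonian U KG Gq Gp) (hamH : is_hamiltonian U KH Hq Hp)
    (bracket0 : forall z : 'rV[R]_n * 'rV[R]_n, U z.1 ->
       pairing (Hp z) (Gq z) = pairing (Hq z) (Gp z))
    (lam a m : R) (f w : 'rV[R]_n -> R) (q0 : 'rV[R]_n) :
  0 < lam -> a < m -> U q0 ->
  local_sub U KH (fun q => - (lam * (f q - w q))) f ->
  (forall q p, U q -> subdiff f q p -> - (lam * (f q - w q)) <= KH (q, p)) ->
  local_sub U KG (fun=> a) w -> local_sub U KG (fun=> m) f ->
  exists d r, [/\ 0 < d, 0 < r & forall q, `|q - q0| < r ->
    forall v, dini f q v (legendre KG q v + (m - d))].
Proof.
move=> lam0 am Uq0 subH superH subw subf.
have [Lam [r1 [Lam0 r10 r1U lipf]]] := local_sub_lipschitz hamG m Uq0.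
have {}lipf := lipf _ _ subf (fun q _ => lexx m).
have [C1 hC1] := legendre_superlinear hamG (Lam + 1) Uq0.
(* A step along which f grows faster than allowed has speed below Vm, since the slope Lam + 1 of the
   Legendre transform beats the Lipschitz constant Lam. The maximum taken below is thus interior in
   v. *)
pose Vm := `|C1| + `|m| + 2.
have Vm0 : 0 < Vm by rewrite ltr_wpDl// addr_ge0.
have [B hB] := maximizer_bound hamG Vm Uq0.
have [r2 r20 h2] := near_norm (filterI hC1 hB).
pose r := Num.min r1 r2 / 4.
have r0 : 0 < r by rewrite divr_gt0// lt_min r10.
have rr1 : 4 * r <= r1 by rewrite /r mulrC divfK// ge_min lexx.
have rr2 : 4 * r <= r2 by rewrite /r mulrC divfK// ge_min lexx orbT.
have in_r2 y : `|y - q0| <= 2 * r -> `|y - q0| < r2 by lra.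
pose box (b : R) : set ('rV[R]_n * 'rV[R]_n) := [set x | `|x - q0| <= 2 * r] `*` [set x | `|x - 0| <= b].
have cbox b : compact (box b) by apply: compact_setX; exact: compact_ball_rV.
have boxU b (z : 'rV[R]_n * 'rV[R]_n) : box b z -> U z.1 by move=> [/= zr _]; apply: r1U; lra.
have [C2 C20 hC2] : exists2 C2, 0 <= C2 & forall z, box `|B| z -> `|Hp z| <= C2.
  have [||z0 _ z0max] := @compact_EVT_max _ _ (fun z => `|Hp z|) _ _ (cbox `|B|) _.
  - by exists (q0, 0); split; rewrite /= subrr normr0// mulr_ge0// ltW.
  - apply: continuous_in_subspaceT => z /set_mem/boxU Uz; apply: cvg_norm.
    exact: (ham_cp hamH Uz).
  by exists `|Hp z0| => // z /mem_set/z0max.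
(* D collects the coefficients of d in the final comparison: the effect of the penalty on H, the
   error of the Euler step, and lam times the two errors d made in the growth of f and of w. The
   choice of d makes d D at most lam (m - a), which is the contradiction sought. *)
pose D := n%:R * C2 * (4 / r) + 1 + 2 * lam.
have D0 : 0 < D.
  have : 0 <= n%:R * C2 * (4 / r) by rewrite !mulr_ge0// invr_ge0 ltW.
  by rewrite /D; lra.
pose d := Num.min 1 (Num.min (r / 4) (lam * (m - a) / D)).
have d0 : 0 < d.
  by rewrite !lt_min ltr01 divr_gt0//= divr_gt0// mulr_gt0// subr_gt0.
have d1 : d <= 1 by rewrite ge_min lexx.
have dr : d <= r / 4 by rewrite !ge_min lexx orbT.
have r4 : 4 / r * d <= 1.
  by rewrite mulrAC ler_pdivrMr// mul1r; lra.
have dD : d * D <= lam * (m - a) by rewrite -ler_pdivlMr// !ge_min lexx !orbT.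
have [t1 t10 ht1] := legendre_uniform hamG (cbox Vm) (@boxU Vm) d0.
have [t2 t20 ht2] := symplectic_step hamG hamH bracket0 (cbox `|B|) (@boxU `|B|) d0.
exists d, r; split => // qb qbr vb e e0.
have n1 : \forall h \near 0^'+, h * (`|vb| + Vm) < r :> R.
  near=> h; rewrite -ltr_pdivlMr ?ltr_wpDl//; near: h.
  by apply: nbhs_right_lt; rewrite divr_gt0// ltr_wpDl.
apply: filterS3 (filterI n1 (nbhs_right_gt 0)) (nbhs_right_lt t10) (nbhs_right_lt t20).
move=> t [tV t0] tt1 tt2.
apply: (@le_trans _ _ (t * (legendre KG qb vb + (m - d)))); last first.
  by apply: (ler_wpM2l (ltW t0)); rewrite lerDl ltW.
rewrite leNgt; apply/negP => contra.
have trav y v : `|v| <= `|vb| + Vm -> `|y - q0| <= 2 * r -> `|y + t *: v - q0| < 3 * r.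
  move=> vV yr; rewrite addrAC; apply: le_lt_trans (ler_normD _ _) _.
  rewrite normrZ gtr0_norm//; have := ler_wpM2l (ltW t0) vV; move: yr tV; clear; lra.
have bv y v : `|v| <= `|vb| + Vm -> `|y - q0| <= 2 * r ->
    t * (legendre KG y v + (m - d)) < f (y + t *: v) - f y -> `|v| < Vm.
  move=> vV yr h; have xr := trav _ _ vV yr.
  have yr2 := in_r2 _ yr.
  have [/(_ v) l1 _] := h2 y yr2.
  have l2 : f (y + t *: v) - f y <= Lam * (t * `|v|).
    have E : y + t *: v - y = t *: v by rewrite addrAC subrr add0r.
    by have := lipf y (y + t *: v); rewrite E normrZ (gtr0_norm t0); apply; move: xr yr rr1 r0; clear; lra.
  have : t * (legendre KG y v + (m - d)) < t * (Lam * `|v|) by rewrite mulrCA; exact: lt_le_trans h l2.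
  rewrite ltr_pM2l//; rewrite mulrDl mul1r in l1.
  by rewrite /Vm; have := ler_norm C1; have := ler_norm (- m); rewrite normrN; move: l1 d1; clear; lra.
have vbV : `|vb| <= `|vb| + Vm by rewrite lerDl ltW.
have qbr2 : `|qb - q0| <= 2 * r by move: qbr r0; clear; lra.
have vbVm : `|vb| < Vm by exact: (bv qb).
(* Positivity of the maximum leaves a penalty below 2 d, and with this strength that forces
   [|y - qb| < r]. The penalty then perturbs the momentum by at most 4 d / r per unit time. *)
pose k := 2 * d / r ^+ 2.
have k0 : 0 < k by rewrite divr_gt0 ?exprn_gt0// mulr_gt0.
pose sq (x : 'rV[R]_n) := pairing x x.
have sq0 x : 0 <= sq x by rewrite (le_trans _ (pairing_sqr_ge x))// sqr_ge0.
pose Phi (z : 'rV[R]_n * 'rV[R]_n) : R := f (z.1 + t *: z.2) - f z.1 - t * legendre KG z.1 z.2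
  - t * (m - d) - t * (k * sq (z.1 - qb)).
have inU z : box Vm z -> U (z.1 + t *: z.2).
  move=> [/= z1 z2]; apply: r1U; have := trav _ z.2 _ z1; rewrite subr0 in z2.
  have : `|z.2| <= `|vb| + Vm by rewrite (le_trans z2)// lerDr.
  move=> h1 /(_ h1); move: rr1 r0; clear; lra.
have cPhi (z : 'rV[R]_n * 'rV[R]_n) : box Vm z -> {for z, continuous Phi}.
  move=> zb; have Uz := boxU _ _ zb.
  have c1 : z'.1 @[z' --> z] --> z.1 by exact: cvg_fst.
  have c2 : z'.2 @[z' --> z] --> z.2 by exact: cvg_snd.
  apply: cvgB; first apply: cvgB; first apply: cvgB; first apply: cvgB.
  - apply: (cvg_comp (fun z' : 'rV[R]_n * 'rV[R]_n => z'.1 + t *: z'.2) f); last exact: (subf.1 _ (inU _ zb)).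
    exact: cvgD c1 (cvgZr c2).
  - exact: cvg_comp c1 (subf.1 _ Uz).
  - by apply: cvgMr; case: z Uz {zb c1 c2} => z1 z2 Uz; exact: (legendre_continuous hamG Uz).
  - exact: cvg_cst.
  - have c3 : z'.1 - qb @[z' --> z] --> z.1 - qb by apply: cvgB c1 (cvg_cst qb).
    exact: cvgMr (cvgMr (cvg_pairing c3 c3)).
have boxb : box Vm (qb, vb) by split => //=; rewrite subr0 ltW.
have [||[y v] yvb Phimax] := @compact_EVT_max _ _ Phi _ _ (cbox Vm) _.
- by exists (qb, vb).
- by apply: continuous_in_subspaceT => z /set_mem; exact: cPhi.
have {}yvb : box Vm (y, v) by exact: set_mem yvb.
have [/= yr vV] := yvb; rewrite subr0 in vV.
have Uy : U y by exact: (boxU _ _ yvb).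
have Ux : U (y + t *: v) by exact: (inU _ yvb).
have PhiV : 0 < Phi (y, v).
  apply: (@lt_le_trans _ _ (Phi (qb, vb))); last exact: (Phimax _ (mem_set boxb)).
  rewrite /Phi/= /sq subrr pairing0l !mulr0 subr0; rewrite mulrDr in contra; move: contra; clear; lra.
pose S := k * sq (y - qb).
have S0 : 0 <= S by rewrite mulr_ge0// ltW.
have gap : t * (legendre KG y v + (m - d)) < f (y + t *: v) - f y.
  by move: PhiV; rewrite /Phi/= -/S mulrDr; have := mulr_ge0 (ltW t0) S0; clear; lra.
have vVm : `|v| < Vm by apply: (bv y) => //; rewrite (le_trans vV)// lerDr.
have step g c : local_sub U KG (fun=> c) g -> g (y + t *: v) - g y <= t * (legendre KG y v + d + c).
  move=> subg; apply: (local_sub_segment subg); first exact: ltW.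
    move=> s /andP[s0 st]; case: (ltgtP s 0) s0 => // [s0 _|-> _]; last by rewrite scale0r addr0.
    by have [] := ht1 s s0 (le_lt_trans st tt1) _ yvb.
  move=> s /andP[s0 st]; rewrite lerD2r; case: (ltgtP s 0) s0 => // [s0 _|-> _].
    by have [] := ht1 s s0 (le_lt_trans st tt1) _ yvb.
  by rewrite scale0r addr0 lerDl ltW.
have Sd : S < 2 * d.
  have := step _ _ subf; move: PhiV; rewrite /Phi/= -/S => h1 h3.
  by rewrite -(ltr_pM2l t0); move: h1 h3; rewrite !mulrDr; clear; lra.
have yqb : `|y - qb| < r.
  rewrite -ltr_sqr ?nnegrE ?(ltW r0)//.
  apply: le_lt_trans (pairing_sqr_ge _) _.
  move: Sd; rewrite /S /k mulrAC ltr_pdivrMr ?exprn_gt0// ltr_pM2l// mulr_gt0//.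
have yr' : `|y - q0| < 2 * r.
  by rewrite -(subrKA qb); apply: le_lt_trans (ler_normD _ _) _; move: yqb qbr; clear; lra.
have [p pm] := maximizer_exists hamG v Uy.
have vE := maximizer_grad hamG Uy pm.
have yr2 := in_r2 _ yr.
have pB : `|p| <= `|B|.
  by have [_ /(_ v p vV pm) h] := h2 y yr2; rewrite (le_trans h)// ler_norm.
have near_max : \forall z \near (y, v), Phi z <= Phi (y, v).
  have rr0 : 0 < 2 * r - `|y - q0| by rewrite subr_gt0.
  have Vv0 : 0 < Vm - `|v| by rewrite subr_gt0.
  apply: filterS2 (near_fst v (near_dist y rr0)) (near_snd y (near_dist v Vv0)) => -[y' v'] /= yr1 vr1.
  apply/Phimax/mem_set; split => /=.
    by rewrite -(subrKA y) (le_trans (ler_normD _ _))// -lerBrDr ltW.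
  by rewrite subr0 -[v'](subrK v) (le_trans (ler_normD _ _))// -lerBrDr ltW.
pose wv := (2 * k) *: (y - qb).
have px : superdiff f (y + t *: v) p.
  apply: (doubling_superdiff hamG Uy pm t0).
  by apply: filterS (near_pair2 near_max) => b; rewrite /Phi/= !lerD2r addrAC [leRHS]addrAC lerD2r.
have py : subdiff f y (p + t *: (Gq (y, p) - wv)).
  apply: (doubling_subdiff hamG Uy pm t0 k0).
  apply: filterS near_max => z + zE; rewrite /Phi/= zE -/(sq _).
  by rewrite -[pairing (y - qb) _]/(sq (y - qb)); clear; lra.
(* H is at most its discounted level at the endpoint, where f is a subsolution, and at least that
   level at the starting point, where f is a supersolution. *)
have lx := local_sub_superdiff hamH subH Ux _ px.
have ly := superH _ _ Uy py.
have cl : {for y + t *: v, continuous (fun q => - (lam * (f q - w q)))}.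
  exact: (continuous_discount (subf.1 _ Ux) (subw.1 _ Ux)).
have {}lx := lx cl.
have nwv : `|wv| <= 4 / r * d.
  have k20 : 0 < 2 * k by rewrite mulr_gt0.
  rewrite normrZ (gtr0_norm k20).
  apply: (@le_trans _ _ (2 * k * r)); first by apply: (ler_wpM2l (ltW k20)); exact: ltW.
  by rewrite le_eqVlt; apply/orP; left; apply/eqP; rewrite /k; field; rewrite gt_eqF.
have zb : box `|B| (y, p) by split => //=; rewrite subr0.
have := ht2 t t0 tt2 _ zb wv (le_trans nwv r4); rewrite /= -vE => st.
have pw : - pairing (Hp (y, p)) wv <= n%:R * C2 * (4 / r) * d.
  rewrite -pairingNr; apply: le_trans (pairing_le _ _) _.
  rewrite normrN -!mulrA ler_wpM2l//; apply: ler_pM => //; first exact: hC2.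
  by rewrite mulrA.
have l1 := step _ _ subw.
(* Beyond the Lagrangian cost, w grows at rate at most about a and f at rate nearly m. So f - w
   increases by about t (m - a), and the discounted equation turns this into a variation of H too
   large for [symplectic_step]. *)
have l2 : lam * (t * (m - a - 2 * d)) < lam * ((f (y + t *: v) - f y) - (w (y + t *: v) - w y)).
  by rewrite ltr_pM2l//; move: l1 gap; rewrite !mulrDr !mulrN; clear; lra.
have l3 : lam * ((f (y + t *: v) - f y) - (w (y + t *: v) - w y)) <= t * (d - pairing (Hp (y, p)) wv).
  by apply: le_trans st; move: lx ly; clear; lra.
have l4 : t * (d - pairing (Hp (y, p)) wv) <= t * (d + n%:R * C2 * (4 / r) * d).
  by apply: (ler_wpM2l (ltW t0)); rewrite lerD2l.
have := lt_le_trans l2 (le_trans l3 l4).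
rewrite mulrCA ltr_pM2l//; move: dD; rewrite /D; clear; lra.
Unshelve. all: by end_near. Qed.

(** * Tonelli Hamiltonians in the charts of the manifold *)

Section calculus.
Context {R : realType}.

Lemma line_quotient (W W' : normedModType R) (f : W -> W') (P D : W) (t : R) :
  (fun h : R => h^-1 *: (((fun s : R => f (P + s *: D)) \o shift t) (h *: 1) -
     f (P + t *: D))) =
  (fun h : R => h^-1 *: ((f \o shift (P + t *: D)) (h *: D) - f (P + t *: D))).
Proof.
apply/funext => h /=.
by rewrite -[h *: 1]/(h * 1) mulr1 scalerDl addrCA.
Qed.

Lemma derive_line (W W' : normedModType R) (f : W -> W') (P D : W) (t : R) :
  'D_1 (fun s : R => f (P + s *: D)) t = 'D_D f (P + t *: D).
Proof. by rewrite /derive line_quotient. Qed.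

Lemma derivable_line (W W' : normedModType R) (f : W -> W') (P D : W) (t : R) :
  derivable (fun s : R => f (P + s *: D)) t 1 = derivable f (P + t *: D) D.
Proof. by rewrite /derivable line_quotient. Qed.

(** Where the difference quotients diverge, ['D_v f x] takes the default value 0, so positivity
    carries existence. This is how the last clause of [tonelli] yields a genuine second derivative
    along fibers. *)
Lemma derive_gt0_derivable (W : normedModType R) (f : W -> R) x v :
  0 < 'D_v f x -> derivable f x v.
Proof.
move=> h; case: (pselect (derivable f x v)) => // nd.
by move: h; rewrite /derive (dvgP nd) ltxx.
Qed.

Lemma segment_mean_value (W : normedModType R) (f : W -> R) (y x : W) :
  (forall t : R, 0 <= t <= 1 -> derivable f (y + t *: (x - y)) (x - y)) ->
  exists2 t : R, 0 < t < 1 & f x - f y = 'D_(x - y) f (y + t *: (x - y)).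
Proof.
move=> df; set g := fun t : R => f (y + t *: (x - y)).
have dg (t : R) : 0 <= t <= 1 -> derivable g t 1 by move=> t01; rewrite derivable_line; exact: df.
have [||t] := @MVT R g (fun t => 'D_(x - y) f (y + t *: (x - y))) 0 1 ltr01.
- move=> t; rewrite in_itv/= => /andP[t0 t1]; rewrite -derive_line; apply: derivableP.
  by apply: dg; rewrite !ltW.
- apply: derivable_within_continuous => t; rewrite in_itv/=; exact: dg.
rewrite in_itv/= => t01; rewrite /g scale1r scale0r addr0 subr0 mulr1 [y + (x - y)]addrC subrK => e.
by exists t.
Qed.

End calculus.

Section gradients.
Context {R : realType} {n : nat}.
Local Notation V := 'rV[R]_n.
Local Notation e_ := (delta_mx (0 : 'I_1)).

Definition gradient (f : V -> R) q : V := \row_k 'D_(e_ k) f q.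
Definition gradq (K : V * V -> R) z : V := \row_k 'D_(e_ k, 0) K z.
Definition gradp (K : V * V -> R) z : V := \row_k 'D_(0, e_ k) K z.

Lemma derive_gradient (f : V -> R) q v : differentiable f q ->
  'D_v f q = pairing (gradient f q) v.
Proof.
move=> df; rewrite deriveE // {1}(row_sum_delta v) linear_sum /pairing.
by apply: eq_bigr => k _; rewrite mxE deriveE // linearZ /= -[_ *: _]/(_ * _) mulrC.
Qed.

Lemma derive_gradqp (K : V * V -> R) z h : differentiable K z ->
  'D_h K z = pairing (gradq K z) h.1 + pairing (gradp K z) h.2.
Proof.
move=> df; have -> : h = (h.1, 0) + (0, h.2).
  by case: h => a b /=; congr pair; rewrite ?addr0 ?add0r.
rewrite deriveE // linearD /= addr0 add0r /pairing; congr (_ + _).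
  have -> : (h.1, 0 : V) = \sum_k h.1 0 k *: (e_ k : V, 0 : V).
    rewrite {1}(row_sum_delta h.1); elim/big_rec2: _ => // k a b _ <-.
    by congr pair; rewrite /= ?scaler0 ?addr0.
  rewrite linear_sum; apply: eq_bigr => k _.
  by rewrite mxE deriveE // linearZ /= -[_ *: _]/(_ * _) mulrC.
have -> : (0 : V, h.2) = \sum_k h.2 0 k *: (0 : V, e_ k : V).
  rewrite {1}(row_sum_delta h.2); elim/big_rec2: _ => // k a b _ <-.
  by congr pair; rewrite /= ?scaler0 ?addr0.
rewrite linear_sum; apply: eq_bigr => k _.
by rewrite mxE deriveE // linearZ /= -[_ *: _]/(_ * _) mulrC.
Qed.

Lemma continuous_row (T : topologicalType) (f : 'I_n -> T -> R) (x : T) :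
  (forall k, {for x, continuous (f k)}) ->
  {for x, continuous (fun y => \row_k f k y : V)}.
Proof.
move=> cf; apply/cvgrPdist_le => e e0.
have : \forall y \near x, forall k, `|f k x - f k y| <= e.
  by apply: filter_forall => k; move/cvgrPdist_le: (cf k) => h; exact: h.
apply: filterS => y h; apply: norm_rV_le (ltW e0) _ => k.
by rewrite !mxE; exact: h.
Qed.

Lemma differentiable_row (W : normedModType R) (f : 'I_n -> W -> R) (x : W) :
  (forall k, differentiable (f k) x) ->
  differentiable (fun y => \row_k f k y : V) x.
Proof.
move=> cf; have -> : (fun y => \row_k f k y : V) = \sum_k (fun y => f k y *: (e_ k : V)).
  apply/funext => y; rewrite fct_sumE [LHS]row_sum_delta.
  by apply: eq_bigr => k _; rewrite mxE.
by apply: differentiable_sum => k; exact: differentiableZl.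
Qed.

(** Mean value theorem on the segment from y to x, on which the gradients are close to those at
    z. *)
Lemma strict_differentiable (U : set V) (K : V * V -> R) (Kq Kp : V * V -> V) (z : V * V) :
  open U -> U z.1 ->
  (forall y : V * V, U y.1 -> forall h, derivable K y h /\
     'D_h K y = pairing (Kq y) h.1 + pairing (Kp y) h.2) ->
  {for z, continuous Kq} -> {for z, continuous Kp} ->
  forall e, 0 < e -> exists2 d, 0 < d &
    forall x y : V * V, `|x - z| < d -> `|y - z| < d ->
      `|K x - K y - pairing (Kq z) (x.1 - y.1) - pairing (Kp z) (x.2 - y.2)|
      <= e * `|x - y|.
Proof.
move=> oU Uz dK cq cp e e0.
have n0 : 0 < (2 * (n%:R + 1) : R) by rewrite mulr_gt0 // ltr_wpDl.
have [d d0 dP] : exists2 d : R, 0 < d & forall y : V * V, `|y - z| < d ->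
    [/\ U y.1, `|Kq y - Kq z| <= e / (2 * (n%:R + 1)) & `|Kp y - Kp z| <= e / (2 * (n%:R + 1))].
  apply: near_norm; case: z Uz cq cp => q p /= Uz cq cp.
  have := near_fst p (open_nbhs_nbhs (conj oU Uz)).
  have /continuous_ptP /(_ _ (divr_gt0 e0 n0)) := cq.
  have /continuous_ptP /(_ _ (divr_gt0 e0 n0)) := cp.
  by apply: filterS3 => y a b c; split.
exists d => // x y xd yd.
have seg (t : R) : 0 <= t <= 1 -> `|y + t *: (x - y) - z| < d.
  move=> /andP[t0 t1].
  have -> : y + t *: (x - y) - z = (1 - t) *: (y - z) + t *: (x - z).
    have -> : x - z = (x - y) + (y - z) by rewrite addrA subrK.
    by rewrite [t *: (_ + (y - z))]scalerDr addrCA -scalerDl subrK scale1r [RHS]addrA [_ + y]addrC.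
  apply: le_lt_trans (ler_normD _ _) _; rewrite !normrZ (ger0_norm t0) ger0_norm ?subr_ge0 //.
  have [t00|t0'] := eqVneq t 0; first by rewrite t00 mul0r addr0 subr0 mul1r.
  have tp : 0 < t by rewrite lt_def t0'.
  have : t * `|x - z| < t * d by rewrite ltr_pM2l.
  have : (1 - t) * `|y - z| <= (1 - t) * d by rewrite ler_wpM2l ?subr_ge0 // ltW.
  by move=> h1 h2; lra.
have [t t01 ->] := segment_mean_value (fun t t01 => (dK _ (let: And3 h _ _ := dP _ (seg t t01) in h) _).1).
have t01' : 0 <= t <= 1 by case/andP: t01 => *; rewrite !ltW.
have [Uw hq hp] := dP _ (seg t t01'); set w := y + _ in Uw hq hp *.
rewrite (dK w Uw _).2 -addrA -opprD addrC opprD.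
rewrite [X in `|X|](_ : _ = pairing (Kq w - Kq z) (x.1 - y.1) + pairing (Kp w - Kp z) (x.2 - y.2)); last first.
  by rewrite !pairingBl; lra.
apply: le_trans (ler_normD _ _) _.
have c1 := norm_pair_fst x y; have c2 := norm_pair_snd x y.
have b (a v : V) : `|a| <= e / (2 * (n%:R + 1)) -> `|v| <= `|x - y| ->
    `|pairing a v| <= e / 2 * `|x - y|.
  move=> ae vl; apply: le_trans (pairing_bound _ _) _.
  apply: le_trans (_ : (n%:R + 1) * ((e / (2 * (n%:R + 1))) * `|x - y|) <= _).
    by apply: ler_pM; rewrite ?mulr_ge0 ?lerDl // ler_pM.
  have -> // : (n%:R + 1) * ((e / (2 * (n%:R + 1))) * `|x - y|) = e / 2 * `|x - y|.
  by field; rewrite gt_eqF // ltr_wpDl.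
by have := b _ _ hq c1; have := b _ _ hp c2; lra.
Qed.

End gradients.

Section curves.
Context {R : realType} {n : nat}.
Local Notation V := 'rV[R]_n.

(** Under a local Lipschitz bound a Dini estimate sees only the tangent vector of a curve. It is
    what allows a change of chart, since a segment of one chart is merely a curve in another. *)
Lemma dini_curve (U : V -> R) (c : R -> V) q v (C b : R) :
  (\forall x \near q & y \near q, U y - U x <= C * `|y - x|) ->
  c 0 = q -> (forall e, 0 < e -> \forall h \near 0^'+, `|c h - q - h *: v| <= h * e) ->
  dini U q v b -> forall e, 0 < e -> \forall h \near 0^'+, U (c h) - U q <= h * (b + e).
Proof.
move=> UL c0 cv Ub e e0.
have C0 : 0 < `|C| + 1 by rewrite ltr_wpDl.
have e2 : 0 < e / 2 by rewrite divr_gt0.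
have e3 : 0 < e / 2 / (`|C| + 1) by rewrite divr_gt0.
have [d d0 dU] : exists2 d : R, 0 < d & forall x y : V, `|x - q| < d -> `|y - q| < d ->
    U y - U x <= C * `|y - x|.
  case: UL => -[P Q] [/= /near_norm[d1 d10 h1] /near_norm[d2 d20 h2]] PQ.
  exists (Num.min d1 d2) => [|x y]; rewrite ?lt_min ?d10 // => /andP[x1 _] /andP[_ y2].
  by apply: (PQ (x, y)); split => /=; [exact: h1|exact: h2].
have d2 : 0 < d / 2 by rewrite divr_gt0.
have s1 : \forall h \near (0 : R)^'+, `|q + h *: v - q| < d / 2.
  by apply: (@near_ray _ _ q v (fun y => `|y - q| < d / 2)); exact: near_dist.
have s2 : \forall h \near (0 : R)^'+, 0 < h < d / 2.
  by apply: filterS2 (nbhs_right_gt 0) (nbhs_right_lt d2) => h -> ->.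
have s3 := cv _ ltr01; have s4 := cv _ e3; have s5 := Ub _ e2.
apply: filterS3 (filterI s1 s2) (filterI s3 s4) s5 => h [b1 /andP[h0 b2]] [b6 b5] b4.
have cq : `|c h - q| < d.
  have -> : c h - q = (c h - q - h *: v) + (q + h *: v - q) by rewrite [q + _]addrC addrK subrK.
  by apply: le_lt_trans (ler_normD _ _) _; lra.
have b7 : `|q + h *: v - q| < d by lra.
have := dU _ _ b7 cq.
rewrite [c h - _](_ : _ = c h - q - h *: v); last by rewrite opprD addrA.
have : C * `|c h - q - h *: v| <= (`|C| + 1) * (h * (e / 2 / (`|C| + 1))).
  by apply: le_trans (ler_wpM2r (normr_ge0 _) (_ : C <= `|C| + 1)) _; rewrite ?ler_pM2l // ler_wpDr // ler_norm.
have -> : (`|C| + 1) * (h * (e / 2 / (`|C| + 1))) = h * (e / 2) by field; rewrite gt_eqF.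
by move=> *; lra.
Qed.

Lemma differentiable_curve (W W' : normedModType R) (f : W -> W') (q v : W) :
  differentiable f q -> forall e, 0 < e ->
  \forall h \near (0 : R)^'+, `|f (q + h *: v) - f q - h *: 'D_v f q| <= h * e.
Proof.
move=> df e e0.
have dv := diff_derivable (v := v) df.
have : \forall h \near (0:R)^', `|h^-1 *: (f (h *: v + q) - f q) - 'D_v f q| <= e.
  by have /cvgrPdist_le/(_ e e0) := dv; apply: filterS => h; rewrite distrC.
move=> h'; have h0 : \forall h \near (0 : R)^'+, 0 < h by exact: nbhs_right_gt.
have hr : (0 : R)^'+ `=>` (0 : R)^'.
  by move=> P; rewrite /at_right /dnbhs /within /=; apply: filterS => y hy y0; apply: hy; rewrite gt_eqF.
apply: filterS2 h0 (hr _ h') => h h0 hh.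
rewrite [q + _]addrC.
have -> : f (h *: v + q) - f q - h *: 'D_v f q =
    h *: (h^-1 *: (f (h *: v + q) - f q) - 'D_v f q).
  by rewrite scalerBr scalerA divff ?gt_eqF // scale1r.
by rewrite normrZ gtr0_norm // ler_wpM2l // ltW.
Qed.

Lemma diffEjacobian (f : V -> V) (q v : V) : differentiable f q -> 'd f q v = v *m 'J f q.
Proof. by move=> df; rewrite -deriveE // deriveEjacobian. Qed.

Lemma jacobian_unique (f : V -> V) (q : V) (B : 'M[R]_n) : differentiable f q ->
  (forall v, 'd f q v = v *m B) -> 'J f q = B.
Proof.
move=> df h; apply/row_matrixP => l; rewrite [LHS]rowE [RHS]rowE -h.
exact/esym/diffEjacobian.
Qed.

Lemma jacobian_comp (f g : V -> V) (q : V) : differentiable f q -> differentiable g (f q) ->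
  'J (g \o f) q = 'J f q *m 'J g (f q).
Proof.
move=> df dg; apply: jacobian_unique => [|v]; first exact: differentiable_comp.
rewrite diff_comp //; apply: (etrans (diffEjacobian _ dg)).
exact: (etrans (congr1 (fun u => u *m _) (diffEjacobian v df)) (esym (mulmxA v _ _))).
Qed.

Lemma jacobian_near (f g : V -> V) (q : V) : (\near q, f q = g q) ->
  differentiable f q -> 'J f q = 'J g q.
Proof.
move=> fg df; have dg := near_differentiable fg df.
apply: jacobian_unique => // v; apply: etrans (diffEjacobian v dg).
apply: (etrans (esym (deriveE v df))); apply: etrans (deriveE v dg); exact: near_eq_derive.
Qed.

Lemma jacobian_id (q : V) : 'J (id : V -> V) q = 1%:M.
Proof.
have di : differentiable (id : V -> V) q by [].
by apply/row_matrixP => l; rewrite !rowE mulmx1 -(deriveEjacobian _ di) derive_id.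
Qed.

End curves.

(** * Changes of charts *)

Section transitions.
Context {R : realType} {n : nat} {M : topologicalType} (A : c2atlas R n M).
Local Notation V := 'rV[R]_n.
Local Notation e_ := (delta_mx (0 : 'I_1)).
Implicit Types (i j k : chart_index A) (x : M) (q p v : V).

Definition transition i j : V -> V := chart j \o param i.

Lemma near_cod i q : cod i q -> \forall q' \near q, cod i q'.
Proof. by move=> iq; apply: open_nbhs_nbhs; split=> //; exact: open_cod. Qed.

Lemma dom_param i q : cod i q -> dom i (param i q).
Proof. by move=> [x ix <-]; rewrite chartK. Qed.

Lemma paramK i q : cod i q -> chart i (param i q) = q.
Proof. by move=> [x ix <-]; rewrite chartK. Qed.

Lemma cod_chart i x : dom i x -> cod i (chart i x).
Proof. by move=> ix; exists x. Qed.

Lemma overlapP i j q : (chart i @` (dom i `&` dom j)) q <-> cod i q /\ dom j (param i q).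
Proof.
split=> [[x [ix jx] <-]|[iq jq]]; first by rewrite chartK //; split=> //; exists x.
by exists (param i q); [split=> //; exact: dom_param|exact: paramK].
Qed.

Lemma near_param i q (P : M -> Prop) : cod i q -> (\forall x \near param i q, P x) ->
  \forall q' \near q, P (param i q').
Proof. by move=> iq h; exact: (param_continuous iq h). Qed.

Lemma near_chart i x (P : V -> Prop) : dom i x -> (\forall q \near chart i x, P q) ->
  \forall y \near x, P (chart i y).
Proof. by move=> ix h; exact: (chart_continuous ix h). Qed.

Lemma near_dom i x : dom i x -> \forall y \near x, dom i y.
Proof. by move=> ix; apply: open_nbhs_nbhs; split=> //; exact: dom_open. Qed.

Lemma near_dom_param i j q : cod i q -> dom j (param i q) ->
  \forall q' \near q, dom j (param i q').
Proof. by move=> iq jq; apply: near_param => //; exact: near_dom. Qed.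

Lemma open_overlap i j : open (chart i @` (dom i `&` dom j)).
Proof.
rewrite openE => q /overlapP[iq jq]; rewrite /interior.
have := near_cod iq; have := near_dom_param iq jq.
by apply: filterS2 => q' h1 h2; apply/overlapP.
Qed.

Lemma transition_differentiable i j q : cod i q -> dom j (param i q) ->
  differentiable (transition i j) q.
Proof. move=> iq jq; have /= [d _] := transition_C2 (c := A) i j; apply: d.
exact/overlapP. Qed.

Lemma transition_comp i j k q : cod i q -> dom j (param i q) -> dom k (param i q) ->
  'J (transition i j) q *m 'J (transition j k) (transition i j q) = 'J (transition i k) q.
Proof.
move=> iq jq kq.
have jq' : cod j (transition i j q) by exact: cod_chart.
have pq : param j (transition i j q) = param i q by rewrite /transition /= chartK.
have dij := transition_differentiable iq jq.
have djk : differentiable (transition j k) (transition i j q).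
  by apply: transition_differentiable; rewrite ?pq.
apply: (etrans (esym (jacobian_comp dij djk))).
apply: jacobian_near (differentiable_comp dij djk).
by apply: filterS (near_dom_param iq jq) => y jy; rewrite /transition /= chartK.
Qed.

Lemma transition_id i q : cod i q -> 'J (transition i i) q = 1%:M.
Proof.
move=> iq; rewrite -(jacobian_id q); apply: jacobian_near (transition_differentiable iq (dom_param iq)).
by apply: filterS (near_cod iq) => y iy; rewrite /transition /= paramK.
Qed.

Lemma tangent_paramE i j q v : cod i q -> dom j (param i q) ->
  tangent_param j (transition i j q) (v *m 'J (transition i j) q) = tangent_param i q v.
Proof.
move=> iq jq; have pq : param j (transition i j q) = param i q by exact: chartK.
rewrite /tangent_param /to_preferred pq -mulmxA; congr (_ *m _).
exact: (transition_comp iq jq (dom_chart_at A (param i q))).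
Qed.

Definition from_preferred i q : 'M[R]_n :=
  'J (transition (chart_at A (param i q)) i) (chart (chart_at A (param i q)) (param i q)).

Lemma to_from_preferred i q : cod i q -> to_preferred i q *m from_preferred i q = 1%:M.
Proof.
move=> iq; rewrite -(transition_id iq).
by apply: transition_comp => //; [exact: dom_chart_at|exact: dom_param].
Qed.

Lemma from_to_preferred i q : cod i q -> from_preferred i q *m to_preferred i q = 1%:M.
Proof. by move=> iq; apply: mulmx1C; exact: to_from_preferred. Qed.

Lemma pairing_trmx p v (B : 'M[R]_n) : pairing (p *m B^T) v = pairing p (v *m B).
Proof.
have E (a b : V) : pairing a b = (a *m b^T) ord0 ord0.
  by rewrite mxE; apply: eq_bigr => k _; rewrite mxE.
by rewrite !E trmx_mul mulmxA.
Qed.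

(** Covectors in the chart i and in the preferred chart correspond bijectively, so both suprema run
    over the same values. *)
Lemma legendre_lagrangian (F : cotangent_bundle A -> R) i q v : cod i q ->
  legendre (F \o cotangent_param i) q v = lagrangian F (param i q) (tangent_param i q v).
Proof.
move=> iq; rewrite /legendre /lagrangian; congr sup; apply/seteqP; split=> c [p _ <-].
  exists (p *m (from_preferred i q)^T) => //=.
  by rewrite pairing_trmx -mulmxA to_from_preferred // mulmx1.
exists (p *m (to_preferred i q)^T) => //=; rewrite pairing_trmx; congr (_ - F (_, _)).
transitivity (p *m (from_preferred i q *m to_preferred i q)^T).
  by rewrite trmx_mul mulmxA.
by rewrite (from_to_preferred iq) trmx1 mulmx1.
Qed.

Lemma legendre_transition (F : cotangent_bundle A -> R) i j q v :
  cod i q -> dom j (param i q) ->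
  legendre (F \o cotangent_param j) (transition i j q) (v *m 'J (transition i j) q) =
  legendre (F \o cotangent_param i) q v.
Proof.
move=> iq jq; have pq : param j (transition i j q) = param i q by exact: chartK.
apply: etrans (esym (legendre_lagrangian F v iq)).
apply: (etrans (legendre_lagrangian F _ (cod_chart jq))).
exact: (f_equal2 (lagrangian F) pq (tangent_paramE v iq jq)).
Qed.

End transitions.

Lemma near_continuous (T T' : topologicalType) (f g : T -> T') (x : T) :
  (\forall y \near x, f y = g y) -> {for x, continuous f} -> {for x, continuous g}.
Proof.
move=> fg cf; rewrite /prop_for /continuous_at -(nbhs_singleton fg).
by apply: cvg_trans cf; exact: near_eq_cvg.
Qed.

(** * Shifting momenta by a 1-form *)

Section shear.
Context {R : realType} {n : nat}.
Local Notation V := 'rV[R]_n.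
Local Notation e_ := (delta_mx (0 : 'I_1)).
Implicit Types (p q v : V) (z h : V * V).

Lemma derive_snd (K : V * V -> R) q p v :
  'D_v (fun p' => K (q, p')) p = 'D_(0, v) K (q, p).
Proof.
have E : (fun h : R => h^-1 *: (((fun p' => K (q, p')) \o shift p) (h *: v) - K (q, p))) =
    (fun h : R => h^-1 *: ((K \o shift (q, p)) (h *: ((0, v) : V * V)) - K (q, p))).
  by apply/funext => h /=; congr (_ *: (K (_, _) - _)); rewrite /= ?scaler0 ?add0r.
by rewrite /derive E.
Qed.

Lemma derivable_snd (K : V * V -> R) q p v :
  derivable (fun p' => K (q, p')) p v = derivable K (q, p) (0, v).
Proof.
have E : (fun h : R => h^-1 *: (((fun p' => K (q, p')) \o shift p) (h *: v) - K (q, p))) =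
    (fun h : R => h^-1 *: ((K \o shift (q, p)) (h *: ((0, v) : V * V)) - K (q, p))).
  by apply/funext => h /=; congr (_ *: (K (_, _) - _)); rewrite /= ?scaler0 ?add0r.
by rewrite /derivable E.
Qed.

Lemma derive_affine (f : V -> R) (B : 'M[R]_n) (b p v : V) :
  'D_v (fun p' => f (p' *m B + b)) p = 'D_(v *m B) f (p *m B + b).
Proof.
have E : (fun h : R => h^-1 *: (((fun p' => f (p' *m B + b)) \o shift p) (h *: v) -
    f (p *m B + b))) =
    (fun h : R => h^-1 *: ((f \o shift (p *m B + b)) (h *: (v *m B)) - f (p *m B + b))).
  by apply/funext => h /=; rewrite mulmxDl -scalemxAl addrA.
by rewrite /derive E.
Qed.

Lemma strictly_convex (f : V -> R) p p' : p' != p ->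
  (forall x, derivable f x (p' - p)) ->
  (forall x, 0 < 'D_(p' - p) ('D_(p' - p) f) x) ->
  f p + 'D_(p' - p) f p < f p'.
Proof.
move=> pp' df ddf; have [t /andP[t0 t1] E] := segment_mean_value (fun t _ => df (p + t *: (p' - p))).
rewrite addrC -ltrBrDr E.
set v := p' - p in df ddf E *; set h := fun s : R => 'D_v f (p + s *: v).
have dh (s : R) : derivable h s 1.
  by rewrite /h (derivable_line ('D_v f)); apply: derive_gt0_derivable.
have [||s] := @MVT R h (fun s => 'D_v ('D_v f) (p + s *: v)) 0 t t0.
- by move=> s _; rewrite -(derive_line ('D_v f)); apply: derivableP.
- by apply: derivable_within_continuous => s _.
rewrite in_itv/= => _; rewrite /h scale0r addr0 subr0 => E2.
by rewrite -subr_gt0 E2 mulr_gt0.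
Qed.

Variables (U : set V) (K K0 : V * V -> R) (W : V -> V).
Hypotheses (oU : open U) (K0C2 : Ck 2 K0 [set z | U z.1])
  (WC1 : forall k, Ck 1 (fun q => W q 0 k) U)
  (KE : forall z, U z.1 -> K z = K0 (z.1, z.2 + W z.1)).

Let S (z : V * V) : V * V := (z.1, z.2 + W z.1).
Let dW k q : V := \row_l 'D_(e_ k) (fun q => W q 0 l) q.

Lemma W_differentiable q : U q -> differentiable W q.
Proof.
move=> Uq; have -> : W = (fun q => \row_l W q 0 l).
  by apply/funext => y; apply/rowP => l; rewrite mxE.
by apply: differentiable_row => l; apply: (WC1 l).1.
Qed.

Lemma derive_W k q : U q -> 'D_(e_ k) W q = dW k q.
Proof.
move=> Uq; rewrite derive_mx; last exact/diff_derivable/W_differentiable.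
by apply/rowP => l; rewrite !mxE.
Qed.

Lemma shear_diff z : U z.1 -> is_diff z S (fun h => (h.1, h.2 + 'd W (z.1) h.1)).
Proof.
move=> Uz.
have d1 : is_diff z (fst : V * V -> V) fst.
  have c : continuous (fst : V * V -> V) by move=> y; exact: cvg_fst.
  by apply: DiffDef; [exact: linear_differentiable|exact: diff_lin].
have d2 : is_diff z (snd : V * V -> V) snd.
  have c : continuous (snd : V * V -> V) by move=> y; exact: cvg_snd.
  by apply: DiffDef; [exact: linear_differentiable|exact: diff_lin].
have dW' : is_diff (z.1) W ('d W (z.1)) by apply: DiffDef => //; exact: W_differentiable.
exact: is_diff_pair.
Qed.

Lemma near_shear z : U z.1 -> \forall y \near z, K y = K0 (S y).
Proof.
case: z => q p Uq; apply: filterS (near_fst p (open_nbhs_nbhs (conj oU Uq))) => y Uy.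
exact: KE.
Qed.

Lemma K_differentiable z : U z.1 -> differentiable K z.
Proof.
move=> Uz; apply: (@near_differentiable _ _ _ (K0 \o S)).
  by apply: filterS (near_shear Uz) => y /= ->.
have dS := shear_diff Uz.
by apply: differentiable_comp => //; exact: K0C2.1.
Qed.

Lemma derive_shear z h : U z.1 -> 'D_h K z = 'D_(h.1, h.2 + 'd W (z.1) h.1) K0 (S z).
Proof.
move=> Uz; have dS := shear_diff Uz; have dK0 : differentiable K0 (S z) by exact: K0C2.1.
rewrite (near_eq_derive _ (near_shear Uz)) deriveE; last exact: differentiable_comp.
by rewrite diff_comp // diff_val deriveE.
Qed.

Lemma gradp_shear z : U z.1 -> gradp K z = gradp K0 (S z).
Proof.
move=> Uz; apply/rowP => k; rewrite mxE [RHS]mxE (derive_shear _ Uz) /=.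
have L := linear0 ('d W (z.1)).
by rewrite L addr0.
Qed.

Lemma gradq_shear z : U z.1 ->
  gradq K z = gradq K0 (S z) + \row_k pairing (gradp K0 (S z)) (dW k z.1).
Proof.
move=> Uz; apply/rowP => k; rewrite mxE (derive_shear _ Uz) /= add0r.
rewrite derive_gradqp; last exact: K0C2.1.
rewrite -(deriveE _ (W_differentiable Uz)) (derive_W k Uz) mxE [X in _ = _ + X]mxE.
rewrite /=; congr (_ + _); rewrite /pairing (bigD1 k) //= big1 ?addr0.
  by rewrite !mxE !eqxx mulr1.
by move=> l lk; rewrite !mxE (negbTE lk) andbF mulr0.
Qed.

Lemma gradients_continuous z : U z.1 ->
  {for z, continuous (gradq K)} /\ {for z, continuous (gradp K)}.
Proof.
move=> Uz.
have nU : \forall y \near z, U y.1.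
  by move: z Uz => [q p] Uq; exact: (near_fst p (open_nbhs_nbhs (conj oU Uq))).
have dS := shear_diff Uz.
have cS : {for z, continuous S} by apply: differentiable_continuous.
have cd (v : V * V) : {for z, continuous (fun y => 'D_v K0 (S y))}.
  apply: (@continuous_comp _ _ _ S ('D_v K0)) => //.
  by apply: differentiable_continuous; apply: (K0C2.2 v).1.
have cp : {for z, continuous (gradp K0 \o S)} by apply: continuous_row => k; exact: cd.
have cq : {for z, continuous (gradq K0 \o S)} by apply: continuous_row => k; exact: cd.
have cW k : {for z, continuous (fun y => dW k y.1)}.
  apply: (@continuous_comp _ _ _ fst (dW k)); first exact: cvg_fst.
  by apply: continuous_row => l; exact: (WC1 l).2.
split.
- have c : {for z, continuous (fun y => gradq K0 (S y) + \row_k pairing (gradp K0 (S y)) (dW k y.1))}.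
    apply: cvgD; first exact: cq.
    by apply: continuous_row => k; apply: cvg_pairing; [exact: cp|exact: cW].
  by apply: near_continuous c; apply: filterS nU => y Uy; exact/esym/gradq_shear.
- by apply: near_continuous cp; apply: filterS nU => y Uy; exact/esym/gradp_shear.
Qed.

(** K is only known to be C^1, because W is. Continuity of its gradients gives strict
    differentiability, and positivity of the second derivative along fibers gives strict
    convexity. *)
Lemma shear_hamiltonian :
  (forall q p v, U q -> v != 0 -> 0 < 'D_v ('D_v (fun p' => K (q, p'))) p) ->
  (forall q0 (k : R), U q0 -> exists C : R, \forall q \near q0, forall p : V, k * `|p| - C <= K (q, p)) ->
  is_hamiltonian U K (gradq K) (gradp K).
Proof.
move=> convK coerK; split=> //.
- move=> z Uz; have [cq cp] := gradients_continuous Uz.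
  apply: (@strict_differentiable R n U K (gradq K) (gradp K) z oU Uz _ cq cp).
  move=> y Uy h; split; first exact/diff_derivable/K_differentiable.
  by apply: derive_gradqp; exact: K_differentiable.
- by move=> z Uz; exact: (gradients_continuous Uz).1.
- by move=> z Uz; exact: (gradients_continuous Uz).2.
move=> q p p' Uq pp'.
have dKq : differentiable K (q, p) by exact: K_differentiable.
have := derive_gradqp (0, p' - p) dKq; rewrite /= pairing0r add0r => <-.
rewrite -derive_snd; apply: strictly_convex => // [x|x].
  by rewrite derivable_snd; exact/diff_derivable/K_differentiable.
by apply: convK; rewrite // subr_eq0.
Qed.

End shear.

(** The shift adds to the bracket the derivatives of W paired with both fiber gradients. These terms
    cancel because the Jacobian of W is symmetric, that is, because the form is closed. *)
Lemma shear_bracket (R : realType) (n : nat) (U : set 'rV[R]_n)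
    (K K0 L L0 : 'rV[R]_n * 'rV[R]_n -> R) (W : 'rV[R]_n -> 'rV[R]_n) z :
  open U -> Ck 2 K0 [set z | U z.1] -> Ck 2 L0 [set z | U z.1] ->
  (forall k, Ck 1 (fun q => W q 0 k) U) ->
  (forall z, U z.1 -> K z = K0 (z.1, z.2 + W z.1)) ->
  (forall z, U z.1 -> L z = L0 (z.1, z.2 + W z.1)) ->
  (forall q k l, U q -> 'D_(delta_mx 0 k) (fun q => W q 0 l) q =
                        'D_(delta_mx 0 l) (fun q => W q 0 k) q) ->
  (forall z, U z.1 -> pairing (gradp L0 z) (gradq K0 z) = pairing (gradq L0 z) (gradp K0 z)) ->
  U z.1 -> pairing (gradp L z) (gradq K z) = pairing (gradq L z) (gradp K z).
Proof.
move=> oU CK CL CW KE LE sym br Uz.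
rewrite (gradp_shear oU CK CW KE Uz) (gradq_shear oU CK CW KE Uz).
rewrite (gradp_shear oU CL CW LE Uz) (gradq_shear oU CL CW LE Uz).
rewrite pairingDr pairingDl br //; congr (_ + _); rewrite [RHS]pairingC /pairing.
under eq_bigr => k _ do rewrite mxE mulr_sumr.
under [RHS]eq_bigr => k _ do rewrite mxE mulr_sumr.
rewrite exchange_big /=; apply: eq_bigr => k _; apply: eq_bigr => l _.
by rewrite !mxE sym // mulrCA.
Qed.

(** * Shifted Tonelli Hamiltonians in charts *)

Section tonelli_charts.
Context {R : realType} {n : nat} {M : topologicalType} (A : c2atlas R n M).
Variable g : riemannian_metric A.
Local Notation V := 'rV[R]_n.
Local Notation e_ := (delta_mx (0 : 'I_1)).
Implicit Types (i : chart_index A) (x : M) (q p v : V) (z X Y : V * V) (w : M -> V).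
Implicit Types F G H : cotangent_bundle A -> R.

Definition shift_comp w i q : V := \row_k form_comp w i (e_ k) q.

Lemma pairing_delta p k : pairing p (e_ k) = p ord0 k.
Proof.
rewrite /pairing (bigD1 k) //= big1 ?addr0; first by rewrite !mxE !eqxx mulr1.
by move=> l lk; rewrite !mxE (negbTE lk) andbF mulr0.
Qed.

Lemma shift_compE w i q : cod i q -> shift_comp w i q *m (from_preferred i q)^T = w (param i q).
Proof.
move=> iq; have -> : shift_comp w i q = w (param i q) *m (to_preferred i q)^T.
  apply/rowP => k; rewrite mxE -[RHS]pairing_delta.
  by rewrite pairing_trmx.
transitivity (w (param i q) *m (from_preferred i q *m to_preferred i q)^T).
  by rewrite trmx_mul mulmxA.
by rewrite (from_to_preferred iq) trmx1 mulmx1.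
Qed.

Lemma shift_form_param F w i z : cod i z.1 ->
  (shift_form F w \o cotangent_param i) z =
  (F \o cotangent_param i) (z.1, z.2 + shift_comp w i z.1).
Proof.
case: z => q p /= iq; rewrite /shift_form /=; congr (F (_, _)).
by rewrite mulmxDl; congr (_ + _); exact/esym/shift_compE.
Qed.

Lemma gram_unit x : gram g x \in unitmx.
Proof.
rewrite -row_free_unit -kermx_eq0; apply/rowV0P => v /sub_kermxP vG.
apply/eqP; apply: contraT => v0; have := gram_posdef g x v0.
by rewrite vG mul0mx mxE ltxx.
Qed.

(** [sup] is meaningful only for bounded sets, so a bound comes first: if a represents p in the
    metric, positivity of the squared length of a - v' bounds [pairing p v'] by half of 1 plus the
    squared length of a. *)
Lemma cotangent_norm_ge x p v : tangent_norm g x v <= 1 -> pairing p v <= cotangent_norm g x p.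
Proof.
move=> v1; apply: ub_le_sup; last by exists v.
set Q := gram g x; set a : V := p *m invmx Q.
have pE (v' : V) : pairing p v' = (a *m Q *m v'^T) ord0 ord0.
  rewrite mulmxKV ?gram_unit // mxE; apply: eq_bigr => k _; by rewrite mxE.
exists (((a *m Q *m a^T) ord0 ord0 + 1) / 2) => _ [v' v'1 <-].
have v'2 : (v' *m Q *m v'^T) ord0 ord0 <= 1.
  rewrite leNgt; apply/negP => gt1; move: v'1; rewrite /= /tangent_norm -/Q.
  by rewrite leNgt => /negP; apply; rewrite -[X in X < _]sqrtr1 ltr_sqrt // (lt_trans ltr01).
have pos : 0 <= ((a - v') *m Q *m (a - v')^T) ord0 ord0.
  have [->|av] := eqVneq (a - v') 0; first by rewrite !mul0mx mxE.
  by apply: ltW; exact: gram_posdef.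
have sym : (v' *m Q *m a^T) ord0 ord0 = (a *m Q *m v'^T) ord0 ord0.
  have -> : v' *m Q *m a^T = (a *m Q *m v'^T)^T.
    by rewrite !trmx_mul trmxK gram_sym mulmxA.
  by rewrite mxE.
move: pos; rewrite linearB /= mulmxBl mulmxBr mulmxBl mulmxBl.
have E (B C : 'M[R]_1) : (B - C) ord0 ord0 = B ord0 ord0 - C ord0 ord0 by rewrite !mxE.
rewrite !E sym -pE => pos; lra.
Qed.

(** Near q0 the coordinate vectors divided by c have length at most 1, because c is at least 1 and
    exceeds their squared lengths; pairing a covector with them and their opposites bounds its
    coordinates. *)
Lemma cotangent_norm_chart i q0 : cod i q0 -> exists2 c : R, 0 < c & \forall q \near q0,
  forall p, `|p| <= c * cotangent_norm g (param i q) (p *m (from_preferred i q)^T).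
Proof.
move=> iq0.
pose gam (k : 'I_n) q := (tangent_param i q (e_ k) *m gram g (param i q) *m (tangent_param i q (e_ k))^T) ord0 ord0.
pose c : R := \sum_k `|gam k q0| + 1.
have gc k : gam k q0 + 1 <= c.
  rewrite lerD2r; apply: le_trans (ler_norm _) _.
  by rewrite (bigD1 k) //= lerDl sumr_ge0.
have c1 : 1 <= c by rewrite lerDr sumr_ge0.
have c0 : 0 < c by exact: lt_le_trans c1.
exists c => //.
have ng : \forall q \near q0, forall k, gam k q < c.
  have h k : \forall q \near q0, gam k q < c.
    apply: continuous_near_lt.
      by apply: differentiable_continuous; apply: (gram_C1 g i (e_ k) (e_ k)).1.
    by apply: lt_le_trans (gc k); rewrite ltrDl.
  exact: filter_forall h.
apply: filterS2 (near_cod iq0) ng => q iq gq p.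
set N := cotangent_norm _ _ _.
have tn (s : R) k : s ^+ 2 <= c^-1 ^+ 2 -> tangent_norm g (param i q) (tangent_param i q (s *: e_ k)) <= 1.
  move=> sc; rewrite /tangent_norm -sqrtr1 ler_wsqrtr //.
  have -> : tangent_param i q (s *: e_ k) = s *: tangent_param i q (e_ k) by rewrite /tangent_param -scalemxAl.
  rewrite linearZ /= -!scalemxAl -scalemxAr scalerA -expr2 mxE -/(gam k q).
  have [g0|g0] := lerP (gam k q) 0.
    by apply: le_trans (ler01); rewrite mulr_ge0_le0 // sqr_ge0.
  apply: le_trans (ler_wpM2r (ltW g0) sc) _.
  rewrite expr2 -mulrA (@le_trans _ _ (c^-1 * (c^-1 * c))) //.
    by rewrite ler_pM2l ?invr_gt0 // ler_pM2l ?invr_gt0 // ltW.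
  by rewrite mulVf ?gt_eqF // mulr1 invf_le1.
have pe (s : R) k : s ^+ 2 <= c^-1 ^+ 2 -> s * p ord0 k <= N.
  move=> sc; apply: le_trans (cotangent_norm_ge (p *m (from_preferred i q)^T) (tn _ k sc)).
  rewrite pairing_trmx /tangent_param -mulmxA (to_from_preferred iq) mulmx1.
  by rewrite pairingZr pairing_delta.
have bnd k : `|p ord0 k| <= c * N.
  have h1 := pe c^-1 k (lexx _).
  have h2 : - c^-1 * p ord0 k <= N by apply: pe; rewrite sqrrN.
  rewrite ler_norml; move: h1 h2; rewrite -(ler_pM2l c0) mulrA divff ?gt_eqF // mul1r => h1.
  rewrite -(ler_pM2l c0) mulNr mulrN mulrA divff ?gt_eqF // mul1r => h2.
  by rewrite h1 andbT lerNl.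
(* In dimension 0 there is no coordinate to give the sign of N, which comes from the zero vector
   instead. *)
have [k|n0] := pickP 'I_n; last first.
  have N0 : 0 <= N by rewrite -(pairing0r (p *m (from_preferred i q)^T)); apply: cotangent_norm_ge; rewrite /tangent_norm !mul0mx mxE sqrtr0.
  by apply: norm_rV_le => [|k]; [rewrite mulr_ge0 // ltW|have := n0 k].
by move=> _; apply: norm_rV_le => //; exact: le_trans (normr_ge0 _) (bnd k).
Qed.

Lemma shift_comp_C1 w i k : is_closed A w -> Ck 1 (fun q => shift_comp w i q 0 k) (cod i).
Proof.
move=> [wC _]; have -> : (fun q => shift_comp w i q 0 k) = form_comp w i (e_ k).
  by apply/funext => q; rewrite mxE.
exact: wC.
Qed.

Definition regular F := forall i,
  is_hamiltonian (cod i) (F \o cotangent_param i)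
    (gradq (F \o cotangent_param i)) (gradp (F \o cotangent_param i)).

(** Vanishing of the Poisson bracket in canonical coordinates. *)
Definition commuting G H := forall i z, cod i z.1 ->
  pairing (gradp (H \o cotangent_param i) z) (gradq (G \o cotangent_param i) z) =
  pairing (gradq (H \o cotangent_param i) z) (gradp (G \o cotangent_param i) z).

Lemma tonelli_regular F w : tonelli g F -> is_closed A w -> regular (shift_form F w).
Proof.
move=> [FC2 coer _ conv] cw i.
apply: (@shear_hamiltonian _ _ (cod i) _ _ (shift_comp w i) (@open_cod _ _ _ _ i) (FC2 i)).
- by move=> k; exact: shift_comp_C1.
- by move=> z; exact: shift_form_param.
- move=> q p v iq v0.
  set B := (from_preferred i q)^T; set x := param i q.
  have E : (fun p' => (shift_form F w \o cotangent_param i) (q, p')) =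
      (fun p' => F (x, p' *m B + w x)) by [].
  have E1 : 'D_v (fun p' => F (x, p' *m B + w x)) =
      (fun p' => 'D_(v *m B) (fun p'' => F (x, p'')) (p' *m B + w x)).
    by apply/funext => p'; rewrite -(derive_affine (fun p'' => F (x, p''))).
  rewrite E E1 (derive_affine ('D_(v *m B) (fun p'' => F (x, p'')))).
  apply: conv; apply: contra_neq v0 => vB.
  rewrite -[v]mulmx1 -trmx1 -(to_from_preferred iq) trmx_mul mulmxA.
  by move: vB; rewrite /B => ->; rewrite mul0mx.
move=> q0 k iq0.
have [c c0 cN] := cotangent_norm_chart iq0.
have kk : 0 < `|k| + 1 by rewrite ltr_wpDl.
have [C CP] := coer ((`|k| + 1) * c) (mulr_gt0 kk c0).
have cW : {for q0, continuous (shift_comp w i)}.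
  by apply: continuous_row => l; apply: differentiable_continuous; apply: (cw.1 i (e_ l)).1.
have nW : \forall q \near q0, `|shift_comp w i q| <= `|shift_comp w i q0| + 1.
  have /continuous_ptP /(_ 1 ltr01) := cW; apply: filterS => q h.
  by rewrite -lerBlDl; apply: le_trans h; exact: lerB_dist.
exists (C + (`|k| + 1) * (`|shift_comp w i q0| + 1)).
apply: filterS3 (near_cod iq0) cN nW => q iq hN hW p.
have := CP (param i q) ((p + shift_comp w i q) *m (from_preferred i q)^T).
rewrite -/((F \o cotangent_param i) (q, p + shift_comp w i q)) -(shift_form_param _ _ (z := (q, p))) // => h.
have := hN (p + shift_comp w i q); move: h; set N := cotangent_norm _ _ _ => h1 h2.
have h3 : `|p| <= `|p + shift_comp w i q| + `|shift_comp w i q|.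
  by rewrite -{1}[p](addrK (shift_comp w i q)); exact: ler_normB.
have h4 : k * `|p| <= (`|k| + 1) * `|p|.
  by rewrite ler_wpM2r // ler_wpDr // ler_norm.
have h5 : (`|k| + 1) * `|p| <= (`|k| + 1) * (c * N + (`|shift_comp w i q0| + 1)).
  by rewrite ler_pM2l // (le_trans h3) // lerD.
move: h1 => /(le_trans _); apply; rewrite -mulrA.
move: (le_trans h4 h5); rewrite mulrDr => h6; rewrite lerBlDr.
by apply: le_trans h6 _; rewrite addrA subrK.
Qed.

Lemma derive_pairing_snd z X p : 'D_X (fun z' : V * V => pairing z'.2 p) z = pairing X.2 p.
Proof.
have H : (fun h : R => h^-1 *: (((fun z' : V * V => pairing z'.2 p) \o shift z) (h *: X) -
    pairing z.2 p)) @ 0^' --> pairing X.2 p.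
  apply: cvg_near_cst; apply: filterS (nbhs_dnbhs_neq (0 : R)) => h h0.
  by rewrite /= pairingDl pairingZl addrK -[LHS]/(_ * _) mulKf.
by rewrite /derive; exact: (cvg_lim (@Rhausdorff R) H).
Qed.

Lemma OmegaE z X Y : Omega z X Y = pairing Y.2 X.1 - pairing X.2 Y.1.
Proof. by rewrite /Omega /liouville !derive_pairing_snd opprB. Qed.

(** [poisson_commute] speaks of any vectors satisfying the defining relation; in canonical
    coordinates the pair of [gradp] and minus [gradq] satisfies it. *)
Lemma commute_bracket G H : tonelli g G -> tonelli g H -> poisson_commute G H -> commuting G H.
Proof.
move=> [GC _ _ _] [HC _ _ _] GH i z iz.
set KG := G \o cotangent_param i; set KH := H \o cotangent_param i.
have hv F (KF := F \o cotangent_param i) : Ck 2 KF (cotangent_cod i) ->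
    hamiltonian_vector F i z (gradp KF z, - gradq KF z).
  move=> FC Y; rewrite OmegaE derive_gradqp; last exact: FC.1.
  by rewrite /= pairingNl opprK addrC [pairing Y.2 _]pairingC.
have := GH i z _ _ iz (hv G (GC i)) (hv H (HC i)).
rewrite OmegaE /= !pairingNl opprK addrC => /eqP; rewrite subr_eq0 => /eqP e.
exact: (etrans (pairingC _ _) e).
Qed.

Lemma shift_bracket G H w : tonelli g G -> tonelli g H -> poisson_commute G H ->
  is_closed A w -> commuting (shift_form G w) (shift_form H w).
Proof.
move=> tG tH GH cw i z iz; have br := commute_bracket tG tH GH.
case: tG tH => [GC _ _ _] [HC _ _ _].
have E m : (fun q => shift_comp w i q 0 m) = form_comp w i (e_ m).
  by apply/funext => y; rewrite mxE.
have sym q k l : cod i q -> 'D_(e_ k) (fun q => shift_comp w i q 0 l) q =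
    'D_(e_ l) (fun q => shift_comp w i q 0 k) q.
  by move=> iq; rewrite !E; exact: cw.2.
exact: (@shear_bracket R n (cod i) _ (G \o cotangent_param i) _ (H \o cotangent_param i)
  (shift_comp w i) z (@open_cod _ _ _ _ i) (GC i) (HC i) (fun k => shift_comp_C1 i k cw)
  (fun z' => @shift_form_param G w i z') (fun z' => @shift_form_param H w i z') sym (br i) iz).
Qed.

End tonelli_charts.

(** * Subsolutions on the manifold *)

Section global_subsolutions.
Context {R : realType} {n : nat} {M : topologicalType} {A : c2atlas R n M}.
Local Notation V := 'rV[R]_n.
Implicit Types (i j : chart_index A) (x y : M) (q p v : V) (l u : M -> R).
Implicit Types F : cotangent_bundle A -> R.

Definition local_lipschitz (f : V -> R) q :=
  exists C, \forall x \near q & y \near q, f y - f x <= C * `|y - x|.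

Definition chart_ham F i : V * V -> R := F \o cotangent_param i.

Definition sub F l u := forall i,
  local_sub (cod i) (chart_ham F i) (l \o param i) (u \o param i).

(** A single chart around x suffices, provided that u is Lipschitz there: this clause lets
    [dini_curve] carry the estimate to the other charts. *)
Definition sub_at F l u x := exists i, [/\ dom i x,
  local_lipschitz (u \o param i) (chart i x) &
  forall v, dini (u \o param i) (chart i x) v
    (legendre (chart_ham F i) (chart i x) v + l x)].

Lemma local_lipschitzP (f : V -> R) q : local_lipschitz f q <-> exists C r,
  [/\ 0 <= C, 0 < r & forall x y : V, `|x - q| < r -> `|y - q| < r -> f y - f x <= C * `|y - x|].
Proof.
split=> [[C [[P Q] [/= /near_norm[d1 d10 h1] /near_norm[d2 d20 h2]]] PQ]|[C [r [C0 r0 h]]]].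
  exists `|C|, (Num.min d1 d2); split=> [||x y]; rewrite ?normr_ge0 ?lt_min ?d10 //.
  move=> /andP[x1 _] /andP[_ y2]; apply: (@le_trans _ _ (C * `|y - x|)).
    by apply: (PQ (x, y)); split => /=; [exact: h1|exact: h2].
  by rewrite ler_wpM2r // ler_norm.
exists C; exists ([set x : V | `|x - q| < r], [set x : V | `|x - q| < r]).
  by split; exact: (near_dist q r0).
by move=> [x y] [/= h1 h2]; exact: h.
Qed.

Lemma local_lipschitz_continuous (f : V -> R) q : local_lipschitz f q -> {for q, continuous f}.
Proof.
move=> /local_lipschitzP[C [r [C0 r0 h]]]; apply/continuous_ptP => e e0.
have C1 : 0 < C + 1 by rewrite ltr_wpDl.
have := near_dist q (divr_gt0 e0 C1); have := near_dist q r0.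
apply: filterS2 => y yr ye; have q0 : `|q - q| < r by rewrite subrr normr0.
have h1 := h _ _ q0 yr; have h2 := h _ _ yr q0.
rewrite distrC in h2.
have h3 : C * `|y - q| <= e.
  apply: le_trans (_ : (C + 1) * `|y - q| <= _); first by rewrite ler_wpM2r // lerDl.
  by rewrite -ler_pdivlMl // mulrC ltW.
rewrite ler_norml; apply/andP; split; last exact: le_trans h1 h3.
by rewrite lerNl opprB; exact: le_trans h2 h3.
Qed.

Lemma sub_at_all F l u : (forall x, sub_at F l u x) -> sub F l u.
Proof.
move=> h j.
have ev q : cod j q -> exists i, [/\ dom i (param j q), differentiable (transition j i) q,
    \forall q' \near q, (u \o param j) q' = (u \o param i) (transition j i q'),
    local_lipschitz (u \o param i) (transition j i q) &
    forall v, dini (u \o param i) (transition j i q) v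
    (legendre (chart_ham F i) (transition j i q) v + l (param j q))].
  move=> jq; have [i [ix lu du]] := h (param j q).
  exists i; split=> //; first exact: transition_differentiable.
  by apply: filterS (near_dom_param jq ix) => y iy; rewrite /transition /= chartK.
split=> [q /ev [i [ix d ne lu _]]|q v jq].
  apply: near_continuous (_ : {for q, continuous ((u \o param i) \o transition j i)}).
    by apply: filterS ne => y /esym.
  apply: continuous_comp; first exact: differentiable_continuous.
  exact: local_lipschitz_continuous.
have [i [ix d ne [C lu] du]] := ev q jq.
set v' := v *m 'J (transition j i) q.
have LE : legendre (chart_ham F i) (transition j i q) v' = legendre (chart_ham F j) q v.
  exact: legendre_transition.
have dc e : 0 < e -> \forall h \near (0 : R)^'+,
    `|transition j i (q + h *: v) - transition j i q - h *: v'| <= h * e.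
  move=> e0; have E : 'D_v (transition j i) q = v' := deriveEjacobian v d.
  by rewrite -E; exact: differentiable_curve.
have c0 : transition j i (q + 0 *: v) = transition j i q by rewrite scale0r addr0.
have du' := eq_ind _ (fun z => dini (u \o param i) (transition j i q) v' (z + l (param j q)))
  (du v') _ LE.
move=> e e0.
have D := @dini_curve _ _ _ (fun h => transition j i (q + h *: v)) _ v' C _ lu c0 dc du' e e0.
apply: filterS2 (near_ray v ne) D => t.
by rewrite (nbhs_singleton ne) => ->.
Qed.

Lemma sub_at_near F l u u' x : (\forall y \near x, u y = u' y) -> sub_at F l u x -> sub_at F l u' x.
Proof.
move=> uu' [i [ix lu du]]; exists i.
have ne : \forall q \near chart i x, u (param i q) = u' (param i q).
  by apply: (@near_param _ _ _ A i _ (fun y => u y = u' y) (cod_chart ix)); rewrite chartK.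
split=> // [|v e e0]; last first.
  apply: filterS2 (near_ray v ne) (du v e e0) => h /= <-.
  by rewrite -(nbhs_singleton ne).
case: lu => C [[P Q] /= [nP nQ] PQ]; exists C.
exists (P `&` [set q | u (param i q) = u' (param i q)], Q `&` [set q | u (param i q) = u' (param i q)]).
  by split; apply: filterI.
by move=> [a b] /= [[Pa ea] [Qb eb]]; rewrite -ea -eb; apply: (PQ (a, b)).
Qed.

Lemma sub_continuous F l u : sub F l u -> continuous u.
Proof.
move=> h x; have ix := dom_chart_at A x; set i := chart_at A x in ix.
apply: (near_continuous (f := (u \o param i) \o chart i)).
  by apply: filterS (near_dom ix) => y iy; rewrite /= chartK.
apply: continuous_comp; first exact: chart_continuous.
by apply: (h i).1; exact: cod_chart.
Qed.

Section regular.
Variables (F : cotangent_bundle A -> R).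
Hypothesis regF : regular F.

Lemma sub_equilipschitz m i q0 : cod i q0 -> exists C r, [/\ 0 <= C, 0 < r,
  forall x : V, `|x - q0| < r -> cod i x &
  forall l u, sub F l u -> (forall x, l x <= m) ->
    forall x y : V, `|x - q0| < r -> `|y - q0| < r ->
      u (param i y) - u (param i x) <= C * `|y - x|].
Proof.
move=> iq; have [C [r [C0 r0 ri h]]] := local_sub_lipschitz (regF i) m iq.
by exists C, r; split=> // l u su lm; apply: (h (l \o param i) (u \o param i) (su i)) => q _; exact: lm.
Qed.

Lemma sub_lipschitz l u m i q : sub F l u -> (forall x, l x <= m) -> cod i q ->
  local_lipschitz (u \o param i) q.
Proof.
move=> su lm iq; have [C [r [C0 r0 _ h]]] := sub_equilipschitz m iq.
by apply/local_lipschitzP; exists C, r; split=> //; exact: h su lm.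
Qed.

Lemma sub_sub_at l u m x : sub F l u -> (forall x, l x <= m) -> sub_at F l u x.
Proof.
move=> su lm; have ix := dom_chart_at A x; exists (chart_at A x); split=> //.
  by apply: sub_lipschitz su lm _; exact: cod_chart.
move=> v; have := (su (chart_at A x)).2 _ v (cod_chart ix).
by rewrite /= chartK.
Qed.

(** d is chosen before the subsolution, so the estimate passes to limits and to suprema of
    families. *)
Lemma sub_ray i q v e : cod i q -> 0 < e -> exists2 d, 0 < d &
  forall h, 0 < h -> h < d -> (forall r, 0 <= r <= h -> cod i (q + r *: v)) /\
  forall l u c, sub F l u ->
    (forall r, 0 <= r <= h -> l (param i (q + r *: v)) <= c) ->
    u (param i (q + h *: v)) - u (param i q) <= h * (legendre (chart_ham F i) q v + e + c).
Proof.
move=> iq e0.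
have cL := @legendre_continuous R n _ _ _ _ (regF i) q v iq.
have : legendre (chart_ham F i) q v < legendre (chart_ham F i) q v + e by rewrite ltrDl.
move=> /(continuous_near_lt cL) /near_pair1 nL.
have [d d0 dP] := near_norm (filterI (near_cod iq) nL).
have v1 : 0 < `|v| + 1 by rewrite ltr_wpDl.
have near0 h r : h < d / (`|v| + 1) -> 0 <= r <= h -> `|q + r *: v - q| < d.
  move=> hd /andP[r0 rh]; rewrite addrC addKr normrZ ger0_norm //.
  apply: le_lt_trans (_ : r * (`|v| + 1) < d).
    by rewrite ler_wpM2l // lerDl.
  by rewrite -ltr_pdivlMr // (le_lt_trans rh).
exists (d / (`|v| + 1)) => [|h h0 hd]; first exact: divr_gt0.
split=> [r rh|l u c su lc]; first by have [] := dP _ (near0 _ _ hd rh).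
apply: (local_sub_segment (su i) (ltW h0)) => r rh.
  by have [] := dP _ (near0 _ _ hd rh).
by apply: lerD (lc _ rh); have [_ /ltW] := dP _ (near0 _ _ hd rh).
Qed.

End regular.
End global_subsolutions.

(** * Compactness, connectedness and the critical level *)

Section compact_manifold.
Context {R : realType} {n : nat} {M : topologicalType} {A : c2atlas R n M}.
Local Notation V := 'rV[R]_n.
Implicit Types (i j : chart_index A) (x y : M) (q p v : V) (l u : M -> R).
Implicit Types F : cotangent_bundle A -> R.

Lemma dini_le (f : V -> R) q v c c' : c <= c' -> dini f q v c -> dini f q v c'.
Proof.
move=> cc d e e0; apply: filterS2 (nbhs_right_gt 0) (d e e0) => h h0 /le_trans; apply.
by rewrite ler_wpM2l ?(ltW h0) // lerD2r.
Qed.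

Lemma sub_mono F l l' u : (forall x, l x <= l' x) -> sub F l u -> sub F l' u.
Proof.
move=> ll su i; split=> [|q v iq]; first exact: (su i).1.
by apply: dini_le ((su i).2 q v iq); rewrite lerD2l; exact: ll.
Qed.

Lemma near_chart_at x (P : M -> Prop) :
  (\forall q \near chart (chart_at A x) x, P (param (chart_at A x) q)) -> \forall y \near x, P y.
Proof.
move=> h; have ix := dom_chart_at A x.
have := near_chart ix h; apply: filterS2 (near_dom ix) => y iy.
by rewrite chartK.
Qed.

Hypotheses (M_compact : compact [set: M]) (M_connected : connected [set: M]).

Lemma compact_near (I : Type) (FF : set_system I) (P : I -> M -> Prop) : Filter FF ->
  (forall x, \forall y \near x & k \near FF, P k y) -> \forall k \near FF, forall x, P k x.
Proof.
move=> F h; have /compact_near_coveringP := M_compact.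
move=> /(_ I FF P F (fun x _ => h x)); apply: filterS => k hk x; exact: hk.
Qed.

Lemma locally_bounded_compact (B : M -> R -> Prop) :
  (forall x c c', c <= c' -> B x c -> B x c') ->
  (forall x, exists c, \forall y \near x, B y c) -> exists c, forall x, B x c.
Proof.
move=> mono loc.
have : \forall c \near +oo, forall x, B x c.
  apply: (@compact_near R +oo (fun c x => B x c)) => x.
  have [c hc] := loc x.
  by apply: near_prodI hc (nbhs_pinfty_ge (num_real c)) _ => y c' hy cc; exact: mono cc hy.
by move=> /filter_ex[c hc]; exists c.
Qed.

Lemma connected_relation (E : M -> Prop) x0 : E x0 ->
  (forall x, \forall y \near x, E y <-> E x) -> forall x, E x.
Proof.
move=> E0 loc x; suff -> : E = [set: M] by [].
apply: M_connected; first by exists x0.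
- exists E; last by rewrite setTI.
  by rewrite openE => y Ey; apply: filterS (loc y) => z h; exact/h.
- exists E; last by rewrite setTI.
  move=> y clEy; have [z [Ez h]] := clEy _ (loc y).
  exact/h.
Qed.

Section regular.
Variable F : cotangent_bundle A -> R.
Hypothesis regF : regular F.

(** The points whose value relative to x0 is bounded uniformly over the class form an open and
    closed set, by the equi-Lipschitz estimate; compactness then makes the bound uniform in the
    point. *)
Lemma equi_oscillation m : [set: M] !=set0 -> exists C, forall l u, sub F l u ->
  (forall x, l x <= m) -> forall x y, u y - u x <= C.
Proof.
move=> [x0 _].
have loc x : exists C, \forall y \near x, forall l u, sub F l u -> (forall x, l x <= m) ->
    `|u y - u x| <= C.
  have ix := dom_chart_at A x; set i := chart_at A x in ix.
  have [C [r [C0 r0 _ h]]] := sub_equilipschitz regF m (cod_chart ix).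
  exists (C * r); apply: near_chart_at; rewrite -/i.
  apply: filterS (near_dist (chart i x) r0) => q qr l u su lm.
  have c0 : `|chart i x - chart i x| < r by rewrite subrr normr0.
  have h1 := h l u su lm _ _ c0 qr; have h2 := h l u su lm _ _ qr c0.
  rewrite chartK // in h1 h2; rewrite distrC in h2.
  have h3 : C * `|q - chart i x| <= C * r by rewrite ler_wpM2l // ltW.
  by rewrite ler_norml lerNl opprB (le_trans h1 h3) (le_trans h2 h3).
pose E y := exists C, forall l u, sub F l u -> (forall x, l x <= m) -> `|u y - u x0| <= C.
have tri (a b c : R) : `|a - c| <= `|a - b| + `|b - c|.
  have -> : a - c = (a - b) + (b - c) by lra.
  exact: ler_normD.
have allE : forall y, E y.
  apply: (@connected_relation E x0).
    by exists 0 => l u _ _; rewrite subrr normr0.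
  move=> x; have [C hC] := loc x; apply: filterS hC => y hC.
  split=> -[D hD]; exists (C + D) => l u su lm.
    apply: le_trans (tri _ (u y) _) _; rewrite distrC.
    by apply: lerD; [exact: hC su lm|exact: hD su lm].
  apply: le_trans (tri _ (u x) _) _.
  by apply: lerD; [exact: hC su lm|exact: hD su lm].
have [C hC] : exists C, forall y l u, sub F l u -> (forall x, l x <= m) -> `|u y - u x0| <= C.
  apply: (locally_bounded_compact (B := fun y C => forall l u, sub F l u ->
    (forall x, l x <= m) -> `|u y - u x0| <= C)).
    by move=> x c c' cc h l u su lm; exact: le_trans (h l u su lm) cc.
  move=> x; have [C hC] := loc x; have [D hD] := allE x; exists (C + D).
  apply: filterS hC => y hC l u su lm; apply: le_trans (tri _ (u x) _) _.
  by apply: lerD; [exact: hC su lm|exact: hD su lm].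
exists (C + C) => l u su lm x y.
apply: le_trans (ler_norm _) _; apply: le_trans (tri _ (u x0) _) _.
by apply: lerD; [|rewrite distrC]; exact: hC su lm.
Qed.

(** The condition compares two values of u, so the approximating v may depend on the pair of
    points. *)
Lemma sub_closure m u :
  (forall x y e, 0 < e -> exists v : M -> R, sub F (cst (m + e)) v /\ u y - u x <= v y - v x + e) ->
  sub F (cst m) u.
Proof.
move=> h i; split=> [q iq|q v iq e e0].
  have [C [r [C0 r0 _ hL]]] := sub_equilipschitz regF (m + 1) iq.
  apply: local_lipschitz_continuous; apply/local_lipschitzP; exists C, r; split=> // a b ar br.
  apply/ler_addgt0Pr => e e0; have e1 : 0 < Num.min e 1 by rewrite lt_min e0 ltr01.
  have [v [sv uv]] := h (param i a) (param i b) _ e1.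
  have := hL _ v sv (fun _ => _) a b ar br.
  move=> /(_ _) => hv; apply: le_trans uv _; apply: lerD; last by rewrite ge_min lexx.
  by apply: hv => x; rewrite lerD2l ge_min lexx orbT.
have e2 : 0 < e / 2 by rewrite divr_gt0.
have [d d0 dP] := sub_ray regF v iq e2.
apply: filterS2 (nbhs_right_gt 0) (nbhs_right_lt d0) => t t0 td.
have [_ {}dP] := dP t t0 td.
apply/ler_addgt0Pr => b b0; have b1 : 0 < b / (t + 1) by rewrite divr_gt0 // ltr_wpDl // ltW.
have [w [sw uw]] := h (param i q) (param i (q + t *: v)) _ b1.
have := dP _ w (m + b / (t + 1)) sw (fun _ _ => lexx _).
have bE : b = t * (b / (t + 1)) + b / (t + 1) by field; rewrite gt_eqF // ltr_wpDl // ltW.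
have t1 : t * (e / 2) <= t * e by rewrite ler_wpM2l ?(ltW t0) //; lra.
move: uw; rewrite /= !mulrDr; set L := legendre _ _ _; move: (t * L) (t * (e / 2)) (t * e) t1 bE.
by move=> *; lra.
Qed.

(** The gain d is given near each point; compactness yields a common one. *)
Lemma sub_improve m u :
  (forall i q, cod i q -> local_lipschitz (u \o param i) q) ->
  (forall x, exists i d, [/\ dom i x, 0 < d & \forall q \near chart i x, forall v,
     dini (u \o param i) q v (legendre (chart_ham F i) q v + (m - d))]) ->
  exists2 d, 0 < d & sub F (cst (m - d)) u.
Proof.
move=> uL h.
have : \forall d \near (0 : R)^'+, forall x, sub_at F (cst (m - d)) u x.
  apply: compact_near => x; have [i [d [ix d0 hd]]] := h x.
  have := near_chart ix hd; have := near_dom ix => n1 n2.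
  apply: near_prodI (filterI n1 n2) (nbhs_right_lt d0) _ => y d' [iy hy] dd.
  exists i; split=> //; first by apply: uL; exact: cod_chart.
  by move=> v; apply: dini_le (hy v); rewrite lerD2l lerD2l lerN2 ltW.
move=> hn; have [d [hd d0]] := filter_ex (filterI hn (nbhs_right_gt 0)).
by exists d => //; apply: sub_at_all.
Qed.

(** Constants are subsolutions at any level above F on the zero section, by the Fenchel inequality
    at p = 0. *)
Lemma sub_exists : exists a, sub F (cst a) (cst 0).
Proof.
have [a ha] : exists a, forall x, F (x, 0) <= a.
  apply: (locally_bounded_compact (B := fun x a => F (x, 0) <= a)).
    by move=> x c c' cc h; exact: le_trans cc.
  move=> x; have ix := dom_chart_at A x; exists (F (x, 0) + 1); apply: near_chart_at.
  set i := chart_at A x in ix *.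
  have E q : chart_ham F i (q, 0) = F (param i q, 0) by rewrite /chart_ham /= /cotangent_param /= mul0mx.
  have := ham_near_le (regF i) 0 (cod_chart ix) ltr01; apply: filterS => q.
  rewrite -/(chart_ham F i (q, 0)) -/(chart_ham F i (chart i x, 0)) !E chartK // => /ler_normlW.
  by rewrite lerBlDl.
exists a => i; split=> [q _|q v iq e e0]; first exact: (@cst_continuous _ _ (0 : R) q).
apply: filterS (nbhs_right_gt 0) => t t0; rewrite /= subrr mulr_ge0 ?(ltW t0) //.
have := fenchel (regF i) v 0 iq; rewrite pairing0l.
have -> : (F \o cotangent_param i) (q, 0) = F (param i q, 0) by rewrite /= /cotangent_param /= mul0mx.
by rewrite /chart_ham; have := ha (param i q); set L := legendre _ _ _; move: (F _) => *; lra.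
Qed.

Lemma sub_level_ge i q a u : cod i q -> sub F (cst a) u -> - legendre (chart_ham F i) q 0 <= a.
Proof.
move=> iq su; apply/ler_addgt0Pr => e e0.
have := (su i).2 q 0 iq e e0 => hd.
have [t [ht t0]] := filter_ex (filterI hd (nbhs_right_gt 0)).
by move: ht; rewrite scaler0 addr0 subrr pmulr_rge0 // /cst /=; set L := legendre _ _ _; move: L => L *; lra.
Qed.

(** A critical subsolution is obtained as the limit, for e tending to 0, of the upper envelopes
    [U e] of all subsolutions of level [inf S + e], normalized at x0. The envelopes are monotone in
    e, so the limit is an infimum and no sequence has to be extracted. *)
Lemma sub_level_attained : [set: M] !=set0 ->
  exists a, (exists u, sub F (cst a) u) /\ forall b, (exists u, sub F (cst b) u) -> a <= b.
Proof.
move=> [x0 M0]; have ix0 := cod_chart (dom_chart_at A x0).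
pose S := [set a | exists u, sub F (cst a) u].
have S0 : S !=set0 by have [a ha] := sub_exists; exists a, (cst 0).
have Slb : has_lbound S.
  by eexists => a [u]; exact: sub_level_ge ix0.
exists (inf S); split; last by move=> b bS; apply: ge_inf.
have [C hC] := equi_oscillation (inf S + 1) (ex_intro _ x0 M0).
pose Cl e := [set v : M -> R | sub F (cst (inf S + e)) v].
have Cl0 e : 0 < e -> Cl e !=set0.
  move=> e0; have [a [v sv] ae] := inf_adherent e0 (conj S0 Slb).
  by exists v; apply: (@sub_mono F _ (cst (inf S + e)) v _ sv) => x; exact: ltW.
have Clb e (v : M -> R) x y : e <= 1 -> Cl e v -> v y - v x <= C.
  by move=> e1 cv; apply: (hC _ _ cv) => z; rewrite /= lerD2l.
have Clm e e' (v : M -> R) : e <= e' -> Cl e v -> Cl e' v.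
  by move=> ee; apply: (@sub_mono F) => x; rewrite lerD2l.
pose T e x := [set v x - v x0 | v in Cl e].
pose U e x := sup (T e x).
have Tsup e x : 0 < e -> e <= 1 -> has_sup (T e x).
  move=> e0 e1; split; first by have [v cv] := Cl0 e e0; exists (v x - v x0), v.
  by exists C => _ [v cv <-]; exact: Clb cv.
have TU e x (v : M -> R) : 0 < e -> e <= 1 -> Cl e v -> v x - v x0 <= U e x.
  by move=> e0 e1 cv; apply: ub_le_sup; [exact: (Tsup e x e0 e1).2|exists v].
have UM e e' x : 0 < e -> e <= e' -> e' <= 1 -> U e x <= U e' x.
  move=> e0 ee e1; apply: ge_sup; first exact: (Tsup e x e0 (le_trans ee e1)).1.
  by move=> _ [v cv <-]; apply: TU => //; [exact: lt_le_trans ee|exact: Clm cv].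
pose W x := [set U e x | e in [set e : R | 0 < e <= 1]].
have Winf x : has_inf (W x).
  split; first by exists (U 1 x), 1 => //=; rewrite ltr01 lexx.
  exists (- C) => _ [e /andP[e0 e1] <-].
  have [v cv] := Cl0 e e0; apply: le_trans (TU e x v e0 e1 cv).
  by rewrite lerNl opprB; exact: Clb cv.
exists (fun x => inf (W x)); apply: sub_closure => x y e e0.
have e2 : 0 < e / 2 by rewrite divr_gt0.
have [_ [d /andP[d0 d1] <-] hd] := inf_adherent e2 (Winf x).
pose d' := Num.min d (Num.min e 1).
have d'0 : 0 < d' by rewrite !lt_min d0 e0 ltr01.
have d'1 : d' <= 1 by rewrite !ge_min lexx !orbT.
have d'd : d' <= d by rewrite !ge_min lexx.
have d'e : d' <= e by rewrite !ge_min lexx !orbT.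
(* v nearly realizes the envelope of the smaller class at y, while at x it stays below the larger
   envelope [U d x], which is close to the infimum. *)
have [_ [v cv <-] hv] := sup_adherent e2 (Tsup d' y d'0 d'1).
exists v; split; first exact: Clm d'e cv.
have h1 : inf (W y) <= U d' y by apply: ge_inf; [exact: (Winf y).2|exists d' => //=; rewrite d'0].
have h2 := TU d' x v d'0 d'1 cv.
have h3 := UM d' d x d'0 d'd d1.
by move: hd hv h1 h2 h3; rewrite -/(U d' y); move: (U d' y) (U d' x) (U d x) (inf _) (inf _) => *; lra.
Qed.

End regular.
End compact_manifold.

(** * Action of absolutely continuous curves *)

Section gluing_integrals.
Context {R : realType}.
Local Notation mu := (@lebesgue_measure R).

Lemma integrable_minorant_gluing (f : R -> R) (phi : R -> R) (x y z : R) : x <= y -> y <= z ->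
  (exists g : R -> R, [/\ mu.-integrable `[x, y] (EFin \o g),
    forall s, x <= s <= y -> g s <= f s &
    ((phi y - phi x)%:E <= \int[mu]_(s in `[x, y]) (g s)%:E)%E]) ->
  (exists g : R -> R, [/\ mu.-integrable `[y, z] (EFin \o g),
    forall s, y <= s <= z -> g s <= f s &
    ((phi z - phi y)%:E <= \int[mu]_(s in `[y, z]) (g s)%:E)%E]) ->
  exists g : R -> R, [/\ mu.-integrable `[x, z] (EFin \o g),
    forall s, x <= s <= z -> g s <= f s &
    ((phi z - phi x)%:E <= \int[mu]_(s in `[x, z]) (g s)%:E)%E].
Proof.
move=> xy yz [g1 [i1 l1 p1]] [g2 [i2 l2 p2]].
have i1' : mu.-integrable `[x, y[ (EFin \o g1).
  by apply: integrableS i1 => //; exact: subset_itv_co_cc.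
have I1 : mu.-integrable setT ((EFin \o g1) \_ `[x, y[).
  by apply/(integrable_mkcond _ _).1 => //; exact: measurable_itv.
have I2 : mu.-integrable setT ((EFin \o g2) \_ `[y, z]).
  by apply/(integrable_mkcond _ _).1 => //; exact: measurable_itv.
rewrite restrict_EFin in I1; rewrite restrict_EFin in I2.
pose g s := (g1 \_ `[x, y[) s + (g2 \_ `[y, z]) s.
have gE : EFin \o g = (EFin \o (g1 \_ `[x, y[)) \+ (EFin \o (g2 \_ `[y, z])) by [].
have ig : mu.-integrable setT (EFin \o g) by rewrite gE; exact: integrableD.
exists g; split.
- exact: integrableS ig.
- move=> s /andP[xs sz]; rewrite /g !patchE; have [sy|ys] := ltP s y.
    rewrite mem_set ?memNset ?addr0 /= ?in_itv /= ?xs //; last by rewrite leNgt sy.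
    by apply: l1; rewrite xs ltW.
  rewrite memNset ?mem_set ?add0r /= ?in_itv /= ?ys //; last by rewrite ltNge ys andbF.
  by apply: l2; rewrite ys.
rewrite integral_mkcond.
have -> : ((fun s => (g s)%:E) \_ `[x, z])%classic = EFin \o g.
  apply/funext => s; rewrite patchE; case: ifPn => //= /negP sn; rewrite /g !patchE.
  rewrite !memNset ?addr0 //= => h; apply: sn; apply/mem_set; move: h; rewrite /= !in_itv /= => /andP[a b].
    by rewrite b (le_trans xy).
  by rewrite a (le_trans (ltW b)).
rewrite gE integralD // -!restrict_EFin -!integral_mkcond integral_itv_bndo_bndc; last first.
  by have /integrableP[] := i1'.
apply: le_trans (leeD p1 p2); rewrite -EFinD lee_fin; lra.
Qed.

End gluing_integrals.

Section action.
Context {R : realType} {n : nat} {M : topologicalType} {A : c2atlas R n M}.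
Local Notation V := 'rV[R]_n.
Local Notation mu := (@lebesgue_measure R).
Implicit Types (i j : chart_index A) (x y : M) (q p v : V) (l u : M -> R).
Variable F : cotangent_bundle A -> R.
Hypothesis regF : regular F.

Lemma convex_ball (a b : V) (t r : R) : 0 <= t -> t <= 1 -> `|a| < r -> `|b| < r ->
  `|(1 - t) *: a + t *: b| < r.
Proof.
move=> t0 t1 ar br; apply: le_lt_trans (ler_normD _ _) _.
rewrite !normrZ (ger0_norm t0) ger0_norm ?subr_ge0 //.
have [t00|t0'] := eqVneq t 0; first by rewrite t00 mul0r addr0 subr0 mul1r.
have tp : 0 < t by rewrite lt_def t0'.
have : t * `|b| < t * r by rewrite ltr_pM2l.
have : (1 - t) * `|a| <= (1 - t) * r by rewrite ler_wpM2l ?subr_ge0 // ltW.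
by move=> h1 h2; lra.
Qed.

Lemma lipschitz_abs_continuous (a b C : R) (f : R -> V) :
  (forall s t, a <= s -> s <= t -> t <= b -> `|f t - f s| <= C * (t - s)) ->
  abs_continuous a b f.
Proof.
move=> fL e e0; have C1 : 0 < `|C| + 1 by rewrite ltr_wpDl.
exists (e / (`|C| + 1)) => [|m s t st _]; first exact: divr_gt0.
rewrite ltr_pdivlMr // => h; apply: le_lt_trans h; rewrite mulr_suml ler_sum // => k _.
have [as_ [st_ tb]] := st k; apply: le_trans (fL _ _ as_ st_ tb) _.
rewrite [leRHS]mulrC ler_wpM2r ?subr_ge0 // ler_wpDr //; exact: ler_norm.
Qed.

(** Makes the segments of a chart admissible curves, since absolute continuity is required in every
    chart. The derivative of the transition map is continuous, which gives local Lipschitz bounds,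
    chained by [interval_gluing]. *)
Lemma transition_line i j q v (a b : R) : a <= b ->
  (forall r, a <= r <= b -> cod i (q + r *: v) /\ dom j (param i (q + r *: v))) ->
  exists C : R, forall s t, a <= s -> s <= t -> t <= b ->
    `|transition i j (q + t *: v) - transition i j (q + s *: v)| <= C * (t - s).
Proof.
move=> ab h; set T := transition i j.
suff [C [C0 hC]] : exists C : R, 0 <= C /\ forall s t, a <= s -> s <= t -> t <= b ->
    `|T (q + t *: v) - T (q + s *: v)| <= C * (t - s) by exists C.
apply: (@interval_gluing _ (fun a b => exists C : R, 0 <= C /\
  forall s t, a <= s -> s <= t -> t <= b ->
    `|T (q + t *: v) - T (q + s *: v)| <= C * (t - s))) => //.
  move=> x y z _ xy yz _ [C [C0 hC]] [D [D0 hD]]; exists (C + D); split=> [|s t xs st tz].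
    exact: addr_ge0.
  have [ty|yt] := lerP t y.
    by apply: le_trans (hC s t xs st ty) _; rewrite ler_wpM2r ?subr_ge0 // lerDl.
  have [ys|sy] := lerP y s.
    by apply: le_trans (hD s t ys st tz) _; rewrite ler_wpM2r ?subr_ge0 // lerDr.
  have -> : T (q + t *: v) - T (q + s *: v) =
      (T (q + t *: v) - T (q + y *: v)) + (T (q + y *: v) - T (q + s *: v)).
    by rewrite addrA subrK.
  apply: le_trans (ler_normD _ _) _.
  have h1 := hC s y xs (ltW sy) (lexx _); have h2 := hD y t (lexx _) (ltW yt) tz.
  apply: le_trans (lerD h2 h1) _.
  have h3 : D * (t - y) <= D * (t - s) by rewrite ler_wpM2l // lerD2l lerN2 ltW.
  have h4 : C * (y - s) <= C * (t - s) by rewrite ler_wpM2l // lerD2r ltW.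
  by rewrite mulrDl [X in _ <= X]addrC; exact: lerD.
move=> s0 /h [iq jq].
have oq : (chart i @` (dom i `&` dom j)) (q + s0 *: v) by apply/overlapP.
have [Td /(_ v)[Tv _]] := transition_C2 (c := A) i j.
have cT : {for q + s0 *: v, continuous ('D_v T)} by apply: differentiable_continuous; exact: Tv.
have bT : \forall y \near q + s0 *: v, `|'D_v T y| <= `|'D_v T (q + s0 *: v)| + 1.
  have /continuous_ptP /(_ 1 ltr01) := cT; apply: filterS => y hy.
  by rewrite -lerBlDl; apply: le_trans hy; exact: lerB_dist.
have [d d0 hd] := near_norm (filterI (open_nbhs_nbhs (conj (@open_overlap _ _ _ A i j) oq)) bT).
have v1 : 0 < `|v| + 1 by rewrite ltr_wpDl.
exists (d / (`|v| + 1)) => [|x y ax xs sy yb]; first exact: divr_gt0.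
rewrite ltr_pdivlMr // => xyd.
exists (`|'D_v T (q + s0 *: v)| + 1); split=> [|s t xs' st ty]; first by rewrite addr_ge0.
have inB (r : R) : x <= r <= y -> `|(q + r *: v) - (q + s0 *: v)| < d.
  move=> /andP[xr ry]; rewrite opprD addrACA subrr add0r -scalerBl normrZ.
  apply: le_lt_trans xyd; have rs : `|r - s0| <= y - x.
    by rewrite ler_norml; apply/andP; split; lra.
  by apply: ler_pM; rewrite ?lerDl.
have dT r : x <= r <= y -> derivable (fun s : R => T (q + s *: v)) r 1.
  by move=> /inB/hd[oT _]; rewrite derivable_line; apply: diff_derivable; exact: Td.
apply: norm_rV_le => [|k]; first by rewrite mulr_ge0 ?subr_ge0 // addr_ge0.
have stx r : s <= r <= t -> x <= r <= y.
  by move=> /andP[sr rt]; rewrite (le_trans xs' sr) (le_trans rt ty).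
have [||c] := @MVT_segment R (fun s => T (q + s *: v) 0 k)
    (fun s => ('D_v T (q + s *: v)) 0 k) s t st.
- move=> r; rewrite in_itv /= => /andP[sr rt].
  have xr : x <= r <= y by apply: stx; rewrite !ltW.
  have /derivable_mxP/(_ 0 k) dk := dT r xr.
  have Em := etrans (esym (derive_line T q v r)) (derive_mx (dT r xr)).
  have E : ('D_v T (q + r *: v)) 0 k = 'D_1 (fun s : R => T (q + s *: v) 0 k) r.
    by rewrite Em mxE.
  by rewrite E; exact: derivableP.
- apply: derivable_within_continuous => r; rewrite in_itv /= => /stx/dT/derivable_mxP; exact.
rewrite in_itv /= => /stx/inB/hd[_ bc] E.
rewrite !mxE E normrM (ger0_norm (_ : 0 <= t - s)) ?subr_ge0 //.
rewrite ler_wpM2r ?subr_ge0 //; exact: le_trans (norm_coord _ _) bc.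
Qed.

Lemma velocity_line i q v (s : R) : cod i (q + s *: v) ->
  velocity A (fun r => param i (q + r *: v)) s = tangent_param i (q + s *: v) v.
Proof.
move=> iq; rewrite /velocity derive1E.
set e := chart_at A (param i (q + s *: v)).
rewrite (derive_line (transition i e)) /tangent_param /to_preferred.
by apply: deriveEjacobian; apply: transition_differentiable => //; exact: dom_chart_at.
Qed.

(** The segment competes in the infimum defining [subsolution]; its action is compared with the
    integral of the constant c by [le_integral_nonmeasurable]. *)
Lemma subsolution_segment a u i q v (h c : R) : subsolution a F u -> 0 < h ->
  (forall r, 0 <= r <= h -> cod i (q + r *: v)) ->
  (forall r, 0 <= r <= h -> legendre (chart_ham F i) (q + r *: v) v <= c) ->
  u (param i (q + h *: v)) - u (param i q) <= h * (c + a).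
Proof.
move=> su h0 hi hc; pose gam r := param i (q + r *: v).
have gam0 : gam 0 = param i q by rewrite /gam scale0r addr0.
have ac : abs_continuous_curve A h gam.
  split.
    apply: continuous_in_subspaceT => r /set_mem; rewrite /= in_itv /= => rh.
    have c1 : {for (r : R), continuous (fun r : R => q + r *: v)}.
      by apply: cvgD; [exact: cvg_cst|apply: cvgZr_tmp; exact: cvg_id].
    exact: (continuous_comp c1 (param_continuous (hi r rh))).
  move=> j b d b0 bd dh gd.
  have [C hC] : exists C : R, forall s t, b <= s -> s <= t -> t <= d ->
    `|transition i j (q + t *: v) - transition i j (q + s *: v)| <= C * (t - s).
    apply: transition_line => // r /andP[br rd].
    have rh : 0 <= r <= h by rewrite (le_trans b0 br) (le_trans rd dh).
    split; first exact: hi.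
    by apply: gd; exists r => //; rewrite /= in_itv /= br rd.
  exact: lipschitz_abs_continuous hC.
have := su (gam 0) (gam h) h (ltW h0).
rewrite -gam0 -lee_fin => /le_trans; apply.
rewrite mulrDr EFinD; apply: leeD => //.
apply: (@le_trans _ _ (action F h gam)); first by apply: ereal_inf_lbound; exists gam.
rewrite /action; apply: (@le_trans _ _ (\int[mu]_(s in `[0%R, h]) (c%:E))%E).
  apply: le_integral_nonmeasurable => s; rewrite /= in_itv /= => sh; rewrite lee_fin.
  apply: le_trans (hc s sh); rewrite /chart_ham (legendre_lagrangian F v (hi s sh)).
  by rewrite -(velocity_line (hi s sh)).
rewrite integral_cst //= lebesgue_measure_itv /= lte_fin h0 oppr0 adde0 -EFinM mulrC.
by rewrite lexx.
Qed.

Lemma subsolution_sub a u : subsolution a F u -> sub F (cst a) u.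
Proof.
move=> su i; split=> [q iq|q v iq e e0].
  have [c hc] := legendre_near_bound (regF i) 1 iq.
  have [r r0 hr] := near_norm (filterI (near_cod iq) hc).
  apply: local_lipschitz_continuous; apply/local_lipschitzP.
  exists `|c + a|, r; split=> // x y xr yr.
  have [->|xy] := eqVneq y x; first by rewrite !subrr normr0 mulr0.
  have d0 : 0 < `|y - x| by rewrite normr_gt0 subr_eq0.
  have yE : y = x + `|y - x| *: (`|y - x|^-1 *: (y - x)).
    by rewrite scalerA divff ?gt_eqF // scale1r addrC subrK.
  have seg (s : R) : 0 <= s <= `|y - x| -> `|x + s *: (`|y - x|^-1 *: (y - x)) - q| < r.
    move=> /andP[s0 s1]; set t := s / `|y - x|.
    have t0 : 0 <= t by rewrite divr_ge0.
    have t1 : t <= 1 by rewrite ler_pdivrMr // mul1r.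
    have -> : x + s *: (`|y - x|^-1 *: (y - x)) - q = (1 - t) *: (x - q) + t *: (y - q).
      rewrite scalerA -/t.
      have -> : y - q = (y - x) + (x - q) by rewrite addrA subrK.
      by rewrite [t *: (_ + (x - q))]scalerDr addrCA -scalerDl subrK scale1r [RHS]addrA [_ + x]addrC.
    exact: convex_ball.
  have := @subsolution_segment a u i x (`|y - x|^-1 *: (y - x)) `|y - x| c su d0 _ _.
  rewrite -yE => hs; apply: le_trans (hs _ _) _.
  - by move=> s sh; have [] := hr _ (seg s sh).
  - move=> s sh; have [_] := hr _ (seg s sh); apply.
    by rewrite normrZ normrV ?unitfE ?gt_eqF // normr_id mulVf ?gt_eqF.
  by rewrite mulrC ler_wpM2r // ler_norm.
have cL := @legendre_continuous R n _ _ _ _ (regF i) q v iq.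
have : legendre (chart_ham F i) q v < legendre (chart_ham F i) q v + e by rewrite ltrDl.
move=> /(continuous_near_lt cL) /near_pair1 nL.
have [d d0 dP] := near_norm (filterI (near_cod iq) nL).
have v1 : 0 < `|v| + 1 by rewrite ltr_wpDl.
apply: filterS2 (nbhs_right_gt 0) (nbhs_right_lt (divr_gt0 d0 v1)) => h h0 hd.
have near0 r : 0 <= r <= h -> `|q + r *: v - q| < d.
  move=> /andP[r0 rh]; rewrite addrC addKr normrZ ger0_norm //.
  apply: le_lt_trans (_ : r * (`|v| + 1) < d).
    by rewrite ler_wpM2l // lerDl.
  by rewrite -ltr_pdivlMr // (le_lt_trans rh).
have := @subsolution_segment a u i q v h (legendre (chart_ham F i) q v + e) su h0 _ _.
rewrite addrAC => hs; apply: hs => r rh.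
  by have [] := dP _ (near0 _ rh).
by have [_ /ltW] := dP _ (near0 _ rh).
Qed.

End action.

Section action_lower_bound.
Context {R : realType} {n : nat} {M : topologicalType} {A : c2atlas R n M}.
Local Notation V := 'rV[R]_n.
Local Notation mu := (@lebesgue_measure R).
Implicit Types (i j : chart_index A) (x y : M) (q p v : V) (l u : M -> R).
Variable F : cotangent_bundle A -> R.
Hypothesis regF : regular F.

Lemma lagrangian_near_ge x : exists C : R, \forall y \near x, forall v, C <= lagrangian F y v.
Proof.
have ix := dom_chart_at A x; set i := chart_at A x in ix.
have ci := cod_chart ix.
exists (- (chart_ham F i (chart i x, 0) + 1)); apply: near_chart_at; rewrite -/i.
apply: filterS2 (near_cod ci) (ham_near_le (regF i) 0 ci ltr01) => q iq /ler_normlW h v.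
have vE : v = tangent_param i q (v *m from_preferred i q).
  by rewrite /tangent_param -mulmxA (from_to_preferred iq) mulmx1.
rewrite vE -legendre_lagrangian //.
have := fenchel (regF i) (v *m from_preferred i q) 0 iq; rewrite pairing0l => h2.
by rewrite lerNl; move: h h2; rewrite /chart_ham; move: (legendre _ _ _) ((_ \o _) (q, 0)) ((_ \o _) (chart i x, 0)) => *; lra.
Qed.

Lemma velocity_chart (gam : R -> M) i (s : R) : (\forall r \near s, dom i (gam r)) ->
  derivable (chart i \o gam) s 1 ->
  velocity A gam s = tangent_param i (chart i (gam s)) ('D_1 (chart i \o gam) s).
Proof.
move=> ni dc; have ix := nbhs_singleton ni; set c := chart i \o gam in dc *.
have gs : param i (chart i (gam s)) = gam s by exact: chartK.
rewrite /velocity derive1E /tangent_param /to_preferred gs.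
set e := chart_at A (gam s).
have dcs : differentiable c s by apply/derivable1_diffP.
have dT : differentiable (transition i e) (c s).
  apply: transition_differentiable; first exact: cod_chart.
  by rewrite /c /= gs; exact: dom_chart_at.
have ne : \forall r \near s, (chart e \o gam) r = (transition i e \o c) r.
  by apply: filterS ni => r ir; rewrite /c /transition /= chartK.
rewrite (near_eq_derive _ ne) (deriveE _ (differentiable_comp dcs dT)) diff_comp //.
rewrite /= (diffEjacobian _ dT); congr (_ *m _); exact/esym/deriveE.
Qed.

(** The curve is tangent to its velocity at s, so [dini_curve] bounds the right increments of
    [u \o gam] by the Legendre transform, which is the Lagrangian read in the chart. *)
Lemma derive_le_lagrangian a u (gam : R -> M) i (s d : R) : sub F (cst a) u ->
  (\forall r \near s, dom i (gam r)) -> derivable (chart i \o gam) s 1 ->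
  is_derive s 1 (u \o gam) d -> d <= lagrangian F (gam s) (velocity A gam s) + a.
Proof.
move=> su ni dc dd; have ix := nbhs_singleton ni; set c := chart i \o gam in dc *.
have gs : param i (chart i (gam s)) = gam s by exact: chartK.
rewrite (velocity_chart ni dc) -/c.
have <- : legendre (chart_ham F i) (c s) ('D_1 c s) =
    lagrangian F (gam s) (tangent_param i (chart i (gam s)) ('D_1 c s)).
  by rewrite /chart_ham legendre_lagrangian ?gs //; exact: cod_chart.
have [C lu] := sub_lipschitz regF su (fun _ => lexx a) (cod_chart ix).
have dcs : differentiable c s by apply/derivable1_diffP.
have cv e : 0 < e -> \forall h \near (0 : R)^'+, `|c (s + h) - c s - h *: 'D_1 c s| <= h * e.
  move=> e0; have := differentiable_curve (1 : R) dcs e0; apply: filterS => h.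
  by rewrite -[h *: 1]/(h * 1) mulr1.
have c0 : c (s + 0) = c s by rewrite addr0.
have du := (su i).2 (c s) ('D_1 c s) (cod_chart ix).
have ng : \forall h \near (0 : R)^'+, dom i (gam (s + h)).
  have [r r0 hr] := near_norm ni.
  apply: filterS2 (nbhs_right_gt 0) (nbhs_right_lt r0) => h h0 hrr; apply: hr.
  by rewrite addrC addKr gtr0_norm.
have dus : differentiable (u \o gam) s by apply/derivable1_diffP; exact: ex_derive.
apply/ler_addgt0Pr => e e0; have e2 : 0 < e / 2 by rewrite divr_gt0.
have D := @dini_curve _ _ _ (fun h => c (s + h)) _ ('D_1 c s) C _ lu c0 cv du (e / 2) e2.
have := differentiable_curve (1 : R) dus e2; rewrite derive_val => D2.
have [r1 r10 hr1] := near_right0 D; have [r2 r20 hr2] := near_right0 D2.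
have [r3 r30 hr3] := near_right0 ng.
pose h := Num.min r1 (Num.min r2 r3) / 2.
have m0 : 0 < Num.min r1 (Num.min r2 r3) by rewrite !lt_min r10 r20.
have h0 : 0 < h by rewrite divr_gt0.
have : h < Num.min r1 (Num.min r2 r3) by rewrite ltr_pdivrMr // ltr_pMr // ltr1n.
rewrite !lt_min => /and3P[hh1 hh2 hh3].
have h1 := hr1 h h0 hh1; have h2 := hr2 h h0 hh2; have h3 := hr3 h h0 hh3.
move: h1 h2; rewrite /= gs chartK // -[h *: 1]/(h * 1) mulr1 distrC => h1 /ler_normlW.
rewrite -[h *: d]/(h * d) => h2; rewrite -(ler_pM2l h0); move: h1 h2; rewrite /cst.
by move: (u _) (u _) (legendre _ _ _) => *; lra.
Qed.

(** In charts u is locally Lipschitz, so u along the curve is absolutely continuous; its increments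
    are integrals of its derivative, which is almost everywhere at most the Lagrangian plus a. What
    is glued over [[0, t]] is an integrable minorant of that integrand. *)
Lemma sub_subsolution a u : sub F (cst a) u -> subsolution a F u.
Proof.
move=> su x y t t0; rewrite -leeBlDr //; apply: le_ereal_inf_tmp => _ [gam [[cg ac] g0 gt] <-].
rewrite leeBlDr //; pose f s := lagrangian F (gam s) (velocity A gam s) + a.
pose Q (x1 y1 : R) := exists g : R -> R, [/\ mu.-integrable `[x1, y1] (EFin \o g),
    forall s, x1 <= s <= y1 -> g s <= f s &
    (((u \o gam) y1 - (u \o gam) x1)%:E <= \int[mu]_(s in `[x1, y1]) (g s)%:E)%E].
have [g [ig gf pg]] : Q 0 t.
  apply: (interval_gluing t0) => [x1 y1 z1 _ xy yz _|s0 s0t].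
    exact: integrable_minorant_gluing.
  have ix := dom_chart_at A (gam s0); set i := chart_at A (gam s0) in ix.
  have ci := cod_chart ix.
  have /local_lipschitzP[C [r [C0 r0 hL]]] := sub_lipschitz regF su (fun _ => lexx a) ci.
  have [m hm] := lagrangian_near_ge (gam s0).
  have ng : \forall z \near gam s0, [/\ dom i z, `|chart i z - chart i (gam s0)| < r &
      forall v, m <= lagrangian F z v].
    have n1 := near_chart ix (near_dist (chart i (gam s0)) r0).
    by apply: filterS3 (near_dom ix) n1 hm => z ? ? ?; split.
  have s0I : `[0, t]%classic s0 by rewrite /= in_itv.
  have nt : \forall s \near s0, `[0, t]%classic s -> [/\ dom i (gam s),
      `|chart i (gam s) - chart i (gam s0)| < r & forall v, m <= lagrangian F (gam s) v].
    exact: ((subspace_continuousP _ _).1 cg s0 s0I _ ng).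
  have [d d0 hd] := near_norm nt.
  exists d => // x1 y1 x0 xs sy yt xyd.
  have good s : x1 <= s <= y1 -> [/\ dom i (gam s), `|chart i (gam s) - chart i (gam s0)| < r &
      forall v, m <= lagrangian F (gam s) v].
    move=> /andP[xs' sy']; apply: hd; last by rewrite /= in_itv /= (le_trans x0 xs') (le_trans sy' yt).
    by rewrite ltr_norml; apply/andP; split; lra.
  have xy := le_trans xs sy.
  have acc : abs_continuous x1 y1 (chart i \o gam).
    apply: (ac i x1 y1 x0 xy yt) => z [s /= sI <-].
    by move: sI; rewrite in_itv /= => /good[].
  apply: (acontinuous_le_integrable (C := m + a)) => //.
  - apply: (abs_continuous_acontinuous (C := C) _ acc) => s1 s2 xs1 s12 s2y.
    have sI1 : x1 <= s1 <= y1 by rewrite xs1 (le_trans s12).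
    have sI2 : x1 <= s2 <= y1 by rewrite s2y (le_trans xs1).
    have [d1 n1 _] := good s1 sI1; have [d2 n2 _] := good s2 sI2.
    have h1 := hL _ _ n1 n2; have h2 := hL _ _ n2 n1.
    move: h1 h2; rewrite /= !chartK // => h1 h2.
    by rewrite ler_norml h1 lerNl opprB distrC h2.
  - by move=> s /good[_ _ h]; rewrite /f lerD2r.
  move: xy; rewrite le_eqVlt => /orP[/eqP ->|xy].
    by apply: aeW => s /andP[h1 h2]; have := lt_trans h1 h2; rewrite ltxx.
  pose Pk (k : 'I_n) (s : R) := x1 < s < y1 -> derivable (fun s => (chart i \o gam) s 0 k) s 1.
  (* Almost everywhere differentiability of the curve in the chart is obtained coordinate by
     coordinate. *)
  have ae1 k : {ae mu, forall s, Pk k s}.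
    have ack : acontinuous x1 y1 (fun s => (chart i \o gam) s 0 k).
      apply: (abs_continuous_acontinuous (C := 1) _ acc) => s1 s2 _ _ _.
      by rewrite mul1r; have := norm_coord ((chart i \o gam) s2 - (chart i \o gam) s1) k; rewrite !mxE.
    have [g' [_ dg _]] := acontinuous_FTC xy ack.
    by apply: (@filterS _ _ (ae_filter_ringOfSetsType mu) _ _ _ dg) => s h /h[dk _]; exact: dk.
  have aek := @filter_forall _ _ Pk _ (ae_filter_ringOfSetsType mu) ae1.
  apply: (@filterS _ _ (ae_filter_ringOfSetsType mu) _ _ _ aek) => s hs sI d' dd'.
  apply: (@derive_le_lagrangian a u gam i s d' su _ _ dd').
    have := @near_in_itvoo R x1 y1 s; rewrite in_itv /= => /(_ sI).
    apply: filterS => r'; rewrite in_itv /= => /andP[h1 h2].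
    have rI : x1 <= r' <= y1 by rewrite !ltW.
    by have [] := good r' rI.
  apply/derivable_mxP => a' k; rewrite (ord1 a'); exact: hs.
have ia : mu.-integrable `[0, t] (cst (- a)%:E).
  apply: (continuous_compact_integrable (f := cst (- a))); first exact: segment_compact.
  by apply: continuous_subspaceT => z; exact: cvg_cst.
have : ((u y - u x)%:E + (- (t * a))%:E <= action F t gam)%E.
  apply: (@le_trans _ _ (\int[mu]_(s in `[0%R, t]) ((g s)%:E + (- a)%:E))%E); last first.
    apply: le_integral_nonmeasurable => s; rewrite /= in_itv /= => /gf.
    by rewrite -EFinD lee_fin /f => h; lra.
  rewrite integralD //; apply: leeD.
    by move: pg; rewrite /= g0 gt.
  rewrite integral_cst //= lebesgue_measure_itv /= lte_fin.
  case: ltP => h; first by rewrite oppr0 adde0 -EFinM lee_fin mulNr mulrC.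
  have -> : t = 0 by apply/eqP; rewrite eq_le h t0.
  by rewrite mule0 mul0r oppr0.
by rewrite EFinN leeBlDr.
Qed.

End action_lower_bound.

(** * The discounted equation *)

Section perron.
Context {R : realType} {n : nat} {M : topologicalType} {A : c2atlas R n M}.
Local Notation V := 'rV[R]_n.
Implicit Types (i j : chart_index A) (x y : M) (q p v : V) (u w : M -> R).
Implicit Types F G H : cotangent_bundle A -> R.
Hypotheses (M_compact : compact [set: M]) (M_hausdorff : hausdorff_space M).

(** If the least level not below a at which f is a subsolution of G exceeded a, [doubling_local]
    would lower it near each point and, by compactness, everywhere. *)
Lemma doubling_global G H (lam a m : R) (f w : M -> R) : regular G -> regular H ->
  commuting G H -> 0 < lam ->
  sub H (fun x => - (lam * (f x - w x))) f ->
  (forall i q p, cod i q -> subdiff (f \o param i) q p ->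
     - (lam * (f (param i q) - w (param i q))) <= chart_ham H i (q, p)) ->
  sub G (cst a) w -> sub G (cst m) f -> sub G (cst a) f.
Proof.
move=> regG regH br lam0 subf superf subw subm.
pose S := [set b | a <= b /\ sub G (cst b) f].
have S0 : S !=set0.
  exists (Num.max a m); split; first by rewrite le_max lexx.
  by apply: (@sub_mono _ _ _ _ G _ (cst (Num.max a m)) f _ subm) => x; rewrite le_max lexx orbT.
have Sb : has_lbound S by exists a => b [].
have infS : S (inf S).
  split; first by apply: lb_le_inf => // b [].
  apply: (sub_closure regG) => x y e e0; exists f; split; last by rewrite lerDl ltW.
  have [b [_ sb] be] := inf_adherent e0 (conj S0 Sb).
  by apply: (@sub_mono _ _ _ _ G _ (cst (inf S + e)) f _ sb) => z; exact: ltW.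
have [aS sS] := infS; move: aS; rewrite le_eqVlt => /orP[/eqP ->//|aS].
have fL i q : cod i q -> local_lipschitz (f \o param i) q.
  exact: (sub_lipschitz regG sS (fun _ => lexx _)).
have [|d d0 sd] := @sub_improve _ _ _ _ M_compact G (inf S) f fL.
  move=> x; have ix := dom_chart_at A x; set i := chart_at A x in ix.
  have [d [r [d0 r0 hd]]] := doubling_local (regG i) (regH i) (br i) lam0 aS (cod_chart ix)
    (subf i) (fun q p iq => @superf i q p iq) (subw i) (sS i).
  exists i, d; split=> //; apply: filterS (near_dist (chart i x) r0) => q; exact: hd.
have : S (Num.max a (inf S - d)).
  split; first by rewrite le_max lexx.
  apply: (@sub_mono _ _ _ _ G _ (cst (Num.max a (inf S - d))) f _ sd) => x.
  by rewrite le_max lexx orbT.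
move=> /(ge_inf Sb); rewrite le_max leNgt aS /= => h.
by move: h; rewrite lerBrDr gerDl leNgt d0.
Qed.

Lemma dini_max (f g : V -> R) q v c : {for q, continuous f} -> {for q, continuous g} ->
  (g q <= f q -> dini f q v c) -> (f q <= g q -> dini g q v c) ->
  dini (fun y : V => Num.max (f y) (g y)) q v c.
Proof.
move=> cf cg df dg.
have cd (f1 f2 : V -> R) : {for q, continuous f1} -> {for q, continuous f2} -> f1 q < f2 q ->
    \forall y \near q, f1 y < f2 y.
  move=> c1 c2 h; have h1 : f1 q < (f1 q + f2 q) / 2 by lra.
  have h2 : (f1 q + f2 q) / 2 < f2 q by lra.
  by apply: filterS2 (continuous_near_lt c1 h1) (continuous_near_gt c2 h2) => y; exact: lt_trans.
move=> e e0; case: (ltgtP (f q) (g q)) => h.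
- apply: filterS2 (near_ray v (cd _ _ cf cg h)) (dg (ltW h) e e0) => t h1.
  by move=> h2; rewrite (max_r (ltW h1)).
- apply: filterS2 (near_ray v (cd _ _ cg cf h)) (df (ltW h) e e0) => t h1.
  by move=> h2; rewrite (max_l (ltW h1)).
have h1 : g q <= f q by rewrite h.
have h2 : f q <= g q by rewrite h.
apply: filterS2 (df h1 e e0) (dg h2 e e0) => t a b.
case: (leP (f (q + t *: v)) (g (q + t *: v))) => _; [by rewrite h|exact: a].
Qed.

Lemma local_lipschitz_max (f g : V -> R) q : local_lipschitz f q -> local_lipschitz g q ->
  local_lipschitz (fun y : V => Num.max (f y) (g y)) q.
Proof.
move=> /local_lipschitzP[C [r [C0 r0 hf]]] /local_lipschitzP[D [s [D0 s0 hg]]].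
apply/local_lipschitzP; exists (C + D), (Num.min r s).
split=> [||x y]; rewrite ?addr_ge0 ?lt_min ?r0 // => /andP[xr xs] /andP[yr ys].
have := hf x y xr yr; have := hg x y xs ys => h1 h2.
have a1 : f x <= Num.max (f x) (g x) by rewrite le_max lexx.
have a2 : g x <= Num.max (f x) (g x) by rewrite le_max lexx orbT.
have n0 : 0 <= `|y - x| by [].
have c1 : 0 <= C * `|y - x| by exact: mulr_ge0.
have c2 : 0 <= D * `|y - x| by exact: mulr_ge0.
rewrite lerBlDr mulrDl ge_max; apply/andP; split; lra.
Qed.

Lemma sub_at_eq F (l l' u : M -> R) x : l x = l' x -> sub_at F l u x -> sub_at F l' u x.
Proof. by move=> ll [i [ix lu du]]; exists i; split=> // v; rewrite -ll. Qed.

Lemma sub_level_nonneg F (l u : M -> R) i q : cod i q -> sub F l u ->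
  0 <= legendre (chart_ham F i) q 0 + l (param i q).
Proof.
move=> iq su; apply/ler_addgt0Pr => e e0.
have hd := (su i).2 q 0 iq e e0.
have [t [ht t0]] := filter_ex (filterI hd (nbhs_right_gt 0)).
by move: ht; rewrite scaler0 addr0 subrr pmulr_rge0.
Qed.

Lemma near_dist_ray q v (P : V -> Prop) : (\forall y \near q, P y) ->
  exists2 d, 0 < d & forall h : R, h < d -> forall r, 0 <= r <= h -> P (q + r *: v).
Proof.
move=> /near_norm[d d0 hd]; have v1 : 0 < `|v| + 1 by rewrite ltr_wpDl.
exists (d / (`|v| + 1)) => [|h hdh r /andP[r0 rh]]; first exact: divr_gt0.
apply: hd; rewrite addrC addKr normrZ ger0_norm //.
apply: le_lt_trans (_ : r * (`|v| + 1) < d); first by rewrite ler_wpM2l // lerDl.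
by rewrite -ltr_pdivlMr // (le_lt_trans rh).
Qed.

Fact bump_arith (b w1 w0 d u0 r e : R) : 0 < e -> b <= e / 2 -> - (e / 2) <= w1 - w0 -> 0 <= d ->
  r <= e -> - (u0 - w0) - 2 * e <= - (u0 + r / 2 + b - d - w1).
Proof. lra. Qed.

Fact bump_diff (c a b k l : R) : c + a - k - (c + b - l) = a - b + (l - k).
Proof. ring. Qed.

(** Along v the cone has slope at most [pairing p v] plus kap |v|. For the maximum norm this is the
    pairing of v with p plus or minus kap times a coordinate covector, a momentum at which K is at
    most b. *)
Lemma bump (p q0 : V) (kap c : R) (q v : V) (K : V * V -> R) (b : R) : 0 < kap ->
  (forall p', pairing p' v <= legendre K q v + K (q, p')) ->
  (forall p', `|p' - p| <= kap -> K (q, p') <= b) ->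
  dini (fun y : V => c + pairing p (y - q0) - kap * `|y - q0|) q v (legendre K q v + b).
Proof.
move=> k0 fen Kb.
have main : pairing p v + kap * `|v| <= legendre K q v + b.
  have h0 : pairing p v <= legendre K q v + b.
    by apply: le_trans (fen p) _; rewrite lerD2l; apply: Kb; rewrite subrr normr0 ltW.
  rewrite -lerBrDl mulrC -ler_pdivlMr //; apply: norm_rV_le => [|k].
    by rewrite divr_ge0 ?(ltW k0) // subr_ge0.
  rewrite ler_pdivlMr //.
  have hs (s : R) : `|s| = 1 -> s * v ord0 k * kap <= legendre K q v + b - pairing p v.
    move=> s1; rewrite lerBrDl.
    have -> : pairing p v + s * v ord0 k * kap = pairing (p + (s * kap) *: delta_mx 0 k) v.
      by rewrite pairingDl pairingZl [pairing (delta_mx _ _) v]pairingC pairing_delta mulrAC.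
    apply: le_trans (fen _) _; rewrite lerD2l; apply: Kb.
    rewrite addrC addKr normrZ normrM s1 mul1r gtr0_norm //.
    rewrite -[leRHS]mulr1 ler_wpM2l ?(ltW k0) //.
    by apply: norm_rV_le => // l; rewrite mxE; case: (_ && _); rewrite ?normr1 ?normr0.
  have := hs 1 (normr1 _); have := hs (-1); rewrite normrN normr1 => /(_ erefl).
  have [vk|vk] := lerP 0 (v ord0 k) => a1 a2; [rewrite ger0_norm //|rewrite ltr0_norm //]; lra.
move=> e e0; apply: filterS (nbhs_right_gt 0) => h h0.
have tri : `|q - q0| <= `|q + h *: v - q0| + h * `|v|.
  have -> : q - q0 = (q + h *: v - q0) - h *: v by rewrite [RHS]addrAC addrK.
  by apply: le_trans (ler_normB _ _) _; rewrite normrZ gtr0_norm.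
have k1 := ler_wpM2l (ltW k0) tri.
have -> : pairing p (q + h *: v - q0) = pairing p (q - q0) + h * pairing p v.
  have -> : q + h *: v - q0 = (q - q0) + h *: v by rewrite addrAC.
  by rewrite pairingDr pairingZr.
have he : 0 <= h * e by rewrite mulr_ge0 ?ltW.
have hm := ler_wpM2l (ltW h0) main.
move: k1 hm he; rewrite !mulrDr [kap * (h * _)]mulrCA.
by move: (kap * `|q + h *: v - q0|) (kap * `|q - q0|) (h * (kap * `|v|)) (h * pairing p v) (h * legendre K q v) (h * b) (h * e) (pairing p (q - q0)) => *; lra.
Qed.

Section discounted.
Variables (H : cotangent_bundle A -> R) (lam m : R) (w v0 : M -> R).
Hypotheses (regH : regular H) (lam0 : 0 < lam) (cw : continuous w).
Let rhs (v : M -> R) x := - (lam * (v x - w x)).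
Hypotheses (sub_v0 : sub H (rhs v0) v0) (v0_le : forall x, rhs v0 x <= m).

(** Staying above v0 keeps the level [rhs v] of every member at most m, which makes the class
    equi-Lipschitz. *)
Definition perron_class := [set v : M -> R | sub H (rhs v) v /\ forall x, v0 x <= v x].
Definition perron_sup x := sup [set v x | v in perron_class].
Local Notation Cl := perron_class.
Local Notation u := perron_sup.

Lemma perron_rhs_le (v : M -> R) x : Cl v -> rhs v x <= m.
Proof.
move=> [_ vv]; apply: le_trans (v0_le x); rewrite /rhs lerN2 ler_wpM2l ?(ltW lam0) //.
by rewrite lerD2r.
Qed.

(** Testing a subsolution with velocity 0 bounds [lam * (v x - w x)] by a Legendre transform that
    does not depend on v. *)
Lemma perron_has_sup x : has_sup [set v x | v in Cl].
Proof.
split; first by exists (v0 x), v0 => //; split=> // y; exact: lexx.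
have ix := cod_chart (dom_chart_at A x); set i := chart_at A x in ix.
exists (w x + legendre (chart_ham H i) (chart i x) 0 / lam) => _ [v [sv _] <-].
have := sub_level_nonneg ix sv; rewrite chartK; last exact: dom_chart_at.
rewrite /rhs.
by move=> h; rewrite -lerBlDl ler_pdivlMr // mulrC -subr_ge0.
Qed.

Lemma perron_le (v : M -> R) x : Cl v -> v x <= u x.
Proof. by move=> cv; apply: ub_le_sup; [exact: (perron_has_sup x).2|exists v]. Qed.

Lemma perron_sup_le x c : (forall v : M -> R, Cl v -> v x <= c) -> u x <= c.
Proof. by move=> h; apply: ge_sup; [exact: (perron_has_sup x).1|move=> _ [v cv <-]; exact: h]. Qed.

Lemma perron_equilipschitz i q : cod i q -> exists C r, [/\ 0 <= C, 0 < r &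
  forall v : M -> R, v = u \/ Cl v -> forall x y : V, `|x - q| < r -> `|y - q| < r ->
    v (param i y) - v (param i x) <= C * `|y - x|].
Proof.
move=> iq; have [C [r [C0 r0 _ hL]]] := sub_equilipschitz regH m iq.
exists C, r; split=> // v vv x y xr yr.
have hC (v' : M -> R) : Cl v' -> v' (param i y) - v' (param i x) <= C * `|y - x|.
  by move=> cv; apply: (hL _ v' cv.1) => // z; exact: perron_rhs_le.
case: vv => [->|]; last exact: hC.
rewrite lerBlDr; apply: perron_sup_le => v' cv.
have := hC v' cv; rewrite lerBlDr => /le_trans; apply.
by rewrite lerD2l; exact: perron_le.
Qed.

Lemma perron_lipschitz i q : cod i q -> local_lipschitz (u \o param i) q.
Proof.
move=> iq; have [C [r [C0 r0 hL]]] := perron_equilipschitz iq.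
by apply/local_lipschitzP; exists C, r; split=> // x y; apply: hL; left.
Qed.

Lemma perron_sub : sub H (rhs u) u.
Proof.
move=> i; split=> [q iq|q v iq e e0].
  exact/local_lipschitz_continuous/perron_lipschitz.
have e3 : 0 < e / 2 by rewrite divr_gt0.
have et : 0 < e / 4 / lam by rewrite !divr_gt0.
have [C [r [C0 r0 hL]]] := perron_equilipschitz iq.
have C1 : 0 < C + 1 by rewrite ltr_wpDl.
have cwi : {for q, continuous (w \o param i)}.
  by apply: continuous_comp; [exact: param_continuous iq|exact: cw].
have n1 : \forall y \near q, `|y - q| < r /\ C * `|y - q| <= e / 4 / lam.
  apply: filterS2 (near_dist q r0) (near_dist q (divr_gt0 et C1)) => y h1 h2; split=> //.
  apply: le_trans (_ : (C + 1) * `|y - q| <= _); first by rewrite ler_wpM2r // lerDl.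
  by rewrite mulrC -ler_pdivlMr // ltW.
have [d1 d10 h1] := near_dist_ray v (filterI n1 ((continuous_ptP _ _).1 cwi _ et)).
have [d2 d20 h2] := sub_ray regH v iq e3.
have l10 : 0 < lam^-1 by rewrite invr_gt0.
have dm : 0 < Num.min d1 (Num.min d2 lam^-1) by rewrite !lt_min d10 d20.
apply: filterS2 (nbhs_right_gt 0) (nbhs_right_lt dm) => h h0.
rewrite !lt_min => /and3P[hd1 hd2 hl].
rewrite lerBlDr; apply: perron_sup_le => v' cv.
have [_ /(_ (rhs v') v' (rhs v' (param i q) + e / 2) cv.1)] := h2 h h0 hd2.
have rr s : 0 <= s <= h -> rhs v' (param i (q + s *: v)) <= rhs v' (param i q) + e / 2.
  move=> sh; have [[a1 a2] a3] := h1 h hd1 s sh.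
  have q0 : `|q - q| < r by rewrite subrr normr0.
  have := hL v' (or_intror cv) _ _ a1 q0; rewrite distrC => a4.
  have a5 := le_trans a4 a2; move: a3 => /ler_normlW /= a6.
  have a7 : lam * (e / 4 / lam) = e / 4 by rewrite mulrC divfK ?gt_eqF.
  have := ler_wpM2l (ltW lam0) a5; have := ler_wpM2l (ltW lam0) a6.
  rewrite a7 /rhs; move: (w _) (w _) (v' _) (v' _) => *; lra.
move=> /(_ rr) hv.
(* Replacing v' by the larger u lowers the level by lam times their difference. For [h * lam <= 1]
   the loss over time h is covered by the gain in the value at q. *)
have hl1 : h * lam <= 1 by rewrite -ler_pdivlMr // mul1r ltW.
have hu := perron_le (param i q) cv.
have hh : h * lam * (u (param i q) - v' (param i q)) <= 1 * (u (param i q) - v' (param i q)).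
  by rewrite ler_wpM2r // subr_ge0.
move: hv hh; rewrite /rhs /=.
by move: (legendre _ _ _) (u _) (v' _) (w _) (v' _) => *; nra.
Qed.

Lemma perron_ge x : v0 x <= u x.
Proof. by apply: perron_le; split=> // y; exact: lexx. Qed.

Lemma perron_sup_rhs_le x : rhs u x <= m.
Proof.
apply: le_trans (v0_le x); rewrite /rhs lerN2 ler_wpM2l ?(ltW lam0) // lerD2r.
exact: perron_ge.
Qed.

(* If the supremum were not a supersolution at q0, a cone with vertex above it
   could be glued in, giving a larger element of the class. *)
Lemma perron_super i q0 p : cod i q0 -> subdiff (u \o param i) q0 p ->
  rhs u (param i q0) <= chart_ham H i (q0, p).
Proof.
move=> iq0 sd; rewrite leNgt; apply/negP => gap.
set x0 := param i q0 in gap *; set K := chart_ham H i in gap *.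
have [eps eps0 Kgap] : exists2 eps, 0 < eps & K (q0, p) < rhs u x0 - 2 * eps.
  by exists ((rhs u x0 - K (q0, p)) / 3); lra.
have cK : {for (q0, p) : V * V, continuous K} := @ham_continuous _ _ _ _ _ _ (regH i) (q0, p) iq0.
have [dK dK0 hK] := near_norm (continuous_near_lt cK Kgap).
have [kap k0 kapd] : exists2 kap : R, 0 < kap & kap < dK by exists (dK / 2); lra.
have e0 : 0 < eps / 2 / lam by rewrite !divr_gt0.
have cwi : {for q0, continuous (w \o param i)}.
  by apply: continuous_comp; [exact: param_continuous iq0|exact: cw].
have n1 : \forall y \near q0, [/\ cod i y, `|y - q0| < dK &
    n%:R * (`|p| * `|y - q0|) <= eps / 2 / lam].
  have c1 : 0 < n%:R * `|p| + 1 by rewrite ltr_wpDl // mulr_ge0.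
  apply: filterS3 (near_cod iq0) (near_dist q0 dK0) (near_dist q0 (divr_gt0 e0 c1)) => y h1 h2 h3.
  split=> //; rewrite mulrA; apply: le_trans (_ : (n%:R * `|p| + 1) * `|y - q0| <= _).
    by rewrite ler_wpM2r // lerDl.
  by rewrite mulrC -ler_pdivlMr // ltW.
have k4 : 0 < kap / 4 by rewrite divr_gt0.
have [r1 r10 hr1] := near_norm (filterI n1 (filterI (sd _ k4) ((continuous_ptP _ _).1 cwi _ e0))).
have [r [r0 rr1 rk]] : exists r, [/\ 0 < r, r < r1 & lam * (kap * r) <= eps].
  have ek : 0 < eps / lam / kap by rewrite !divr_gt0.
  exists (Num.min (r1 / 2) (eps / lam / kap)); split.
  - by rewrite lt_min ek andbT divr_gt0.
  - by apply: le_lt_trans (_ : r1 / 2 < _); rewrite ?ge_min ?lexx //; lra.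
  apply: (@le_trans _ _ (lam * (kap * (eps / lam / kap)))).
    by rewrite !ler_pM2l // ge_min lexx orbT.
  by rewrite [kap * _]mulrC divfK ?gt_eqF // mulrC divfK ?gt_eqF.
(* The vertex is kap r / 2 above u. As u lies above the cone with the same linear part and slope kap
   / 4, phi is below u once [|q - q0| >= 3 / 4 * r]: the drop 3/4 kap |q - q0| is then at least 9/16
   kap r. *)
pose phi (q : V) := u x0 + kap * r / 2 + pairing p (q - q0) - kap * `|q - q0|.
pose B := [set x | exists q : V, `|q - q0| < r /\ x = param i q].
pose U x := if x \in B then Num.max (u x) (phi (chart i x)) else u x.
have good q : `|q - q0| <= r -> [/\ cod i q, `|q - q0| < dK,
    n%:R * (`|p| * `|q - q0|) <= eps / 2 / lam,
    pairing p (q - q0) - kap / 4 * `|q - q0| <= u (param i q) - u x0 &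
    `|w (param i q) - w x0| <= eps / 2 / lam].
  by move=> /le_lt_trans/(_ rr1)/hr1[[a b c] [d e]].
have UB q : `|q - q0| < r -> U (param i q) = Num.max (u (param i q)) (phi q).
  move=> qr; have [iq _ _ _ _] := good q (ltW qr).
  by rewrite /U mem_set ?paramK //; exists q.
have U_ge x : u x <= U x by rewrite /U; case: ifP => // _; rewrite le_max lexx.
have phi_le q : 3 / 4 * r <= `|q - q0| -> `|q - q0| <= r -> phi q <= u (param i q).
  move=> q1 q2; have [_ _ _ h _] := good q q2; rewrite /phi.
  have := ler_wpM2l (ltW k0) q1; have : 0 < kap * r by rewrite mulr_gt0.
  move: h; rewrite mulrCA [kap / 4 * _]mulrAC.
  move: (kap * `|_|) (kap * r) (pairing _ _) (u _) (u _) => *; lra.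
have phi_rhs q : `|q - q0| < r -> forall p', `|p' - p| <= kap ->
    K (q, p') <= - (lam * (phi q - w (param i q))).
  move=> qr p' pp; have [_ h1 h2 _ h3] := good q (ltW qr).
  have Kl : K (q, p') < rhs u x0 - 2 * eps.
    apply: hK; rewrite [X in X < _](_ : _ = Num.max `|q - q0| `|p' - p|) // gt_max h1 /=.
    exact: le_lt_trans pp kapd.
  apply: le_trans (ltW Kl) _; rewrite /phi /rhs.
  have h4 := pairing_le p (q - q0); have h5 : 0 <= kap * `|q - q0| by rewrite mulr_ge0 // ltW.
  have ee : lam * (eps / 2 / lam) = eps / 2 by rewrite mulrC divfK ?gt_eqF.
  have h6 := ler_wpM2l (ltW lam0) (le_trans h4 h2).
  move: h3; rewrite ler_norml => /andP[h3 _]; have h7 := ler_wpM2l (ltW lam0) h3.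
  have h8 := ler_wpM2l (ltW lam0) h5.
  rewrite mulrN ee in h7; rewrite ee in h6; rewrite mulr0 in h8.
  move: h6 h7 h8 rk; rewrite !mulrBr !mulrDr [lam * (kap * r / 2)]mulrA.
  exact: bump_arith.
have U_cl : Cl U.
  split; last by move=> x; apply: le_trans (U_ge x); apply: perron_le; split=> // y; exact: lexx.
  apply: sub_at_all => x; have [xB|xB] := pselect (exists q : V, `|q - q0| < r /\ x = param i q).
    have [q [qr xE]] := xB; have [iq _ _ _ _] := good q (ltW qr).
    have nr : \forall y \near q, `|y - q0| < r.
      have qr' : 0 < r - `|q - q0| by rewrite subr_gt0.
      apply: filterS (near_dist q qr') => y; rewrite ltrBrDr; apply: le_lt_trans.
      by have -> : y - q0 = (y - q) + (q - q0); [rewrite addrA subrK|exact: ler_normD].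
    have nU : \forall y \near q, Num.max ((u \o param i) y) (phi y) = (U \o param i) y.
      by apply: filterS nr => y /UB /= ->.
    have phiL : local_lipschitz phi q.
      apply/local_lipschitzP; exists (n%:R * `|p| + kap), 1; split=> // [|a b _ _].
        by rewrite addr_ge0 ?mulr_ge0 // ltW.
      have h1 := pairing_le p (b - a).
      have -> : phi b - phi a = pairing p (b - a) + kap * (`|a - q0| - `|b - q0|).
        have -> : b - a = (b - q0) - (a - q0) by rewrite opprB addrA subrK.
        by rewrite pairingBr mulrBr; exact: bump_diff.
      rewrite mulrDl; apply: lerD; first by rewrite -mulrA.
      rewrite ler_wpM2l ?(ltW k0) //; apply: le_trans (lerB_dist _ _) _.
      by rewrite opprB addrA subrK distrC.
    have uL := perron_lipschitz iq.
    have xi : chart i x = q by rewrite xE paramK.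
    exists i; rewrite xi; split; first by rewrite xE; exact: dom_param.
      have [C [[P Q] /= [nP nQ] PQ]] := local_lipschitz_max uL phiL.
      exists C; exists (P `&` [set y | Num.max ((u \o param i) y) (phi y) = (U \o param i) y],
        Q `&` [set y | Num.max ((u \o param i) y) (phi y) = (U \o param i) y]).
        by split; exact: filterI.
      by move=> [a b] /= [[Pa ea] [Qb eb]]; rewrite -ea -eb; apply: (PQ (a, b)).
    move=> v e e1.
    have Ux : U x = Num.max (u x) (phi q) by rewrite xE UB.
    have D : dini (fun y : V => Num.max ((u \o param i) y) (phi y)) q v
        (legendre K q v + rhs U x).
      apply: dini_max; [exact: local_lipschitz_continuous|exact: local_lipschitz_continuous| |].
        move=> le_phi; have := (perron_sub i).2 q v iq; apply: dini_le.
        have -> : (rhs u \o param i) q = rhs u x by rewrite xE.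
        by rewrite lerD2l /rhs Ux max_l // xE.
      move=> le_u; have := @bump p q0 kap (u x0 + kap * r / 2) q v K _ k0 _ (phi_rhs q qr).
      move=> D; apply: dini_le (D _); last by move=> p'; exact: (fenchel (regH i)).
      by rewrite lerD2l /rhs Ux max_r ?xE.
    apply: filterS2 (near_ray v nU) (D e e1) => t.
    by rewrite (nbhs_singleton nU) => ->.
  (* Outside the image of the ball of radius 3 / 4 * r, a compact set which is closed because M is
     Hausdorff, U coincides with u. *)
  pose Kc := param i @` [set q : V | `|q - q0| <= 3 / 4 * r].
  have Kcc : compact Kc.
    apply: continuous_compact; last exact: compact_ball_rV.
    apply: continuous_in_subspaceT => q /set_mem /= qr.
    have qr' : `|q - q0| <= r by apply: le_trans qr _; lra.
    by have [iq _ _ _ _] := good q qr'; exact: (param_continuous iq).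
  have Kcl : open (~` Kc) by rewrite openC; exact: compact_closed.
  have xK : (~` Kc) x.
    move=> [q /= qr qx]; apply: xB; exists q; split; last by [].
    by apply: le_lt_trans qr _; lra.
  have nU : \forall y \near x, u y = U y.
    apply: filterS (open_nbhs_nbhs (conj Kcl xK)) => y yK.
    rewrite /U; case: ifPn => // /set_mem[q [qr yE]].
    have [iq _ _ _ _] := good q (ltW qr).
    rewrite yE paramK // max_l //; apply: phi_le; last exact: ltW.
    by rewrite leNgt; apply/negP => h; apply: yK; exists q => //=; exact: ltW.
  apply: (sub_at_near nU); apply: (@sub_at_eq H (rhs u)).
    by rewrite /rhs (nbhs_singleton nU).
  exact: (@sub_sub_at _ _ _ _ H regH (rhs u) u m x perron_sub perron_sup_rhs_le).
have q00 : `|q0 - q0| < r by rewrite subrr normr0.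
have := perron_le x0 U_cl; rewrite /x0 UB // leNgt => /negP; apply.
rewrite lt_max; apply/orP; right.
rewrite /phi subrr normr0 pairing0r mulr0 subr0 addr0 ltrDl divr_gt0 //.
by rewrite mulr_gt0.
Qed.

End discounted.
End perron.

(** * Approximate weak KAM solutions *)

Section weak_kam.
Context {R : realType} {n : nat} {M : topologicalType} {A : c2atlas R n M}.
Local Notation V := 'rV[R]_n.
Implicit Types (i j : chart_index A) (x y : M) (q p v : V) (u w : M -> R).
Hypotheses (M_compact : compact [set: M]) (M_hausdorff : hausdorff_space M)
  (M_connected : connected [set: M]) (M_nonempty : [set: M] !=set0).
Variables G H : cotangent_bundle A -> R.
Hypotheses (regG : regular G) (regH : regular H) (brGH : commuting G H).

(** A Lipschitz constant k is absorbed by the superlinear growth of the Legendre transform. This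
    gives the a priori level that [doubling_global] lowers to a. *)
Lemma lipschitz_sub u : (forall i q, cod i q -> local_lipschitz (u \o param i) q) ->
  exists m, sub G (cst m) u.
Proof.
move=> uL; suff [m hm] : exists m, forall x, sub_at G (cst m) u x by exists m; exact: sub_at_all.
apply: (locally_bounded_compact M_compact (B := fun x m => sub_at G (cst m) u x)).
  move=> x c c' cc [i [ix lu du]]; exists i; split=> // v.
  by apply: dini_le (du v); rewrite lerD2l.
move=> x; have ix := dom_chart_at A x; set i := chart_at A x in ix.
have /local_lipschitzP[k [r [k0 r0 hk]]] := uL i _ (cod_chart ix).
have [C hC] := legendre_superlinear (regG i) k (cod_chart ix).
exists C; apply: near_chart_at; rewrite -/i.
apply: filterS3 (near_cod (cod_chart ix)) (near_dist (chart i x) r0) hC => q iq qr hq.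
exists i; split; [exact: dom_param|by apply: uL; rewrite paramK|move=> v e e0].
rewrite paramK //.
have qr' : 0 < r - `|q - chart i x| by rewrite subr_gt0.
have nr : \forall y \near q, `|y - chart i x| < r.
  apply: filterS (near_dist q qr') => y; rewrite ltrBrDr; apply: le_lt_trans.
  by have -> : y - chart i x = (y - q) + (q - chart i x); [rewrite addrA subrK|exact: ler_normD].
apply: filterS2 (nbhs_right_gt 0) (near_ray v nr) => h h0 hr.
apply: le_trans (hk _ _ qr hr) _.
rewrite addrC addKr normrZ gtr0_norm // mulrCA ler_wpM2l ?(ltW h0) //.
by apply: le_trans (_ : legendre (chart_ham G i) q v + C <= _); [rewrite -lerBlDr; exact: hq|rewrite lerDl ltW].
Qed.

Lemma sub_shift (F : cotangent_bundle A -> R) (l u : M -> R) c : sub F l u -> sub F l (fun x => u x - c).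
Proof.
move=> su i; split=> [q iq|q v iq e e0].
  apply/continuous_ptP => e e0; have /continuous_ptP/(_ e e0) := (su i).1 q iq.
  by apply: filterS => y /=; rewrite opprB addrA subrK.
apply: filterS ((su i).2 q v iq e e0) => h /=.
by rewrite opprB addrA subrK.
Qed.

(* Solutions of the discounted equation of H around a subsolution w of G stay
   subsolutions of G; their oscillation is then bounded independently of the
   discount, which makes the discounted term almost constant. *)
Lemma approximate_weak_kam a h (e : R) : (exists w, sub G (cst a) w) ->
  (exists u, sub H (cst h) u) -> (forall b, (exists u, sub H (cst b) u) -> h <= b) -> 0 < e ->
  exists u, [/\ sub G (cst a) u, sub H (cst (h + e)) u &
    forall i q p, cod i q -> subdiff (u \o param i) q p -> h - e <= chart_ham H i (q, p)].
Proof.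
move=> [w sw] [psi spsi] crit e0.
have [C hC] := equi_oscillation M_compact M_connected regG a M_nonempty.
have [D hD] := equi_oscillation M_compact M_connected regH h M_nonempty.
have {}hC u : sub G (cst a) u -> forall x y, u y - u x <= C by move=> su; apply: hC su _ => x.
have {}hD u : sub H (cst h) u -> forall x y, u y - u x <= D by move=> su; apply: hD su _ => x.
have [x0 _] := M_nonempty.
have C0 : 0 <= C by have := hC w sw x0 x0; rewrite subrr.
have D0 : 0 <= D by have := hD psi spsi x0 x0; rewrite subrr.
(* lam is chosen so that lam times twice the oscillation bound B is e; the 1 in B keeps it
   positive. *)
pose B := C + D + 1; have B0 : 0 < B by rewrite ltr_wpDl // addr_ge0.
pose lam := e / (2 * B); have lam0 : 0 < lam by rewrite divr_gt0 // mulr_gt0.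
have lB : 2 * (lam * B) = e by rewrite /lam; field; rewrite gt_eqF.
(* This shift of psi places its discounted term between h and h + e. The first bound makes [v0] a
   subsolution from which Perron's method can start, the second bounds the levels of the whole
   class. *)
pose K := psi x0 - w x0 + (C + D) + h / lam.
pose v0 x := psi x - K.
pose rhs (v : M -> R) x := - (lam * (v x - w x)).
have lh : lam * (h / lam) = h by rewrite mulrC divfK ?gt_eqF.
have rhsE x : rhs v0 x = lam * ((psi x0 - psi x) + (w x - w x0) + (C + D)) + h.
  by rewrite -[X in _ = _ + X]lh /rhs /v0 /K; ring.
have bnd x : - (C + D) <= (psi x0 - psi x) + (w x - w x0) <= C + D.
  have := hC w sw x0 x; have := hC w sw x x0; have := hD psi spsi x0 x; have := hD psi spsi x x0.
  by move=> *; apply/andP; split; lra.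
have v0_ge x : h <= rhs v0 x.
  rewrite rhsE lerDr mulr_ge0 ?(ltW lam0) //; have /andP[b _] := bnd x.
  by rewrite -lerBlDr sub0r.
have v0_le x : rhs v0 x <= h + e.
  rewrite rhsE addrC lerD2l -lB mulrCA ler_wpM2l ?(ltW lam0) //.
  by have /andP[_ b] := bnd x; rewrite /B; lra.
have sv0 : sub H (rhs v0) v0.
  by apply: (sub_shift K); apply: (@sub_mono _ _ _ _ H (cst h)).
have cw : continuous w by exact: sub_continuous sw.
have su := perron_sub regH lam0 cw sv0 v0_le.
have super := perron_super M_hausdorff regH lam0 cw sv0 v0_le.
have ule := perron_sup_rhs_le lam0 sv0 v0_le.
set u := perron_sup H lam w v0 in su super ule.
have [m um] : exists m, sub G (cst m) u.
  by apply: lipschitz_sub => i q iq; exact: (@sub_lipschitz _ _ _ _ H regH _ u (h + e) i q su ule iq).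
have uG : sub G (cst a) u.
  exact: (@doubling_global _ _ _ _ M_compact G H lam a m u w regG regH brGH lam0 su super sw um).
have osc x y : rhs u y - rhs u x <= e.
  have h1 := hC u uG y x; have h2 := hC w sw x y.
  have -> : rhs u y - rhs u x = lam * ((u x - u y) + (w y - w x)) by rewrite /rhs; ring.
  rewrite -lB mulrCA ler_wpM2l ?(ltW lam0) // /B; lra.
exists u; split=> //.
  by apply: (@sub_mono _ _ _ _ H (rhs u)).
move=> i q p iq sd; apply: le_trans (super i q p iq sd).
(* By minimality of h the discounted term of u cannot be below h everywhere; as it oscillates by at
   most e, it is at least h - e at each point. *)
rewrite lerBlDr; apply: crit; exists u.
apply: (@sub_mono _ _ _ _ H (rhs u) _ u _ su) => x.
by rewrite addrC -lerBlDr; exact: osc.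
Qed.

End weak_kam.

(** * Averages of subsolutions *)

Section inf_convolution.
Context {R : realType} {n : nat}.
Local Notation V := 'rV[R]_n.
Implicit Types (q p v x y : V) (f : V -> R).

(** The Moreau envelope, with the infimum restricted to a part B of the chart, a closed ball in all
    uses. *)
Definition inf_convolution f (B : set V) (tau : R) x :=
  inf [set f y + pairing (x - y) (x - y) / (2 * tau) | y in B].

Lemma pairing_sqrD (x y : V) :
  pairing (x + y) (x + y) = pairing x x + 2 * pairing x y + pairing y y.
Proof. by rewrite pairingDl !pairingDr [pairing y x]pairingC; ring. Qed.

Lemma continuous_add_div (T : topologicalType) (f g : T -> R) (x : T) c :
  {for x, continuous f} -> {for x, continuous g} -> {for x, continuous (fun y : T => f y + g y / c)}.
Proof. by move=> cf cg; apply: cvgD; [exact: cf|apply: cvgM; [exact: cg|exact: cvg_cst]]. Qed.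

(** A minimizer y satisfies [|x - y| <= 2 * tau * C], so the condition on tau keeps it in the open
    ball of radius 3 / 4 * r. There (x - y) / tau is both a subdifferential of f at y and the slope
    at x of a paraboloid above the envelope, a semiconcavity that f itself may lack. *)
Lemma inf_convolutionP f q0 (r C tau : R) x : 0 < tau -> 0 <= C -> 2 * tau * C < r / 4 ->
  (forall x y, `|x - q0| < r -> `|y - q0| < r -> f y - f x <= C * `|y - x|) ->
  `|x - q0| < r / 2 ->
  let F := inf_convolution f [set y : V | `|y - q0| <= 3 / 4 * r] tau in
  exists y p, [/\ `|y - q0| < r, subdiff f y p, `|p| <= 2 * C,
    f x - C * (2 * tau * C) <= F x <= f x &
    forall x', F x' <= F x + pairing p (x' - x) + pairing (x' - x) (x' - x) / (2 * tau)].
Proof.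
move=> t0 C0 tC fL xr F; have r0 : 0 < r.
  by have : 0 <= `|x - q0| by []; lra.
set B := [set y : V | `|y - q0| <= 3 / 4 * r] in F *.
have t2 : 0 < 2 * tau by rewrite mulr_gt0.
pose Phi x y := f y + pairing (x - y) (x - y) / (2 * tau).
have Br y : B y -> `|y - q0| < r by rewrite /B /=; lra.
have fc y : `|y - q0| < r -> {for y, continuous f}.
  move=> yr; apply/continuous_ptP => e e0.
  have yr' : 0 < r - `|y - q0| by rewrite subr_gt0.
  have C1 : 0 < C + 1 by rewrite ltr_wpDl.
  apply: filterS2 (near_dist y yr') (near_dist y (divr_gt0 e0 C1)) => z z1 z2.
  have zr : `|z - q0| < r.
    move: z1; rewrite ltrBrDr; apply: le_lt_trans.
    by have -> : z - q0 = (z - y) + (y - q0); [rewrite addrA subrK|exact: ler_normD].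
  have h1 := fL y z yr zr; have h2 := fL z y zr yr; rewrite distrC in h2.
  have h3 : C * `|z - y| <= e.
    apply: le_trans (_ : (C + 1) * `|z - y| <= _); first by rewrite ler_wpM2r // lerDl.
    by rewrite mulrC -ler_pdivlMr // ltW.
  by rewrite ler_norml lerNl opprB (le_trans h1 h3) (le_trans h2 h3).
have Phic z y : `|y - q0| < r -> {for y, continuous (Phi z)}.
  move=> yr.
  have c1 : {for y, continuous (fun y : V => z - y)}.
    apply/continuous_ptP => e e0; apply: filterS (near_dist y e0) => y' /ltW.
    have -> : z - y' - (z - y) = y - y' by rewrite opprB addrC addrA subrK.
    by rewrite distrC.
  have c3 : {for y, continuous (fun y : V => pairing (z - y) (z - y))}.
    by apply: (@cvg_pairing _ _ _ (nbhs y) _ (fun y : V => z - y) (fun y : V => z - y)); exact: c1.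
  exact: (@continuous_add_div _ f (fun y : V => pairing (z - y) (z - y)) y (2 * tau) (fc y yr) c3).
have Bc : compact B by exact: compact_ball_rV.
have xB : B x by rewrite /B /=; lra.
have cPhi z : {within B, continuous (Phi z)}.
  by apply: continuous_in_subspaceT => y /set_mem /Br; exact: Phic.
have mins z : exists2 y, B y & forall y', B y' -> Phi z y <= Phi z y'.
  have B0 : B !=set0 by exists x.
  have [y yB ymin] := @compact_EVT_min _ _ (Phi z) B B0 Bc (cPhi z).
  by exists y; [exact: set_mem|move=> y' yB'; apply: ymin; exact: mem_set].
have FE z y : B y -> (forall y', B y' -> Phi z y <= Phi z y') -> F z = Phi z y.
  move=> yB ymin; apply/eqP; rewrite eq_le; apply/andP; split.
    by apply: ge_inf; [exists (Phi z y) => _ [y' yB' <-]; exact: ymin|exists y].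
  by apply: lb_le_inf; [exists (Phi z y), y|move=> _ [y' yB' <-]; exact: ymin].
have Fle z y : B y -> F z <= Phi z y.
  move=> yB; have [y' yB' ymin] := mins z.
  by rewrite (FE z y' yB' ymin); exact: ymin.
have [y yB ymin] := mins x; have Fx := FE x y yB ymin.
have Phixx : Phi x x = f x by rewrite /Phi subrr pairing0l mul0r addr0.
have yr := Br y yB.
have xr' : `|x - q0| < r by lra.
have sq := pairing_sqr_ge (x - y).
have hm : pairing (x - y) (x - y) <= 2 * tau * (C * `|x - y|).
  have h1 : Phi x y <= f x by rewrite -Phixx; exact: ymin.
  have h2 := fL y x yr xr'.
  by rewrite mulrC -ler_pdivrMr //; move: h1; rewrite /Phi; lra.
have xy : `|x - y| <= 2 * tau * C.
  have [->|n0] := eqVneq `|x - y| 0; first by rewrite mulr_ge0 // ltW.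
  have np : 0 < `|x - y| by rewrite lt_def n0 /=.
  rewrite -(ler_pM2r np) -expr2; apply: le_trans (le_trans sq hm) _.
  by rewrite mulrA.
have yr34 : `|y - q0| < 3 / 4 * r.
  have : `|y - q0| <= `|x - y| + `|x - q0|.
    have -> : y - q0 = (x - q0) - (x - y) by rewrite opprB [RHS]addrC addrA subrK.
    by rewrite [leRHS]addrC; exact: ler_normB.
  by lra.
exists y, (tau^-1 *: (x - y)); split=> //.
- move=> e e0.
  have n1 : 0 < n%:R / (2 * tau) + 1 by rewrite ltr_wpDl // divr_ge0 // ltW.
  have yr' : 0 < 3 / 4 * r - `|y - q0| by rewrite subr_gt0.
  apply: filterS2 (near_dist y yr') (near_dist y (divr_gt0 e0 n1)) => z z1 z2.
  have zB : B z.
    rewrite /B /=; apply: ltW; move: z1; rewrite ltrBrDr; apply: le_lt_trans.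
    by have -> : z - q0 = (z - y) + (y - q0); [rewrite addrA subrK|exact: ler_normD].
  have := ymin z zB; rewrite /Phi.
  have -> : x - z = (x - y) + (y - z) by rewrite addrA subrK.
  rewrite [pairing (x - y + _) _]pairing_sqrD pairingZl.
  have -> : y - z = - (z - y) by rewrite opprB.
  rewrite pairingNr [pairing (- _) (- _)]pairingNl pairingNr opprK.
  have h1 : pairing (z - y) (z - y) / (2 * tau) <= e * `|z - y|.
    rewrite ler_pdivrMr //; apply: le_trans (pairing_le _ _) _.
    rewrite mulrA [leRHS]mulrAC ler_wpM2r //.
    have : `|z - y| * (n%:R / (2 * tau) + 1) <= e by rewrite -ler_pdivlMr // ltW.
    move=> h; have h' : `|z - y| * (n%:R / (2 * tau)) <= e.
      by apply: le_trans h; rewrite ler_wpM2l // lerDl.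
    have := ler_wpM2r (ltW t2) h'; rewrite -mulrA divfK ?gt_eqF // mulrC //.
  have E : 2 * - pairing (x - y) (z - y) / (2 * tau) = - (tau^-1 * pairing (x - y) (z - y)).
    by field; rewrite gt_eqF.
  have E2 (a b c k : R) : (a + b + c) / k = a / k + b / k + c / k by rewrite !mulrDl.
  rewrite E2 E => h2; move: h1 h2.
  move: (pairing (x - y) (x - y) / _) (pairing (z - y) (z - y) / _) (tau^-1 * _) (e * _) => *; lra.
- rewrite normrZ gtr0_norm ?invr_gt0 // mulrC ler_pdivrMr //.
  by apply: le_trans xy _; rewrite mulrAC.
- rewrite Fx -Phixx ymin // andbT Phixx /Phi.
  have h1 := fL y x yr xr'; have h2 : C * `|x - y| <= C * (2 * tau * C) by rewrite ler_wpM2l.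
  have h3 : 0 <= pairing (x - y) (x - y) / (2 * tau).
    by rewrite divr_ge0 ?(ltW t2) // (le_trans _ sq) // sqr_ge0.
  by lra.
move=> x'; apply: le_trans (Fle x' y yB) _; rewrite Fx /Phi.
have -> : x' - y = (x - y) + (x' - x) by rewrite [RHS]addrC addrA subrK.
rewrite pairing_sqrD pairingZl le_eqVlt; apply/orP; left; apply/eqP.
by field; rewrite gt_eqF.
Qed.

(** At a given x, f0 and f1 need not both have subdifferentials, hence a hypothesis on three
    distinct nearby points. The envelopes have at each x upper slopes taken from subdifferentials of
    f0 and f1 nearby. K is at most m at the mean slope, so the Fenchel inequality bounds the growth
    of the mean of the envelopes along v, and the error of the envelopes is arbitrarily small. *)
Lemma local_average (U : set V) (K : V * V -> R) (Kq Kp : V * V -> V) (f0 f1 : V -> R) q0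
    (r C m : R) : is_hamiltonian U K Kq Kp -> 0 < r -> 0 <= C ->
  (forall x, `|x - q0| < r -> U x) ->
  (forall x y, `|x - q0| < r -> `|y - q0| < r -> f0 y - f0 x <= C * `|y - x|) ->
  (forall x y, `|x - q0| < r -> `|y - q0| < r -> f1 y - f1 x <= C * `|y - x|) ->
  (forall x y0 y1 p0 p1, `|x - q0| < r -> `|y0 - q0| < r -> `|y1 - q0| < r ->
    subdiff f0 y0 p0 -> subdiff f1 y1 p1 -> K (x, 2^-1 *: (p0 + p1)) <= m) ->
  forall q v, `|q - q0| < r / 2 ->
    dini (fun y : V => 2^-1 * (f0 y + f1 y)) q v (legendre K q v + m).
Proof.
move=> ham r0 C0 Ur L0 L1 hK q v qr e e0.
have Uq : U q by apply: Ur; apply: lt_trans qr _; lra.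
have cL := @legendre_continuous R n _ _ _ _ ham q v Uq.
have Le : legendre K q v < legendre K q v + e by rewrite ltrDl.
have nL := near_pair1 (continuous_near_lt cL Le).
have qr' : 0 < r / 2 - `|q - q0| by rewrite subr_gt0.
have nr : \forall y \near q, `|y - q0| < r / 2.
  apply: filterS (near_dist q qr') => y; rewrite ltrBrDr; apply: le_lt_trans.
  by have -> : y - q0 = (y - q) + (q - q0); [rewrite addrA subrK|exact: ler_normD].
have [d d0 hd] := near_dist_ray v (filterI nr nL).
apply: filterS2 (nbhs_right_gt 0) (nbhs_right_lt d0) => h h0 /hd{}hd.
apply/ler_addgt0Pr => b b0.
pose c := legendre K q v + m + e.
(* The first smallness condition keeps the minimizers inside the ball, the second makes the error of
   the envelopes at most b. *)
have [tau [t0 tC tb]] : exists tau : R, [/\ 0 < tau, 2 * tau * C < r / 4 & C * (2 * tau * C) <= b].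
  have C1 : 0 < C + 1 by rewrite ltr_wpDl.
  pose s := Num.min (r / 8 / (C + 1)) (b / 2 / ((C + 1) * (C + 1))).
  have s0 : 0 < s by rewrite lt_min !divr_gt0 // mulr_gt0.
  have s1 : s * (C + 1) <= r / 8 by rewrite -ler_pdivlMr // ge_min lexx.
  have s2 : s * ((C + 1) * (C + 1)) <= b / 2 by rewrite -ler_pdivlMr ?mulr_gt0 // ge_min lexx orbT.
  exists s; split=> //; first by lra.
  have : C * C <= (C + 1) * (C + 1) by nra.
  move=> /(ler_wpM2l (ltW s0)); move: s2; move: (s * ((C + 1) * (C + 1))) => *; nra.
have I0 x := @inf_convolutionP f0 q0 r C tau x t0 C0 tC L0.
have I1 x := @inf_convolutionP f1 q0 r C tau x t0 C0 tC L1.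
set F0 := inf_convolution f0 [set y : V | `|y - q0| <= 3 / 4 * r] tau in I0.
set F1 := inf_convolution f1 [set y : V | `|y - q0| <= 3 / 4 * r] tau in I1.
pose Z x := 2^-1 * (F0 x + F1 x).
have ZP x : `|x - q0| < r / 2 -> exists p, [/\ `|p| <= 2 * C, K (x, p) <= m &
    forall x', Z x' <= Z x + pairing p (x' - x) + pairing (x' - x) (x' - x) / (2 * tau)].
  move=> xr; have [y0 [p0 [y0r sd0 p0C _ h0']]] := I0 x xr.
  have [y1 [p1 [y1r sd1 p1C _ h1']]] := I1 x xr.
  exists (2^-1 *: (p0 + p1)); split.
  - rewrite normrZ gtr0_norm // -ler_pdivlMl // invrK.
    by apply: le_trans (ler_normD _ _) _; lra.
  - by apply: (hK x y0 y1) => //; apply: lt_trans xr _; lra.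
  move=> x'; have := h0' x'; have := h1' x'; rewrite /Z pairingZl [pairing (p0 + p1) _]pairingDl.
  by move: (F0 _) (F0 _) (F1 _) (F1 _) (pairing _ _) (pairing _ _) (_ / (2 * tau)) => *; lra.
have ZL x : `|x - q0| < r / 2 -> {for x, continuous Z}.
  move=> xr; apply: local_lipschitz_continuous; apply/local_lipschitzP.
  have xr2 : 0 < r / 2 - `|x - q0| by rewrite subr_gt0.
  exists (n%:R * (2 * C) + n%:R * r / (2 * tau)), (r / 2 - `|x - q0|); split=> //.
    by rewrite addr_ge0 // ?divr_ge0 // ?mulr_ge0 // ltW // mulr_gt0.
  have inB z : `|z - x| < r / 2 - `|x - q0| -> `|z - q0| < r / 2.
    rewrite ltrBrDr; apply: le_lt_trans.
    by have -> : z - q0 = (z - x) + (x - q0); [rewrite addrA subrK|exact: ler_normD].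
  move=> a b' /inB ar /inB br; have [p [pC _ hp]] := ZP a ar.
  rewrite lerBlDl; apply: le_trans (hp b') _; rewrite -addrA lerD2l [leRHS]mulrDl; apply: lerD.
    apply: le_trans (pairing_le _ _) _; rewrite -mulrA ler_wpM2l // ler_wpM2r //.
  rewrite mulrAC ler_pM2r ?invr_gt0 ?mulr_gt0 //; apply: le_trans (pairing_le _ _) _.
  rewrite mulrA ler_wpM2r // ler_wpM2l //.
  have -> : b' - a = (b' - q0) - (a - q0) by rewrite opprB addrA subrK.
  by apply: le_trans (ler_normB _ _) _; lra.
have seg s : 0 <= s <= h -> `|q + s *: v - q0| < r / 2 /\
    legendre K (q + s *: v) v < legendre K q v + e by move=> /hd[].
have := @dini_mean_value R (fun s => Z (q + s *: v)) h c (ltW h0).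
rewrite scale0r addr0 => mv.
have {mv} Zh : Z (q + h *: v) - Z q <= h * c.
  apply: mv => [s /seg[sr _]|s /andP[s0 sh] e1 e10].
    exact: (@continuous_ray _ _ Z q v s (ZL _ sr)).
  have sI : 0 <= s <= h by rewrite s0 ltW.
  have [sr sL] := seg s sI.
  have [p [_ Kp' hp]] := ZP _ sr.
  have sr' : `|q + s *: v - q0| < r by apply: lt_trans sr _; lra.
  have fen := fenchel ham v p (Ur _ sr').
  have v1 : 0 < pairing v v / (2 * tau) + 1.
    by rewrite ltr_wpDl // divr_ge0 ?mulr_ge0 // ?(ltW t0) // (le_trans _ (pairing_sqr_ge v)) // sqr_ge0.
  apply: filterS2 (nbhs_right_gt 0) (nbhs_right_lt (divr_gt0 e10 v1)) => t tp te.
  have := hp (q + (s + t) *: v).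
  have -> : q + (s + t) *: v - (q + s *: v) = t *: v.
    by rewrite scalerDl addrA [X in X - _]addrC addrK.
  rewrite !pairingZl !pairingZr => h1; rewrite lerBlDl; apply: le_trans h1 _.
  rewrite -addrA lerD2l -mulrA -mulrDr ler_wpM2l ?(ltW tp) //.
  have h2 : t * (pairing v v / (2 * tau)) <= e1.
    apply: le_trans (_ : t * (pairing v v / (2 * tau) + 1) <= _).
      by rewrite ler_wpM2l ?(ltW tp) // lerDl.
    by rewrite -ler_pdivlMr // ltW.
  have h3 : pairing p v <= legendre K (q + s *: v) v + K (q + s *: v, p) by exact: fen.
  have h2' : t * pairing v v / (2 * tau) <= e1 by rewrite -mulrA.
  apply: le_trans (lerD h3 h2') _; rewrite lerD2r /c addrAC.
  by apply: lerD => //; exact: ltW.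
have hI : 0 <= h <= h by rewrite lexx ltW.
have [hh _] := seg h hI.
have [? [? [_ _ _ /andP[a0 _] _]]] := I0 _ hh; have [? [? [_ _ _ /andP[a1 _] _]]] := I1 _ hh.
have [? [? [_ _ _ /andP[_ b0'] _]]] := I0 _ qr; have [? [? [_ _ _ /andP[_ b1'] _]]] := I1 _ qr.
move: Zh a0 a1 b0' b1' tb; rewrite /Z -/c.
by move: (h * c) (F0 _) (F0 _) (F1 _) (F1 _) (f0 _) (f0 _) (f1 _) (f1 _) (C * _) => *; lra.
Qed.

End inf_convolution.

Section strict_average.
Context {R : realType} {n : nat}.
Local Notation V := 'rV[R]_n.
Implicit Types (q p v : V).

Fact midpoint_gap (a b c d : R) :
  0 < d -> c = 2^-1 * a + (1 - 2^-1) * b -> c <= 2^-1 * (a + b) - d -> False.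
Proof. lra. Qed.

Lemma near_scale (q0 p : V) (Q : V * V -> Prop) : (\forall z \near (q0, p), Q z) ->
  \forall p' \near p & t \near (0 : R)^'+, forall q, `|q - q0| < t -> Q (q, p').
Proof.
move=> /near_norm[d d0 hd].
apply: near_prodI (near_dist p d0) (nbhs_right_lt d0) _ => p' t pd td q qt.
apply: hd; rewrite [X in X < _](_ : _ = Num.max `|q - q0| `|p' - p|) // gt_max pd andbT.
exact: lt_trans qt td.
Qed.

(** Momenta range over a compact ball. At each pair either one of the closed conditions fails at q0,
    hence in a neighbourhood, or the strict inequality holds and persists with a gap. One radius t
    thus serves for distinct base points and for the gap. *)
Lemma strict_average (q0 : V) (K0 K1 Km L0 L1 : V * V -> R) (a0 a1 b0 b1 m B : R) :
  (forall p, [/\ {for (q0, p) : V * V, continuous K0}, {for (q0, p) : V * V, continuous K1},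
     {for (q0, p) : V * V, continuous Km}, {for (q0, p) : V * V, continuous L0} &
     {for (q0, p) : V * V, continuous L1}]) ->
  (forall p0 p1, K0 (q0, p0) <= a0 -> K1 (q0, p1) <= a1 -> b0 <= L0 (q0, p0) ->
     L1 (q0, p1) <= b1 -> Km (q0, 2^-1 *: (p0 + p1)) < m) ->
  exists2 d, 0 < d & forall t, 0 < t -> t < d -> forall x y0 y1 p0 p1,
    `|x - q0| < t -> `|y0 - q0| < t -> `|y1 - q0| < t -> `|p0| <= B -> `|p1| <= B ->
    K0 (y0, p0) <= a0 -> K1 (y1, p1) <= a1 -> b0 <= L0 (y0, p0) -> L1 (y1, p1) <= b1 ->
    Km (x, 2^-1 *: (p0 + p1)) <= m - t.
Proof.
move=> cont strict.
pose S := [set p : V | `|p| <= B] `*` [set p : V | `|p| <= B].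
have Sc : compact S.
  have c : compact [set p : V | `|p| <= B].
    rewrite (_ : [set p : V | `|p| <= B] = [set p : V | `|p - 0| <= B]).
      exact: compact_ball_rV.
    by apply/seteqP; split=> p /=; rewrite subr0.
  exact: compact_setX.
pose P (z : V * V) (t : R) := forall x y0 y1, `|x - q0| < t -> `|y0 - q0| < t -> `|y1 - q0| < t ->
    K0 (y0, z.1) <= a0 -> K1 (y1, z.2) <= a1 -> b0 <= L0 (y0, z.1) -> L1 (y1, z.2) <= b1 ->
    Km (x, 2^-1 *: (z.1 + z.2)) <= m - t.
have fstP (p0 p1 : V) (Q : V -> R -> Prop) : (\forall p' \near p0 & t \near (0 : R)^'+, Q p' t) ->
    \forall z \near (p0, p1) & t \near (0 : R)^'+, Q z.1 t.
  move=> [[A T] [/= nA nT] AT]; apply: near_prodI (near_fst p1 nA) nT _ => z t za tt.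
  exact: (AT (z.1, t)).
have sndP (p0 p1 : V) (Q : V -> R -> Prop) : (\forall p' \near p1 & t \near (0 : R)^'+, Q p' t) ->
    \forall z \near (p0, p1) & t \near (0 : R)^'+, Q z.2 t.
  move=> [[A T] [/= nA nT] AT]; apply: near_prodI (near_snd p0 nA) nT _ => z t za tt.
  exact: (AT (z.2, t)).
have [d d0 hd] : exists2 d : R, 0 < d & forall t, 0 < t -> t < d -> forall z, S z -> P z t.
  apply: compact_near_right => // -[p0 p1] _.
  have [c0 _ _ cL0 _] := cont p0; have [_ c1 _ _ cL1] := cont p1.
  have [k0|k0] := ltP a0 (K0 (q0, p0)).
    have := fstP _ p1 _ (near_scale (continuous_near_gt c0 k0)).
    by apply: filterS => -[z t] /= h x y0 y1 _ /h; rewrite ltNge => /negP.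
  have [k1|k1] := ltP a1 (K1 (q0, p1)).
    have := sndP p0 _ _ (near_scale (continuous_near_gt c1 k1)).
    by apply: filterS => -[z t] /= h x y0 y1 _ _ /h; rewrite ltNge => /negP.
  have [k2|k2] := ltP (L0 (q0, p0)) b0.
    have := fstP _ p1 _ (near_scale (continuous_near_lt cL0 k2)).
    by apply: filterS => -[z t] /= h x y0 y1 _ /h; rewrite ltNge => /negP.
  have [k3|k3] := ltP b1 (L1 (q0, p1)).
    have := sndP p0 _ _ (near_scale (continuous_near_gt cL1 k3)).
    by apply: filterS => -[z t] /= h x y0 y1 _ _ /h; rewrite ltNge => /negP.
  have km := strict p0 p1 k0 k1 k2 k3; set pm := 2^-1 *: (p0 + p1) in km.
  have [_ _ cm _ _] := cont pm.
  have [e e0 kme] : exists2 e, 0 < e & Km (q0, pm) < m - e by exists ((m - Km (q0, pm)) / 2); lra.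
  have [dm dm0 hdm] := near_norm (continuous_near_lt cm kme).
  have ne : \forall t \near (0 : R)^'+, t < e /\ t < dm.
    by apply: filterS2 (nbhs_right_lt e0) (nbhs_right_lt dm0).
  have dm2 : 0 < dm / 2 by rewrite divr_gt0.
  have nz : \forall z \near ((p0, p1) : V * V), `|z - (p0, p1)| < dm by exact: near_dist.
  apply: near_prodI nz ne _ => -[p0' p1'] t pd [te td] x y0 y1 xt _ _ _ _ _ _ /=.
  have := hdm (x, 2^-1 *: (p0' + p1')) _; move=> /(_ _)/ltW/le_trans; apply; last by lra.
  rewrite [X in X < _](_ : _ = Num.max `|x - q0| `|2^-1 *: (p0' + p1') - pm|) // gt_max.
  rewrite (lt_trans xt td) /= /pm -scalerBr normrZ gtr0_norm //.
  have h1 := norm_pair_fst (p0', p1') (p0, p1); have h2 := norm_pair_snd (p0', p1') (p0, p1).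
  have -> : p0' + p1' - (p0 + p1) = (p0' - p0) + (p1' - p1) by rewrite opprD addrACA.
  have := ler_normD (p0' - p0) (p1' - p1); move: h1 h2 pd => /=.
  by move: (`|_ - (p0, p1)|) => N *; lra.
exists d => // t t0 td x y0 y1 p0 p1 xt y0t y1t p0B p1B k0 k1 k2 k3.
by have := hd t t0 td (p0, p1) (conj p0B p1B) x y0 y1; apply.
Qed.

End strict_average.

(** * Mather's function on a flat *)

Section mather.
Context {R : realType} {n : nat} {M : topologicalType} {A : c2atlas R n M}.
Local Notation V := 'rV[R]_n.
Local Notation e_ := (delta_mx (0 : 'I_1)).
Implicit Types (i j : chart_index A) (x y : M) (q p v : V) (u : M -> R) (w : M -> V).
Hypotheses (M_nonempty : [set: M] !=set0) (M_hausdorff : hausdorff_space M)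
  (M_compact : compact [set: M]) (M_connected : connected [set: M]).

(** [get] returns a least level only if there is one. Attainment for [sub] provides it, as both
    notions of subsolution have the same levels. *)
Lemma critical_valueP (F : cotangent_bundle A -> R) : regular F ->
  (exists u, sub F (cst (critical_value F)) u) /\
  forall b, (exists u, sub F (cst b) u) -> critical_value F <= b.
Proof.
move=> regF; have [a [[u su] amin]] := sub_level_attained M_compact M_connected regF M_nonempty.
pose P := [set alpha : R | (exists u, subsolution alpha F u) /\
   forall beta, (exists u, subsolution beta F u) -> alpha <= beta].
have : P (get P).
  apply: getPex; exists a; split; first by exists u; exact: sub_subsolution.
  by move=> b [v sv]; apply: amin; exists v; exact: subsolution_sub.
move=> [[v sv] vmin]; split; first by exists v; exact: subsolution_sub.
by move=> b [z sz]; apply: vmin; exists z; exact: sub_subsolution.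
Qed.

Lemma chart_ham_shift (F : cotangent_bundle A -> R) w w' i q p : cod i q ->
  chart_ham (shift_form F w) i (q, p) =
  chart_ham (shift_form F w') i (q, p + (shift_comp w i q - shift_comp w' i q)).
Proof.
move=> iq; rewrite /chart_ham !(@shift_form_param _ _ _ _ F) //=.
by rewrite addrA subrK.
Qed.

(** Adding df to the form translates momenta by df, which subtracting f from u undoes. This is why
    the critical value depends on the cohomology class alone. *)
Lemma sub_exact (F : cotangent_bundle A -> R) w w' (l u f : M -> R) :
  regular (shift_form F w) -> regular (shift_form F w') ->
  (forall i, Ck 2 (f \o param i) (cod i)) ->
  (forall i q v, cod i q -> form_comp (w' - w) i v q = 'D_v (f \o param i) q) ->
  sub (shift_form F w) l u -> sub (shift_form F w') l (fun x => u x - f x).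
Proof.
move=> regw regw' fC df su i.
have fd q : cod i q -> differentiable (f \o param i) q by exact: (fC i).1.
split=> [q iq|q v iq e e0].
  have c1 := (su i).1 q iq; have c2 := differentiable_continuous (fd q iq).
  apply/continuous_ptP => e e0; have e2 : 0 < e / 2 by rewrite divr_gt0.
  apply: filterS2 ((continuous_ptP _ _).1 c1 _ e2) ((continuous_ptP _ _).1 c2 _ e2) => y /= h1 h2.
  have -> : u (param i y) - f (param i y) - (u (param i q) - f (param i q)) =
    (u (param i y) - u (param i q)) - (f (param i y) - f (param i q)) by ring.
  by apply: le_trans (ler_normB _ _) _; lra.
have e2 : 0 < e / 2 by rewrite divr_gt0.
set D := shift_comp w' i q - shift_comp w i q.
have Dv : 'D_v (f \o param i) q = pairing D v.
  rewrite (derive_gradient v (fd q iq)); congr (pairing _ v).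
  by apply/rowP => k; rewrite !mxE -df // /form_comp pairingBl.
have [p pmax] := maximizer_exists (regw i) v iq.
have LE : legendre (chart_ham (shift_form F w) i) q v - pairing D v <=
    legendre (chart_ham (shift_form F w') i) q v.
  have -> := maximizer_legendre pmax.
  have := fenchel (regw' i) v (p - D) iq; rewrite pairingBl.
  have -> : (shift_form F w' \o cotangent_param i) (q, p - D) =
      (shift_form F w \o cotangent_param i) (q, p).
    rewrite -/(chart_ham (shift_form F w') i) -/(chart_ham (shift_form F w) i).
    rewrite (chart_ham_shift F w' w) //; congr (chart_ham _ _ (_, _)).
    by rewrite -/D subrK.
  by rewrite /chart_ham => h; rewrite -lerBlDr in h; move: h; rewrite addrAC.
have d1 := (su i).2 q v iq (e / 2) e2.
have d2 := differentiable_curve v (fd q iq) e2.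
apply: filterS3 (nbhs_right_gt 0) d1 d2 => h h0 /= h1.
rewrite Dv -[h *: pairing D v]/(h * pairing D v) distrC => /ler_normlW h2.
have h3 := ler_wpM2l (ltW h0) LE; move: h1 h2 h3; rewrite !mulrDr mulrN.
by move: (h * legendre _ _ _) (h * legendre _ _ _) (h * pairing _ _) (h * l _) (u _) (f _) => *; lra.
Qed.

Lemma local_lipschitz_average (f0 f1 : V -> R) q : local_lipschitz f0 q -> local_lipschitz f1 q ->
  local_lipschitz (fun y : V => 2^-1 * (f0 y + f1 y)) q.
Proof.
move=> /local_lipschitzP[C [r [C0 r0 hf]]] /local_lipschitzP[D [s [D0 s0 hg]]].
apply/local_lipschitzP; exists (C + D), (Num.min r s).
split=> [||x y]; rewrite ?addr_ge0 ?lt_min ?r0 // => /andP[xr xs] /andP[yr ys].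
have h1 := hf x y xr yr; have h2 := hg x y xs ys.
have c1 : 0 <= C * `|y - x| by exact: mulr_ge0.
have c2 : 0 <= D * `|y - x| by exact: mulr_ge0.
by rewrite mulrDl; lra.
Qed.

Variables (g : riemannian_metric A) (G H : cotangent_bundle A -> R).
Hypotheses (G_tonelli : tonelli g G) (H_tonelli : tonelli g H) (GH_commute : poisson_commute G H).

Lemma average_strict_subsolution (w0 w1 : closed_form A) (a0 a1 b0 b1 : R) (u0 u1 : M -> R) :
  let wm := 2^-1 *: (w0 + w1) in b1 < b0 ->
  sub (shift_form G w0) (cst a0) u0 -> sub (shift_form G w1) (cst a1) u1 ->
  (forall i q p, cod i q -> subdiff (u0 \o param i) q p ->
     b0 <= chart_ham (shift_form H w0) i (q, p)) ->
  sub (shift_form H w1) (cst b1) u1 ->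
  exists2 d, 0 < d &
    sub (shift_form G wm) (cst (2^-1 * (a0 + a1) - d)) (fun x => 2^-1 * (u0 x + u1 x)).
Proof.
move=> wm bb s0 s1 low s1H.
have cw (w : closed_form A) : is_closed A w by have := closed_formP w; exact: asboolP.
have regG (w : closed_form A) : regular (shift_form G w) by exact: tonelli_regular G_tonelli (cw w).
have regH (w : closed_form A) : regular (shift_form H w) by exact: tonelli_regular H_tonelli (cw w).
have L0 i q : cod i q -> local_lipschitz (u0 \o param i) q.
  exact: (sub_lipschitz (regG w0) s0 (fun _ => lexx _)).
have L1 i q : cod i q -> local_lipschitz (u1 \o param i) q.
  exact: (sub_lipschitz (regG w1) s1 (fun _ => lexx _)).
apply: sub_improve => // [i q iq|x].
  by apply: local_lipschitz_average; [exact: L0|exact: L1].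
have ix := dom_chart_at A x; set i := chart_at A x in ix.
have iq := cod_chart ix; set q0 := chart i x in iq.
have wmE q : shift_comp wm i q = 2^-1 *: (shift_comp w0 i q + shift_comp w1 i q).
  by apply/rowP => k; rewrite !mxE /form_comp -pairingDl -pairingZl.
pose Km := chart_ham (shift_form G wm) i.
have strict p0 p1 : chart_ham (shift_form G w0) i (q0, p0) <= a0 ->
    chart_ham (shift_form G w1) i (q0, p1) <= a1 ->
    b0 <= chart_ham (shift_form H w0) i (q0, p0) ->
    chart_ham (shift_form H w1) i (q0, p1) <= b1 -> Km (q0, 2^-1 *: (p0 + p1)) < 2^-1 * (a0 + a1).
  rewrite (chart_ham_shift G w0 wm p0 iq) (chart_ham_shift G w1 wm p1 iq).
  rewrite (chart_ham_shift H w0 wm p0 iq) (chart_ham_shift H w1 wm p1 iq) -/Km.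
  (* P0 and P1 are the two momenta read relative to the common form wm, so that a single G and a
     single H are evaluated at both; the two translations cancel in the midpoint. *)
  set P0 := p0 + _; set P1 := p1 + _ => g0 g1 l0 l1.
  have P01 : P0 != P1.
    apply/eqP => E; move: l0; rewrite E => l0; have := le_trans l0 l1.
    by rewrite leNgt bb.
  have mid : 2^-1 *: (p0 + p1) = 2^-1 *: (P0 + P1).
    rewrite /P0 /P1 wmE; apply/rowP => k; rewrite !mxE.
    by field.
  rewrite mid; set pm := 2^-1 *: (P0 + P1).
  have n0 : P0 != pm.
    apply: contra_neq P01 => E; move: E; rewrite /pm scalerDr => E.
    by apply/rowP => k; have /rowP/(_ k) := E; rewrite !mxE; lra.
  have n1 : P1 != pm.
    apply: contra_neq P01 => E; move: E; rewrite /pm scalerDr => E.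
    by apply/rowP => k; have /rowP/(_ k) := E; rewrite !mxE; lra.
  (* The tangent inequality at the midpoint is applied towards both ends; its linear terms are
     opposite and cancel. *)
  have c0 := ham_conv (regG wm i) iq n0; have c1 := ham_conv (regG wm i) iq n1.
  have opp : P1 - pm = - (P0 - pm).
    by apply/rowP => k; rewrite !mxE; field.
  rewrite opp pairingNr in c1.
  move: c0 c1 g0 g1; rewrite -/(chart_ham (shift_form G wm) i) -/Km.
  by move: (Km _) (Km _) (Km _) (pairing _ _) => *; lra.
have [C0 nC0] := ham_coer (regG w0 i) 1 iq.
have [C1 nC1] := ham_coer (regG w1 i) 1 iq.
have cont p : [/\ {for (q0, p) : V * V, continuous (chart_ham (shift_form G w0) i)},
     {for (q0, p) : V * V, continuous (chart_ham (shift_form G w1) i)},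
     {for (q0, p) : V * V, continuous Km},
     {for (q0, p) : V * V, continuous (chart_ham (shift_form H w0) i)} &
     {for (q0, p) : V * V, continuous (chart_ham (shift_form H w1) i)}].
  by split; [exact: (ham_continuous (regG w0 i))|exact: (ham_continuous (regG w1 i))|
    exact: (ham_continuous (regG wm i))|exact: (ham_continuous (regH w0 i))|
    exact: (ham_continuous (regH w1 i))].
(* Through the coercivity of G, subdifferentials at levels a0 and a1 are bounded by B, so the
   relevant momenta lie in a compact set. *)
pose B := Num.max (a0 + C0) (a1 + C1).
have [d d0 hd] := @strict_average R n q0 _ _ Km _ _ a0 a1 b0 b1 _ B cont strict.
have /local_lipschitzP[D0 [r0 [D00 r00 hD0]]] := L0 i q0 iq.
have /local_lipschitzP[D1 [r1 [D10 r10 hD1]]] := L1 i q0 iq.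
have [s s0' hs] := near_norm (filterI (near_cod iq) (filterI nC0 nC1)).
pose t := Num.min (d / 2) (Num.min s (Num.min r0 r1)).
have t0 : 0 < t by rewrite !lt_min s0' r00 r10 divr_gt0.
have td : t < d by apply: le_lt_trans (_ : d / 2 < d); [rewrite /t ge_min lexx|lra].
have ts : t <= s by rewrite /t !ge_min lexx !orbT.
have tr0 : t <= r0 by rewrite /t !ge_min lexx !orbT.
have tr1 : t <= r1 by rewrite /t !ge_min lexx !orbT.
exists i, t; split=> //.
have t2 : 0 < t / 2 by rewrite divr_gt0.
apply: filterS (near_dist q0 t2) => q qt v.
apply: (@local_average R n (cod i) _ _ _ (u0 \o param i) (u1 \o param i) q0 t (D0 + D1) _
  (regG wm i) t0) => //.
- exact: addr_ge0.
- by move=> y yt; have [] := hs y (lt_le_trans yt ts).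
- move=> y z yt zt; apply: le_trans (hD0 y z (lt_le_trans yt tr0) (lt_le_trans zt tr0)) _.
  by rewrite ler_wpM2r // lerDl.
- move=> y z yt zt; apply: le_trans (hD1 y z (lt_le_trans yt tr1) (lt_le_trans zt tr1)) _.
  by rewrite ler_wpM2r // lerDr.
move=> y y0 y1 p0 p1 yt y0t y1t sd0 sd1.
have [iy0 [+ _]] := hs y0 (lt_le_trans y0t ts) => /(_ p0) B0.
have [iy1 [_ +]] := hs y1 (lt_le_trans y1t ts) => /(_ p1) B1.
have g0 : chart_ham (shift_form G w0) i (y0, p0) <= a0 := local_sub_subdiff (regG w0 i) (s0 i) iy0 sd0.
have g1 : chart_ham (shift_form G w1) i (y1, p1) <= a1 := local_sub_subdiff (regG w1 i) (s1 i) iy1 sd1.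
have l1 : chart_ham (shift_form H w1) i (y1, p1) <= b1 := local_sub_subdiff (regH w1 i) (s1H i) iy1 sd1.
apply: (hd t t0 td y y0 y1 p0 p1) => //.
- by rewrite le_max; apply/orP; left; move: B0 g0; rewrite /chart_ham mul1r; move: (_ (y0, p0)) => *; lra.
- by rewrite le_max; apply/orP; right; move: B1 g1; rewrite /chart_ham mul1r; move: (_ (y1, p1)) => *; lra.
- exact: low.
Qed.

(** Used for both orders of the pair, this gives constancy on the flat. *)
Lemma flat_le (C : set (H1 A)) c0 c1 : is_flat (mather_alpha G) C -> C c0 -> C c1 ->
  mather_alpha H c0 <= mather_alpha H c1.
Proof.
move=> [_ aff] Cc0 Cc1; rewrite leNgt; apply/negP => lt.
set h0 := mather_alpha H c0 in lt; set h1 := mather_alpha H c1 in lt.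
pose w0 : closed_form A := repr c0; pose w1 : closed_form A := repr c1.
have cw (w : closed_form A) : is_closed A w by have := closed_formP w; exact: asboolP.
have regG (w : closed_form A) : regular (shift_form G w) by exact: tonelli_regular G_tonelli (cw w).
have regH (w : closed_form A) : regular (shift_form H w) by exact: tonelli_regular H_tonelli (cw w).
have br (w : closed_form A) : commuting (shift_form G w) (shift_form H w).
  exact: shift_bracket G_tonelli H_tonelli GH_commute (cw w).
(* With a quarter of the supposed gap, the bands of width e around h0 and h1 stay disjoint. *)
pose e := (h0 - h1) / 4; have e0 : 0 < e by rewrite divr_gt0 // subr_gt0.
have kam (c : H1 A) (w := repr c : closed_form A) : exists u, [/\
    sub (shift_form G w) (cst (mather_alpha G c)) u,
    sub (shift_form H w) (cst (mather_alpha H c + e)) u &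
    forall i q p, cod i q -> subdiff (u \o param i) q p ->
      mather_alpha H c - e <= chart_ham (shift_form H w) i (q, p)].
  have [exG _] := critical_valueP (regG w); have [exH minH] := critical_valueP (regH w).
  exact: (approximate_weak_kam M_compact M_hausdorff M_connected M_nonempty (regG w) (regH w)
    (br w) exG exH minH e0).
have [u0 [s0 _ low]] := kam c0; have [u1 [s1 s1H _]] := kam c1.
have bb : h1 + e < h0 - e by rewrite /e; lra.
have [d d0 sm] := average_strict_subsolution bb s0 s1 low s1H.
set wm := 2^-1 *: (w0 + w1) in sm.
have half : 0 < (2^-1 : R) < 1 by apply/andP; split; lra.
have := aff c0 c1 Cc0 Cc1 _ half; set cm := (_ *: c0 + _).
have cmE : cm = H1_class wm.
  rewrite /wm H1_classZ H1_classD !reprH1K /cm -[H1_scale _ _]/(2^-1 *: (c0 + c1)).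
  by rewrite scalerDr; congr (_ + _ *: _); lra.
(* The representative chosen for the midpoint class need not be wm, but differs from it by an exact
   form. *)
have [f [fC df]] : is_exact A (repr cm - wm : closed_form A).
  by apply/H1_classP; rewrite reprH1K.
have := sub_exact (regG wm) (regG (repr cm)) fC df sm => sm'.
have [_ minG] := critical_valueP (regG (repr cm)).
have := minG _ (ex_intro _ _ sm'); rewrite -/(mather_alpha G cm) => le ale.
exact: midpoint_gap d0 ale le.
Qed.

End mather.

Theorem theorem5p3 (R : realType) (n : nat) (M : topologicalType)
    (A : c2atlas R n M) (g : riemannian_metric A)
    (M_nonempty : [set: M] !=set0) (M_hausdorff : hausdorff_space M)
    (M_compact : compact [set: M]) (M_connected : connected [set: M])
    (G H : cotangent_bundle A -> R)
    (G_tonelli : tonelli g G) (H_tonelli : tonelli g H)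
    (GH_commute : poisson_commute G H)
    (C : set (H1 A)) (C_flat : is_flat (mather_alpha G) C) :
  is_flat (mather_alpha H) C.
Proof.
split; first exact: C_flat.1.
have const c c' : C c -> C c' -> mather_alpha H c = mather_alpha H c'.
  move=> Cc Cc'; apply/eqP; rewrite eq_le.
  have le c1 c2 := @flat_le R n M A M_nonempty M_hausdorff M_compact M_connected g G H
    G_tonelli H_tonelli GH_commute C c1 c2 C_flat.
  by apply/andP; split; exact: le.
move=> c0 c1 Cc0 Cc1 t /andP[t0 t1].
have Ct : C (t *: c0 + (1 - t) *: c1).
  exact: (set_mem (C_flat.1 c0 c1 (Itv01 (ltW t0) (ltW t1)) (mem_set Cc0) (mem_set Cc1))).
by rewrite (const _ c0 Ct Cc0) (const c1 c0 Cc1 Cc0) -mulrDl addrC subrK mul1r.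
Qed.
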